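(* Suppose the assumptions on the random data and discretisation parameters stated in the context hold with $p_*>2$. Let $2<p<p_*$ and $q=2p/(p-2)$. Suppose the (linear or nonlinear) functional $\mathcal Q:\mathrm C\to\mathbb R$ satisfies the Lipschitz condition $$|\mathcal Q(\phi(\omega,\cdot))-\mathcal Q(\tilde\phi(\omega,\cdot))|\ \le\ C'(\omega)\,\|\phi(\omega,\cdot)-\tilde\phi(\omega,\cdot)\|_\infty\qquad\text{for all }\phi,\tilde\phi\in L_p(\Omega;L_\infty),$$ where $C'\in L_q(\Omega)$. Let $Q(\omega)=\mathcal Q(\phi(\omega,\cdot))$, with $\phi$ the scalar flux, and $Q_h(\omega)=\mathcal Q(\Phi^h(\omega,\cdot))$. Let $h_\ell=s\,h_{\ell-1}$, $\ell\ge1$, for a fixed $s\in(0,1)$ and fixed $h_0\in(0,1)$, and let $Y_\ell=Q_{h_\ell}-Q_{h_{\ell-1}}$ with $Q_{h_{-1}}:=0$. Then $$\big|\mathbb E[Q-Q_h]\big|=\mathcal O(h^{\eta})\qquad\text{and}\qquad \mathbb V[Y_\ell]=\mathcal O(h_\ell^{2\eta}),$$ with hidden constants independent of $h$ and of $\ell$, respectively.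
   Context: Spaces. For an interval $I\subset[0,1]$, $\mathrm C(I)$ is the space of uniformly continuous functions on $I$ with the sup norm, $\mathrm C=\mathrm C([0,1])$; for $0<\xi\le1$, $\mathrm C^\xi(I)$ is the H\''older space with norm $\|g\|_\infty+\sup_{x\ne y\in I}|g(x)-g(y)|/|x-y|^\xi$. Fix a partition $0=c_1<\dots<c_J=1$, $J\ge2$. $\mathrm C^\xi_{pw}$ is the space of $g\in L_\infty[0,1]$ with $g|_{(c_j,c_{j+1})}\in\mathrm C^\xi(c_j,c_{j+1})$ for $1\le j\le J-1$ (value at $c_j$: limit from the right for $j<J$, from the left for $j=J$), normed by $\|g\|_{\xi,pw}=\max_{1\le j\le J-1}\|g\|_{\mathrm C^\xi(c_j,c_{j+1})}$. $L_p(\Omega;X)$ are Bochner spaces over a probability space $(\Omega,\mathbb P)$. In the Lipschitz condition, $\phi,\tilde\phi$ range over those fields for which $\mathcal Q(\phi(\omega,\cdot)),\mathcal Q(\tilde\phi(\omega,\cdot))$ are defined, i.e. with realisations in $\mathrm C$. Random data. $\sigma_S,\sigma,f$ are random fields on $[0,1]$; $\sigma_A=\sigma-\sigma_S$; $\sigma_S,\sigma_A,\sigma$ are positive-valued (for every $\omega$ with positive infimum, and realisations of $\sigma,\sigma_S,f$ in $\mathrm C_{pw}^\eta$). For some $\eta\in(0,1)$: (a) $\sigma,\sigma_S\in L_t(\Omega;\mathrm C^\eta_{pw})$ for all $t\in[1,\infty)$; (b) $((\sigma_S)_{\min})^{-1},((\sigma_A)_{\min})^{-1}\in L_t(\Omega)$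 for all $t\in[1,\infty)$; (c) $f\in L_{p_*}(\Omega;\mathrm C^\eta_{pw})$, where $p_*\in(1,\infty]$. Subscripts $\min,\max$ denote infimum and supremum over $[0,1]$; $\overline a=\max\{1,a\}$, $\underline a=\min\{a,1\}$. Exact solution (pathwise). $\phi=\phi(\omega,\cdot)$ is the scalar flux $\phi(x)=\frac12\int_{-1}^1\psi(x,\mu)\,d\mu$ of the solution of $\mu\,\partial_x\psi+\sigma\psi=\sigma_S\phi+f$, $x\in(0,1)$, $\mu\in[-1,1]$, with $\psi(0,\mu)=0$ for $\mu>0$, $\psi(1,\mu)=0$ for $\mu<0$; equivalently the unique solution of $\phi(x)=\frac12\int_0^1E_1(|\int_x^y\sigma|)(\sigma_S\phi+f)(y)\,dy$, with $E_1(z)=\int_1^\infty e^{-tz}\,dt/t$. Discrete solution for deterministic data. Meshes $0=x_0<\dots<x_M=1$ contain all $c_j$; $I_j=(x_{j-1},x_j)$, $h_j=|I_j|$, diameter $h=\max_jh_j\le\rho\min_jh_j$ with $\rho\ge1$ fixed. The double Gauss rule has nodes $\mu_{\pm k}=\pm\mu_k$ and weights $w_{\pm k}=w_k$, $k=1,\dots,N$, where $(\mu_k,w_k)_{k=1}^N$ is the $N$-point Gauss--Legendre rule on $[0,1]$. $V^h$ is the space of continuous piecewise linear functions on the mesh; $\mathcal P^hv$ is piecewise constant, equal on $I_j$ to $v$ at the midpoint of $I_j$. For $\mu\ne0$, $\mathcal S^h_\mu g=u^h\in V^h$ is defined by $\int_{I_j}(\mu\frac{du^h}{dx}+(\mathcal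 P^h\sigma)u^h)=\int_{I_j}g$, $j=1,\dots,M$, with $u^h(0)=0$ if $\mu>0$, $u^h(1)=0$ if $\mu<0$; $\mathcal K^{h,N}g=\frac12\sum_{|k|=1}^Nw_k\mathcal S^h_{\mu_k}g$. The discrete solution $\phi^{h,N}\in V^h$ solves $\phi^{h,N}=\mathcal K^{h,N}\mathcal P^h(\sigma_S\phi^{h,N}+f)$. Stability condition. $\mathcal R_1(\sigma,\sigma_S)=2\overline{\sigma_{\max}}^{1/2}\frac{\sigma_{\max}}{\sigma_{\min}}(1-\|\sigma_S/\sigma\|_\infty)^{-1}$ and $\mathcal R_3(\sigma,\sigma_S)=K\frac{(\sigma_S)_{\max}}{(\sigma_S)_{\min}}\big(\frac{\overline{\sigma_{\max}}}{\underline{\sigma_{\min}}}\big)^3\overline{\|\sigma\|_{\eta,pw}}\,\mathcal R_1(\sigma,\sigma_S)$. The stability condition for $(h,N)$ is $$(h^\eta+h\log N+N^{-1})^{-1}\ge\mathcal R_3(\sigma,\sigma_S).\qquad(\ast)$$ Here $K\ge1$ is a fixed constant, independent of the data, the mesh and $N$, such that for all admissible deterministic data, all meshes $0=x_0<\dots<x_M=1$ that contain all $c_j$ and satisfy $\max_jh_j\le\rho\min_jh_j$, and all $N\ge2$, $(\ast)$ implies that $I-\mathcal K^{h,N}\mathcal P^h\sigma_S$ is invertible on $\mathrm C$ with norm of the inverse at most $c\rho\frac{\overline{\sigma_{\max}}}{\sigma_{\min}}\frac{(\sigma_S)_{\max}}{(\sigma_S)_{\min}}\overline{(\sigma_S)_{\max}}\,\mathcal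 R_1(\sigma,\sigma_S)$, with $c$ independent of the data, the mesh and $N$. Choice of parameters. For each mesh diameter $h$, $N=N(h)=\lceil c_0h^{-\eta}\rceil$ with $c_0>0$ independent of $h,\omega$ and large enough that $\log N(h)\ge1$. Let $0<h<1$ be deterministic. For $\omega\in\Omega$, $h_\omega^{\max}$ is the largest value of $h$ for which $(\ast)$ holds with $\sigma=\sigma(\omega,\cdot)$, $\sigma_S=\sigma_S(\omega,\cdot)$ and $N=N(h_\omega^{\max})$; $h_\omega=\min\{h,h_\omega^{\max}\}$; and $\Phi^h(\omega,x)=\phi^{h_\omega,N(h_\omega)}(\omega,x)$, computed on a mesh $0=x_0<\dots<x_M=1$ of diameter $\max_jh_j=h_\omega$ that contains all $c_j$ and satisfies $\max_jh_j\le\rho\min_jh_j$. *)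

(* Defs.v *)
From HB Require Import structures.
From mathcomp Require Import all_boot all_order all_algebra.
From mathcomp Require Import all_classical all_reals all_analysis.

Set Implicit Arguments.
Unset Strict Implicit.
Unset Printing Implicit Defensive.

Import Order.TTheory GRing.Theory Num.Theory.
Import numFieldNormedType.Exports.

Local Open Scope classical_set_scope.
Local Open Scope ring_scope.

(* Functions on [0,1] are represented by functions R -> R whose values outside
   [0,1] are irrelevant: every notion below depends only on the restriction to
   [0,1] (or to the indicated subinterval).  A partition
   0 = x_0 < x_1 < ... < x_M = 1 is represented, as in the library, by the
   sequence xs = [:: x_1; ...; x_M] with itv_partition 0 1 xs, so that, counting
   cells from 0, the j-th cell is ](0 :: xs)`_j, xs`_j[ for j < size xs. *)

Section function_spaces.
Context {R : realType}.
Implicit Types (D : set R) (g u : R -> R) (cs xs : seq R).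

Definition unit_itv : set R := `[0, 1].

Definition supnorm D g : \bar R := ereal_sup [set `|g x|%:E | x in D].

(* A function on [0,1] is uniformly continuous iff it is continuous there. *)
Definition C01 : set (R -> R) := [set u | {within unit_itv, continuous u}].

(* Equal to +oo when g is not Hoelder continuous with exponent xi on D. *)
Definition hoelder_norm (xi : R) D g : \bar R :=
  (supnorm D g +
   ereal_sup [set r | exists x y, [/\ D x, D y, x != y &
                 r = (`|g x - g y| / `|x - y| `^ xi)%:E]])%E.

Definition cell xs (j : nat) : set R := `](0 :: xs)`_j, xs`_j[.

Definition pw_norm (xi : R) cs g : \bar R :=
  (\big[maxe/0]_(j < size cs) hoelder_norm xi (cell cs j) g)%E.

Definition Cpw (xi : R) cs : set (R -> R) :=
  [set g | [/\ (pw_norm xi cs g < +oo)%E,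
      forall j, (j < size cs)%N ->
        g x @[x --> ((0 :: cs)`_j)^'+] --> g (0 :: cs)`_j
    & g x @[x --> 1^'-] --> g 1]].

Definition Linfnorm g : \bar R :=
  'N[mrestr lebesgue_measure (measurable_itv `[0%R, 1%R])]_+oo[EFin \o g]%E.

Definition Linf : set (R -> R) :=
  [set g | measurable_fun unit_itv g /\ (Linfnorm g < +oo)%E].

Definition fmin g : R := inf (g @` unit_itv).
Definition fmax g : R := sup (g @` unit_itv).

End function_spaces.

Section bochner_spaces.
Context {d : measure_display} {T : measurableType d} {R : realType}.
Variable P : probability T R.
Implicit Types (X : set (R -> R)) (N : (R -> R) -> \bar R) (F : T -> R -> R).

Definition random_field F :=
  forall x, unit_itv x -> measurable_fun setT (fun w => F w x).

Definition simple_field X F :=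
  [/\ finite_set (range F), forall w, X (F w)
    & forall g, measurable (F @^-1` [set g])].

Definition strongly_measurable X N F :=
  exists s : nat -> T -> R -> R, (forall n, simple_field X (s n)) /\
    {ae P, forall w, N (s n w \- F w) @[n --> \oo] --> 0%E}.

(* L_p(Omega; X), for X normed by N *)
Definition bochner X N (p : \bar R) F :=
  [/\ forall w, X (F w), strongly_measurable X N F
    & ('N[P]_p[N \o F] < +oo)%E].

End bochner_spaces.

Section transport.
Context {R : realType}.
Implicit Types (sigma sigmaS f phi g u v : R -> R) (cs xs : seq R).

Definition admissible (eta : R) cs sigma sigmaS :=
  [/\ Cpw eta cs sigma, Cpw eta cs sigmaS,
      0 < fmin sigma, 0 < fmin sigmaS & 0 < fmin (sigma \- sigmaS)].

(* The data may jump at the points of cs, so the differential equation is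
   imposed classically off cs, and psi(., mu) is continuous on all of [0,1].
   At mu = 0 the equation degenerates to sigma psi = sigmaS phi + f (the
   derivative is multiplied by 0), and no regularity in x is required. *)
Definition transport_solution cs sigma sigmaS f (psi : R -> R -> R) phi :=
  [/\ forall mu, -1 <= mu <= 1 -> mu != 0 ->
        {within unit_itv, continuous (psi^~ mu)},
      forall mu x, -1 <= mu <= 1 -> 0 < x < 1 -> x \notin cs ->
        (mu != 0 -> derivable (psi^~ mu) x 1) /\
        mu * derive1 (psi^~ mu) x + sigma x * psi x mu = sigmaS x * phi x + f x,
      forall mu, 0 < mu <= 1 -> psi 0 mu = 0
    & forall mu, -1 <= mu < 0 -> psi 1 mu = 0].

Definition scalar_flux cs sigma sigmaS f phi :=
  C01 phi /\ exists psi, transport_solution cs sigma sigmaS f psi phi /\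
    forall x, unit_itv x ->
      lebesgue_measure.-integrable `[-1, 1] (EFin \o psi x) /\
      phi x = 2^-1 * \int[lebesgue_measure]_(mu in `[-1, 1]) psi x mu.

(* The N-point Gauss rule on [0,1]: N nodes, exact in degree <= 2 N - 1. *)
Definition gauss_legendre (N : nat) (mu w : 'I_N -> R) :=
  [/\ forall k, unit_itv (mu k),
      forall k l : 'I_N, (k < l)%N -> mu k < mu l
    & forall p : {poly R}, (size p <= N.*2)%N ->
        \sum_(k < N) w k * p.[mu k] =
        \int[lebesgue_measure]_(x in unit_itv) p.[x]].

Definition mesh_width xs : R :=
  \big[Num.max/0]_(j < size xs) (xs`_j - (0 :: xs)`_j).

Definition mesh (rho : R) cs xs :=
  [/\ itv_partition 0 1 xs, {subset cs <= xs}
    & forall j, (j < size xs)%N ->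
        mesh_width xs <= rho * (xs`_j - (0 :: xs)`_j)].

Definition Vh xs : set (R -> R) :=
  [set u | {within unit_itv, continuous u} /\
    forall j, (j < size xs)%N -> exists a b, forall x, cell xs j x ->
      u x = a * x + b].

Definition Ph xs v (x : R) : R :=
  \sum_(j < size xs) v (((0 :: xs)`_j + xs`_j) / 2) * \1_(cell xs j) x.

Definition Sh_spec xs sigma (mu : R) g : set (R -> R) :=
  [set u | [/\ Vh xs u,
      forall j, (j < size xs)%N ->
        \int[lebesgue_measure]_(x in cell xs j)
           (mu * derive1 u x + Ph xs sigma x * u x) =
        \int[lebesgue_measure]_(x in cell xs j) g x,
      0 < mu -> u 0 = 0 & mu < 0 -> u 1 = 0]].

(* For mu != 0, Sh_spec determines u on [0,1] uniquely. *)
Definition Sh xs sigma (mu : R) g : R -> R := get (Sh_spec xs sigma mu g).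

Definition Kh xs (N : nat) (mu w : 'I_N -> R) sigma g (x : R) : R :=
  2^-1 * \sum_(k < N) w k * (Sh xs sigma (mu k) g x + Sh xs sigma (- mu k) g x).

Definition discrete_flux xs (N : nat) (mu w : 'I_N -> R) sigma sigmaS f phi :=
  Vh xs phi /\
  {in unit_itv, phi =1 Kh xs mu w sigma (Ph xs (sigmaS \* phi \+ f))}.

Definition inverse_bounded (A : (R -> R) -> (R -> R)) (B : R) :=
  forall g, C01 g -> exists u, [/\ C01 u, {in unit_itv, A u =1 g},
    forall v, C01 v -> {in unit_itv, A v =1 g} -> {in unit_itv, v =1 u}
    & (supnorm unit_itv u <= B%:E * supnorm unit_itv g)%E].

Definition R1 sigma sigmaS : R :=
  2 * Num.sqrt (Num.max 1 (fmax sigma)) * (fmax sigma / fmin sigma) *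
  (1 - fine (supnorm unit_itv (fun x => sigmaS x / sigma x)))^-1.

Definition R3 (eta : R) cs (K : R) sigma sigmaS : R :=
  K * (fmax sigmaS / fmin sigmaS) *
  (Num.max 1 (fmax sigma) / Num.min (fmin sigma) 1) ^+ 3 *
  Num.max 1 (fine (pw_norm eta cs sigma)) * R1 sigma sigmaS.

Definition stability_condition (eta : R) cs K sigma sigmaS (h : R) (N : nat) :=
  R3 eta cs K sigma sigmaS <= (h `^ eta + h * ln N%:R + N%:R^-1)^-1.

Definition stability_constant (eta : R) cs (rho K : R) :=
  1 <= K /\
  exists c : R, forall sigma sigmaS xs N (mu w : 'I_N -> R),
    admissible eta cs sigma sigmaS -> mesh rho cs xs -> (2 <= N)%N ->
    gauss_legendre mu w ->
    stability_condition eta cs K sigma sigmaS (mesh_width xs) N ->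
    inverse_bounded
      (fun u => u \- Kh xs mu w sigma (Ph xs (sigmaS \* u)))
      (c * rho * (Num.max 1 (fmax sigma) / fmin sigma) *
       (fmax sigmaS / fmin sigmaS) * Num.max 1 (fmax sigmaS) *
       R1 sigma sigmaS).

Definition N_of (eta c0 h : R) : nat := `|Num.ceil (c0 * h `^ (- eta))|%N.

Definition stable_widths (eta : R) cs K c0 sigma sigmaS : set R :=
  [set h | 0 < h /\
    stability_condition eta cs K sigma sigmaS h (N_of eta c0 h)].

(* hmax is the largest element of the set of stable widths whenever there is
   one.  Since N_of jumps, that set need not contain its supremum for every
   realisation of the data; then any element of it is allowed as hmax. *)
Definition largest_stable_width (eta : R) cs K c0 sigma sigmaS (hmax : R) :=
  let S := stable_widths eta cs K c0 sigma sigmaS in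
  S hmax /\ forall m, S m -> ubound S m -> hmax = m.

End transport.

(* The random field Phi is Phi^h: for every w, the discrete flux on some mesh of
   width h_w = min(h, hmax w), with N(h_w) quadrature points per half range.
   This is a condition on each h separately, since a quasi-uniform mesh of exact
   width h_w containing cs need not exist when h_w is large. *)
Definition sample_approximation {T : Type} {R : realType}
    (eta : R) (cs : seq R) (rho c0 : R) (mu wt : forall N, 'I_N -> R)
    (sigma sigmaS f : T -> R -> R) (hmax : T -> R) (h : R)
    (Phi : T -> R -> R) :=
  forall w, let hw := Num.min h (hmax w) in
    exists xs, [/\ mesh rho cs xs, mesh_width xs = hw
      & discrete_flux xs (@mu (N_of eta c0 hw)) (@wt (N_of eta c0 hw))
          (sigma w) (sigmaS w) (f w) (Phi w)].

Definition level_difference {T : Type} {R : realType} (Q : R -> T -> R)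
    (hs : nat -> R) (l : nat) (w : T) : R :=
  Q (hs l) w - (if l is l'.+1 then Q (hs l') w else 0).

(* Main.v *)
(** Write e for the error of the scalar flux. Everything rests on a pathwise
    estimate |e| <= C F Z^11 h_omega^eta, where F is the norm of f, Z collects
    the norms of sigma, sigma_S and the inverses of min sigma_S, min sigma_A,
    and C is deterministic.

    Quadrature error. The increments in mu of the angular flux psi(x, mu) are
    dominated by those of an explicit nondecreasing function of mu, made of one
    exponential layer per jump of the data and a Hoelder term. A Koksma
    inequality then bounds the error of the double Gauss rule by the
    discrepancy of the rule, which is O(1/N): the discrepancy is orthogonal to
    sin(m theta) for m < 2N and grows at most linearly in theta, so that
    testing it against a kernel concentrated at scale 1/N makes it small.

    Spatial error. For fixed mu, a discrete maximum principle bounds the error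
    of the box scheme by its consistency error, divided by sigma_min or by mu.
    The sum of w_k / mu_k equals twice a harmonic number, whence h log N.

    The scattering term feeds e back into itself with a factor close to
    max(sigma_S/sigma); the stability condition keeps this factor below
    1 - (1 - max(sigma_S/sigma))/4, which bounds e by the consistency error.

    Expectations. The square of F Z^11 is at most F^p + Z^(22p/(p-2)), which is
    integrable. As Q and Q_h may fail to be measurable, the moments are
    compared with those of a measurable majorant. *)
Require Import Defs.
From mathcomp Require Import all_boot all_order all_algebra.
From mathcomp Require Import all_classical all_reals all_analysis.
From mathcomp Require Import measurable_realfun ring lra zify.

Set Implicit Arguments.
Unset Strict Implicit.
Unset Printing Implicit Defensive.

Import Order.TTheory GRing.Theory Num.Theory.
Import numFieldNormedType.Exports.

Local Open Scope classical_set_scope.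
Local Open Scope ring_scope.

(** * Gauss quadrature *)

(** The angular flux is not smooth in [mu]: at distance d behind a jump of the data it contains a
    term like exp(-d / mu), whose derivative in [mu] blows up as d tends to 0 while its total
    variation stays bounded. This dictates an error bound for functions of bounded variation, into
    which only the discrepancy of the nodes enters, and N of order h^(-eta) balances it with the
    spatial error. The derivative in x is of size 1 / mu, so the box scheme has a residual of size h
    / mu; it becomes summable only after averaging over the directions.

    The stability condition is known at [hmax w], whereas the contraction is needed at a width that
    may be smaller, so h log N(h) must be shown to be almost monotone in h.

    The exponent 11: the flux is at most F Z^3, one power for the inverse of min sigma and two for
    the inverse of 1 - max(sigma_S / sigma); the Hoelder constant of the source costs two more
    powers, the variation of the layers four more, and the division by the contraction gap the last
    two. *)

Section calculus.
Context {R : realType}.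
Implicit Types (f F : R -> R) (a b : R).
Notation leb := (@lebesgue_measure R).

Lemma continuous_itv_integrable f a b : continuous f ->
  leb.-integrable `[a, b] (EFin \o f).
Proof.
move=> cf; apply: continuous_compact_integrable; first exact: segment_compact.
exact/continuous_subspaceT.
Qed.

Lemma FTC_smooth f F a b : a <= b ->
  (forall x, is_derive x (1:R) F (f x)) -> continuous f ->
  \int[leb]_(x in `[a, b]) f x = F b - F a.
Proof.
move=> ab dF cf; rewrite /Rintegral.
have [<-|neq_ab] := eqVneq a b.
  by rewrite set_itv1 integral_set1 subrr.
have cF : continuous F.
  by move=> x; apply/differentiable_continuous/derivable1_diffP.
rewrite (@continuous_FTC2 _ f F) //.
- by rewrite lt_neqAle neq_ab.
- exact/continuous_subspaceT.
- split => [x _|//|//]; first exact: ex_derive.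
  + exact/cvg_at_right_filter/cF.
  + exact/cvg_at_left_filter/cF.
- by move=> x _; rewrite derive1E derive_val.
Qed.

Lemma Rintegral_deriv_poly (P : {poly R}) :
  \int[leb]_(x in unit_itv) P^`().[x] = P.[1] - P.[0].
Proof.
have dP (x : R) : is_derive x (1 : R) (horner P) P^`().[x] by exact: is_derive_poly.
by rewrite /unit_itv (FTC_smooth ler01 dP)// => x; exact: continuous_horner.
Qed.

(** Division by [0%:R] gives 0, so the constant coefficient is 0 and the primitive vanishes at 0. *)
Definition poly_primitive n (p : {poly R}) : {poly R} :=
  \poly_(i < n.+1) (p`_i.-1 / i%:R).

Lemma deriv_poly_primitive n (p : {poly R}) : (size p <= n)%N ->
  (poly_primitive n p)^`() = p.
Proof.
move=> pn; apply/polyP => i; rewrite coef_deriv coef_poly ltnS.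
have [lt_in|le_ni] := ltnP i n; last by rewrite mul0rn nth_default ?(leq_trans pn).
by rewrite -(mulr_natr (_ / _)) divfK ?pnatr_eq0.
Qed.

Lemma Rintegral_horner (p : {poly R}) n : (size p <= n)%N ->
  \int[leb]_(x in unit_itv) p.[x] = \sum_(i < n) p`_i / i.+1%:R.
Proof.
move=> pn; rewrite -{1}(deriv_poly_primitive pn) Rintegral_deriv_poly.
have -> : (poly_primitive n p).[0] = 0 by rewrite horner_coef0 coef_poly /= invr0 mulr0.
rewrite subr0 (@horner_coef_wide _ n.+1) ?size_poly// big_ord_recl /=.
rewrite coef_poly /= invr0 mulr0 mul0r add0r; apply: eq_bigr => i _.
by rewrite coef_poly /= ltnS ltn_ord expr1n mulr1.
Qed.

End calculus.

Lemma hornerXaddC {A : nzRingType} (c x : A) : ('X + c%:P).[x] = x + c.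
Proof. by rewrite hornerD hornerX hornerC. Qed.

Section log_derivative.
Context {F : fieldType}.

Lemma deriv_prod_log (I : Type) (r : seq I) (a : I -> F) (x : F) :
  (forall i, x + a i != 0) ->
  (\prod_(i <- r) ('X + (a i)%:P))^`().[x] =
  (\prod_(i <- r) (x + a i)) * \sum_(i <- r) (x + a i)^-1.
Proof.
move=> ne0; elim: r => [|i r IH]; first by rewrite !big_nil derivC horner0 mulr0.
rewrite !big_cons derivM derivD derivX derivC addr0 mul1r hornerD hornerM IH.
rewrite horner_prod !hornerE.
under eq_bigr do rewrite !hornerE.
by rewrite /=; field; exact: ne0.
Qed.

End log_derivative.

(** * Weights and nodes of the Gauss rule, and the sum of the [w k / mu k] *)

Section gauss.
Context {R : realType} {N : nat} {mu w : 'I_N.+1 -> R}.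
Hypothesis gauss : gauss_legendre mu w.

Let nodes_inj : injective mu.
Proof.
case: gauss => _ lt_mu _ k l; have [kl|lk|] := ltngtP (k : nat) l; last first.
- by move=> /val_inj.
- by move=> e; have := lt_mu _ _ lk; rewrite e ltxx.
- by move=> e; have := lt_mu _ _ kl; rewrite e ltxx.
Qed.

Lemma gauss_exact (p : {poly R}) n : (size p <= n)%N -> (n <= N.+1.*2)%N ->
  \sum_(k < N.+1) w k * p.[mu k] = \sum_(i < n) p`_i / i.+1%:R.
Proof.
move=> pn nN; case: gauss => _ _ ->; last exact: leq_trans nN.
exact: Rintegral_horner.
Qed.

(** The square of the product of the ['X - (mu j)%:P] over [j != k] has degree 2N, which the rule
    still integrates exactly; only the node [k] contributes, with a positive value, and the integral
    of a square is nonnegative. *)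
Lemma gauss_weight_ge0 k : 0 <= w k.
Proof.
pose p := (\prod_(j <- rem k (enum 'I_N.+1)) ('X - (mu j)%:P)) ^+ 2.
have sp : (size p <= N.+1.*2)%N.
  rewrite /p expr2; apply: (leq_trans (size_polyMleq _ _)).
  rewrite size_prod_XsubC size_rem ?mem_enum// size_enum_ord /=.
  lia.
have [_ _ /(_ p sp)] := gauss; rewrite (bigD1 k)//= big1; last first.
  move=> j jk; rewrite /p hornerE horner_prod (big_rem j) /=; last first.
    by rewrite mem_rem_uniq ?enum_uniq// inE jk mem_enum.
  by rewrite hornerXsubC subrr mul0r expr0n mulr0.
rewrite addr0 => wp.
have pk : 0 < p.[mu k].
  rewrite /p hornerE horner_prod exprn_even_gt0//= prodf_seq_neq0.
  apply/allP => j; rewrite mem_rem_uniq ?enum_uniq// inE => /andP[jk _] /=.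
  by rewrite !hornerE subr_eq0; apply: contra_neq jk => /nodes_inj.
rewrite -(pmulr_lge0 _ pk) wp; apply: Rintegral_ge0 => x _.
by rewrite /p hornerE sqr_ge0.
Qed.

Let T : {poly R} := \prod_(k < N.+1) ('X - (mu k)%:P).

Let size_T : size T = N.+2.
Proof. by rewrite /T size_prod_XsubC /index_enum -enumT size_enum_ord. Qed.

Let T_root k : T.[mu k] = 0.
Proof. by rewrite /T horner_prod (bigD1 k)//= !hornerE subrr mul0r. Qed.

(** The sum is the integral of [T * 'X^m], of degree at most 2N + 1; the rule gives it exactly, and
    [T] vanishes at every node. *)
Let T_orth m : (m < N.+1)%N -> \sum_(i < N.+2) T`_i / (m + i.+1)%:R = 0.
Proof.
move=> mN; have sT : (size (T * 'X^m)%R <= m + N.+2)%N.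
  by apply: (leq_trans (size_polyMleq _ _)); rewrite size_T size_polyXn; lia.
have := gauss_exact sT; have -> : (m + N.+2 <= N.+1.*2)%N by lia.
move=> /(_ isT).
rewrite big1; last by move=> k _; rewrite hornerM T_root mul0r mulr0.
rewrite big_split_ord /= big1 ?add0r; last first.
  by move=> i _; rewrite coefMXn ltn_ord mul0r.
move=> /esym; under eq_bigr do rewrite coefMXn ltnNge leq_addr /= addKn -addnS.
by [].
Qed.

(* The numerator of [\sum_i T_i / (X + i + 1)], the Mellin transform of T. As T
   is orthogonal to 1, ..., X^N, its zeros are 0, ..., N; evaluating the
   logarithmic derivative at -1 gives the sum of the [w k / mu k]. *)
Let num : {poly R} :=
  \sum_(i < N.+2) T`_i *: \prod_(j < N.+2 | j != i) ('X + (j.+1%:R)%:P).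

Let num_root (m : 'I_N.+1) : num.[m%:R] = 0.
Proof.
rewrite /num horner_sum.
transitivity ((\prod_(j < N.+2) (m%:R + j.+1%:R)) *
              \sum_(i < N.+2) T`_i / (m + i.+1)%:R); last by rewrite T_orth ?mulr0.
rewrite mulr_sumr; apply: eq_bigr => i _.
rewrite hornerZ horner_prod [in RHS](bigD1 i)//= natrD.
under eq_bigr do rewrite !hornerE.
by field; rewrite -(natrD _ 1) -natrD pnatr_eq0 addnCA.
Qed.

Let num_size : (size num <= N.+2)%N.
Proof.
apply: (leq_trans (size_sum _ _ _)); apply/bigmax_leqP => i _.
apply: (leq_trans (size_scale_leq _ _)).
rewrite (eq_bigr (fun j : 'I_N.+2 => 'X - (- j.+1%:R)%:P)); last first.
  by move=> j _; rewrite polyCN opprK.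
rewrite -big_filter size_prod_XsubC.
rewrite -[X in (_ < X)%N](size_enum_ord N.+2) enumT.
rewrite size_filter -[X in (_ < X)%N](count_predC (fun j => j != i)) -addn1 leq_add2l.
rewrite -has_count; apply/hasP; exists i; first by rewrite mem_index_enum.
by rewrite /= eqxx.
Qed.

(** Both sides have the roots 0, ..., N and the same coefficient of degree N + 1, so their
    difference has degree at most N and N + 1 roots. This form does not presuppose that the leading
    coefficient of [num] is nonzero. *)
Let num_factor : num = num`_N.+1 *: \prod_(m < N.+1) ('X - (m%:R)%:P).
Proof.
pose Pr : {poly R} := \prod_(m < N.+1) ('X - (m%:R)%:P).
apply/eqP; rewrite -subr_eq0 -/Pr; apply/eqP.
have sPr : size Pr = N.+2.
  by rewrite /Pr size_prod_XsubC /index_enum -enumT size_enum_ord.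
have PrN : Pr`_N.+1 = 1.
  by have /monicP := monic_prod_XsubC (index_enum 'I_N.+1) predT
    (fun m : 'I_N.+1 => m%:R : R); rewrite /lead_coef -/Pr sPr.
apply: (@roots_geq_poly_eq0 _ _ [seq (m%:R : R) | m <- iota 0 N.+1]).
- apply/allP => z /mapP[m]; rewrite mem_iota add0n => /= mN -> {z}.
  rewrite /root hornerD hornerN hornerZ (num_root (Ordinal mN)) horner_prod.
  by rewrite (bigD1 (Ordinal mN))//= hornerXsubC subrr mul0r mulr0 subrr.
- by rewrite map_inj_uniq ?iota_uniq// => a b /eqP; rewrite eqr_nat => /eqP.
rewrite size_map size_iota; apply/leq_sizeP => j Nj.
rewrite coefB coefZ; have [->|jN] := eqVneq j N.+1; first by rewrite PrN mulr1 subrr.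
have lt_Nj : (N.+2 <= j)%N by rewrite ltn_neqAle eq_sym jN.
rewrite (nth_default 0 (leq_trans num_size lt_Nj)) (_ : Pr`_j = 0) ?mulr0 ?subrr//.
by rewrite nth_default ?sPr.
Qed.

(** [- i.+1%:R] is a zero of every product but the [i]-th, so these values read off the coefficients
    of [T] like residues. *)
Let num_at (i : 'I_N.+2) :
  num.[- i.+1%:R] = T`_i * \prod_(j < N.+2 | j != i) (- i.+1%:R + j.+1%:R).
Proof.
rewrite /num horner_sum (bigD1 i)//= [X in _ + X]big1 ?addr0; last first.
  move=> k ki; rewrite hornerZ horner_prod (bigD1 i) 1?eq_sym//=.
  by rewrite hornerXaddC addNr mul0r mulr0.
by rewrite hornerZ horner_prod; congr (_ * _); apply: eq_bigr => j _; rewrite hornerXaddC.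
Qed.

(** If the constant coefficient of [T] were 0, [num] would vanish at -1, which is none of the roots
    0, ..., N. Then [num] would be 0, and its value at the last pole would make the leading
    coefficient of [T] vanish, although [T] is monic. *)
Let T0_neq0 : T`_0 != 0.
Proof.
apply/eqP => T0.
have := num_at ord0; rewrite T0 mul0r num_factor hornerZ => /eqP.
rewrite mulf_eq0 horner_prod => /orP[/eqP c0|/prodf_eq0 [m _]]; last first.
  by rewrite hornerXsubC /= -opprD oppr_eq0 -natrD pnatr_eq0.
have := num_at ord_max; rewrite num_factor c0 scale0r horner0 => /esym/eqP.
rewrite mulf_eq0 => /orP[|/prodf_eq0 [j jmax]].
  have /monicP := monic_prod_XsubC (index_enum 'I_N.+1) predT mu.
  by rewrite /lead_coef -/T size_T /= => ->; rewrite oner_eq0.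
rewrite addrC subr_eq0 eqr_nat eqSS => /eqP e.
by move/eqP: jmax; apply; exact/val_inj.
Qed.

(** The derivative of [num] at -1 is computed in two ways. From the roots 0, ..., N it is [num.[-1]]
    times minus the harmonic number. From the sum, the term [i = 0] contributes the logarithmic
    derivative of [A0], again a harmonic number, while all other terms share the factor ['X + 1] and
    contribute [B.[-1]]. Hence the factor 2. *)
Let num_deriv :
  \sum_(i < N.+1) T`_i.+1 / i.+1%:R = - T`_0 * (2 * \sum_(i < N.+1) i.+1%:R^-1).
Proof.
pose a (j : 'I_N.+1) : R := j.+2%:R.
pose A0 : {poly R} := \prod_(j < N.+1) ('X + (a j)%:P).
pose B : {poly R} := \sum_(i < N.+1) T`_i.+1 *: \prod_(j < N.+1 | j != i) ('X + (a j)%:P).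
have numE : num = T`_0 *: A0 + ('X + 1%:P) * B.
  rewrite /num big_ord_recl /=; congr (_ *: _ + _).
    rewrite big_mkcond big_ord_recl /= mul1r; exact: eq_bigr.
  rewrite /B mulr_sumr; apply: eq_bigr => i _; rewrite -scalerAr; congr (_ *: _).
  rewrite big_mkcond big_ord_recl /= [in RHS]big_mkcond; congr (_ * _).
pose f : R := \prod_(j < N.+1) j.+1%:R.
have f0 : f != 0 by apply/prodf_neq0 => j _; rewrite pnatr_eq0.
have aE j : -1 + a j = j.+1%:R by rewrite /a -[j.+2]add1n natrD addrA addNr add0r.
have A0d : A0^`().[-1] = f * \sum_(i < N.+1) i.+1%:R^-1.
  rewrite deriv_prod_log; last by move=> j; rewrite aE pnatr_eq0.
  by congr (_ * _); apply: eq_bigr => j _; rewrite aE.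
have BE : B.[-1] = f * \sum_(i < N.+1) T`_i.+1 / i.+1%:R.
  rewrite horner_sum mulr_sumr; apply: eq_bigr => i _.
  rewrite hornerZ horner_prod /f [in RHS](bigD1 i)//=.
  under eq_bigr do rewrite hornerXaddC aE.
  by field; rewrite -(natrD _ 1) pnatr_eq0.
have n1 : num.[-1] = T`_0 * f.
  rewrite numE hornerD hornerM hornerXaddC hornerZ addNr mul0r addr0 horner_prod; congr (_ * _).
  by apply: eq_bigr => j _; rewrite hornerXaddC aE.
have dn1 : num^`().[-1] = num.[-1] * - \sum_(i < N.+1) i.+1%:R^-1.
  rewrite num_factor derivZ !hornerZ -mulrA; congr (_ * _).
  rewrite -sumrN (eq_bigr (fun m : 'I_N.+1 => 'X + (- m%:R)%:P)); last first.
    by move=> m _; rewrite polyCN.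
  have mE (m : 'I_N.+1) : -1 + - m%:R = - m.+1%:R :> R by rewrite -opprD -natr1 addrC.
  rewrite deriv_prod_log; last by move=> m; rewrite mE oppr_eq0 pnatr_eq0.
  rewrite horner_prod; under eq_bigr do rewrite mE.
  by congr (_ * _); apply: eq_bigr => m _; rewrite ?mE ?invrN// hornerXaddC mE.
have := dn1; rewrite n1 numE derivD derivZ derivM derivD derivX derivC addr0 mul1r.
rewrite hornerD hornerZ hornerD hornerM hornerXaddC addNr mul0r addr0 A0d BE => e.
by apply: (mulfI f0); move: e; set S := (\sum_(i < _) _ / _); set H := (\sum_(i < _) _); lra.
Qed.

Lemma gauss_node_gt0 k : 0 < mu k.
Proof.
rewrite lt_neqAle; case: gauss => /(_ k) + _ _.
rewrite /unit_itv /= in_itv/= => /andP[-> _]; rewrite andbT.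
apply: contra_neq T0_neq0 => mu0.
by rewrite -horner_coef0 mu0 T_root.
Qed.

(** [T] vanishes at the nodes, so there 1 / x equals the polynomial [p] of degree N with p(x) x = 1
    - T(x) / T(0). The rule integrates [p] exactly, and the integral is, up to the factor -1 / T(0),
    the sum found in [num_deriv]. *)
Lemma gauss_sum_inv :
  \sum_(k < N.+1) w k / mu k = 2 * \sum_(i < N.+1) i.+1%:R^-1.
Proof.
pose p := \poly_(i < N.+1) (- T`_i.+1 / T`_0).
have pE x : p.[x] * x = 1 - T.[x] / T`_0.
  rewrite (@horner_coef_wide _ N.+1) ?size_poly// (horner_coef T) size_T.
  rewrite [X in _ = 1 - X / _]big_ord_recl.
  rewrite expr0 mulr1 mulrDl (divff T0_neq0) opprD addrA subrr add0r -mulNr -sumrN.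
  rewrite !mulr_suml.
  apply: eq_bigr => i _; rewrite coef_poly ltn_ord /= exprS; ring.
rewrite (eq_bigr (fun k => w k * p.[mu k])); last first.
  move=> k _; congr (_ * _); apply: (mulIf (lt0r_neq0 (gauss_node_gt0 k))).
  by rewrite mulVf ?lt0r_neq0 ?gauss_node_gt0// pE T_root mul0r subr0.
rewrite (@gauss_exact _ N.+1) ?size_poly//; last by rewrite -addnn leq_addr.
rewrite -[RHS](mulKf T0_neq0) -(opprK (T`_0)) mulNr -num_deriv.
rewrite opprK mulrN -mulNr mulr_sumr; apply: eq_bigr => i _.
by rewrite coef_poly ltn_ord mulrA !mulNr (mulrC (T`_0)^-1).
Qed.

End gauss.

Section harmonic.
Context {R : realType}.

Lemma ln_le_subr1 (y : R) : 0 < y -> ln y <= y - 1.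
Proof.
move=> y0; have -> : y = 1 + (y - 1) by rewrite addrC subrK.
by rewrite [1 + (y - 1)]addrC addrK addrC le_ln1Dx//; lra.
Qed.

Lemma harmonic_le_ln n : \sum_(i < n.+1) (i.+1%:R)^-1 <= 1 + ln (n.+1%:R : R).
Proof.
elim: n => [|n IH]; first by rewrite big_ord_recl big_ord0 ln1 invr1.
rewrite big_ord_recr /=; apply: (le_trans (lerD IH (lexx _))).
rewrite -addrA lerD2l.
have n0 (k : nat) : (0 : R) < k.+1%:R by rewrite ltr0n.
have : ln (n.+1%:R / n.+2%:R : R) <= n.+1%:R / n.+2%:R - 1.
  by apply: ln_le_subr1; rewrite divr_gt0.
rewrite ln_div ?posrE// lerBlDl => h; rewrite -lerBrDr; apply: (le_trans h).
have n2 : n.+1%:R = n.+2%:R - 1 :> R by rewrite -[n.+2%:R]natr1 addrK.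
by rewrite n2 mulrBl divff ?pnatr_eq0// mul1r lerD2l addrAC subrr add0r.
Qed.

End harmonic.

(** * Discrepancy and the Koksma inequality *)

Section trigonometric_kernel.
Context {R : realType}.
Implicit Types (b t x : R).
Notation leb := (@lebesgue_measure R).

Lemma Rintegral_sum (I : Type) (r : seq I) (D : set R) (f : I -> R -> R) :
  measurable D -> (forall i, leb.-integrable D (EFin \o f i)) ->
  \int[leb]_(x in D) (\sum_(i <- r) f i x) = \sum_(i <- r) \int[leb]_(x in D) f i x.
Proof.
move=> mD fi; elim: r => [|i r IH].
  rewrite big_nil (@eq_Rintegral _ _ _ _ _ (fun=> 0)) ?Rintegral_cst ?mul0r//.
  by move=> x _; rewrite big_nil.
rewrite big_cons -IH -RintegralD//; last first.
  rewrite (_ : _ \o _ = fun x => (\sum_(j <- r) (EFin \o f j) x)%E).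
    exact: integrable_sum.
  by apply/funext => x; rewrite /= sumEFin.
by apply: eq_Rintegral => x _; rewrite big_cons.
Qed.

Lemma continuous_of_derivable (f : R -> R) :
  (forall x, derivable f x 1) -> continuous f.
Proof. by move=> df x; apply/differentiable_continuous/derivable1_diffP. Qed.

Lemma contD (f g : R -> R) : continuous f -> continuous g ->
  continuous (fun x => f x + g x).
Proof. by move=> cf cg x; apply: continuousD; [exact: cf|exact: cg]. Qed.

Lemma contB (f g : R -> R) : continuous f -> continuous g ->
  continuous (fun x => f x - g x).
Proof. by move=> cf cg x; apply: continuousB; [exact: cf|exact: cg]. Qed.

Lemma contM (f g : R -> R) : continuous f -> continuous g ->
  continuous (fun x => f x * g x).
Proof. by move=> cf cg x; apply: continuousM; [exact: cf|exact: cg]. Qed.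

Lemma contC (a : R) : continuous (fun _ : R => a).
Proof. by move=> x; exact: cst_continuous. Qed.

Lemma nondecreasing_of_derive (f F : R -> R) a b : a <= b ->
  (forall x, is_derive x (1 : R) F (f x)) -> continuous f ->
  (forall x, a <= x <= b -> 0 <= f x) -> F a <= F b.
Proof.
move=> ab dF cf f0; rewrite -subr_ge0 -(FTC_smooth ab dF cf).
by apply: Rintegral_ge0 => x /=; rewrite in_itv; exact: f0.
Qed.

Lemma integral_cosM (m : nat) :
  \int[leb]_(x in `[0, pi]) cos (m%:R * x) = if m is 0%N then pi else 0 :> R.
Proof.
case: m => [|m].
  rewrite (@eq_Rintegral _ _ _ _ _ (fun=> 1)); last by move=> x _; rewrite mul0r cos0.
  have dI (x : R) : is_derive x (1 : R) id (cst 1 x) by exact: is_derive_id.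
  by rewrite (FTC_smooth (pi_ge0 R) dI) ?subr0//; exact: cst_continuous.
have m0 : (m.+1%:R : R) != 0 by rewrite pnatr_eq0.
have dS x : is_derive x (1 : R) (fun y => m.+1%:R^-1 * sin (m.+1%:R * y)) (cos (m.+1%:R * x)).
  by apply: is_derive_eq; rewrite /GRing.scale /=; field.
have cC : continuous (fun x : R => cos (m.+1%:R * x)).
  move=> x; apply: (@continuous_comp _ _ _ (fun x => m.+1%:R * x) cos).
    exact: mulrl_continuous.
  exact: continuous_cos.
rewrite (FTC_smooth (pi_ge0 R) dS cC) mulr0 sin0 mulr0 subr0.
suff -> : sin (m.+1%:R * pi) = 0 :> R by rewrite mulr0.
elim: m.+1 => [|k IH]; first by rewrite mul0r sin0.
by rewrite -natr1 mulrDl mul1r sinD sinpi IH mul0r mulr0 addr0.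
Qed.

(** Each inequality in the proof integrates the one before: [sin y <= y], then
    [1 - y ^+ 2 / 2 <= cos y], so that the cosine is at least 1/2 on [0, 1], then [y / 2 <= sin y],
    then the claim. *)
Lemma one_sub_cos_ge x : 0 <= x <= 1 -> x ^+ 2 / 4 <= 1 - cos x.
Proof.
move=> /andP[x0 x1].
have le_sin (y : R) : 0 <= y -> sin y <= y.
  move=> y0; rewrite -subr_ge0 -[0](subrr (sin 0)) {1}sin0.
  apply: (@nondecreasing_of_derive (fun y => 1 - cos y) (fun y => y - sin y)) => //.
  by move=> z; apply: continuousB; [exact: cst_continuous|exact: continuous_cos].
have ge_cos (y : R) : 0 <= y -> 1 - y ^+ 2 / 2 <= cos y.
  move=> y0; rewrite -subr_ge0.
  have := @nondecreasing_of_derive (fun y => y - sin y) (fun y => cos y - (1 - y ^+ 2 / 2)) 0 y y0.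
  rewrite cos0 expr0n mul0r !subr0 subrr; apply.
  - by move=> z; apply: is_derive_eq; rewrite /GRing.scale /=; field.
  - by move=> z; apply: continuousB; [exact: id|exact: continuous_sin].
  - by move=> z /andP[z0 _]; rewrite subr_ge0 le_sin.
have ge_sin (y : R) : 0 <= y <= 1 -> y / 2 <= sin y.
  move=> /andP[y0 y1]; rewrite -subr_ge0.
  have := @nondecreasing_of_derive (fun y => cos y - 2^-1) (fun y => sin y - y / 2) 0 y y0.
  rewrite sin0 mul0r subrr; apply.
  - by move=> z; apply: is_derive_eq; rewrite /GRing.scale /=; field.
  - move=> z; apply: (@continuousB _ _ _ cos (cst 2^-1)); first exact: continuous_cos.
    exact: cst_continuous.
  - move=> z /andP[z0 z1]; have z1' : z <= 1 by apply: le_trans y1.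
    have := ge_cos z z0; have : z ^+ 2 <= 1 by rewrite expr_le1.
    by lra.
rewrite -subr_ge0.
have := @nondecreasing_of_derive (fun y => sin y - y / 2) (fun y => 1 - cos y - y ^+ 2 / 4) 0 x x0.
rewrite cos0 expr0n mul0r !subr0 subrr; apply.
- by move=> z; apply: is_derive_eq; rewrite /GRing.scale /=; field.
- move=> z; apply: (@continuousB _ _ _ sin (fun y => y / 2)); first exact: continuous_sin.
  exact: mulrr_continuous.
- by move=> z /andP[z0 z1]; rewrite subr_ge0 ge_sin// z0 (le_trans z1).
Qed.

(* [kernel n] is the squared modulus of [\sum_k profile n k * expR (i k t)].
   Since the profile vanishes at 0 and n, its mass is of order n^5 and its
   moment against [1 - cos t] of order n^3. *)
Definition profile (n k : nat) : R := k%:R * (n%:R - k%:R).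

Lemma sum_profile_sqr n :
  \sum_(k < n.+1) profile n k ^+ 2 = (n%:R ^+ 5 - n%:R) / 30%:R.
Proof.
(* The upper limit is separated from the parameter [n] of the summand, so that induction on [m]
   applies; the right side collects the sums of squares, cubes and fourth powers. *)
have H (m : nat) : \sum_(k < m) profile n k ^+ 2 =
   let x : R := m%:R in let y : R := n%:R in
   y ^+ 2 * ((x - 1) * x * (2 * x - 1) / 6) - 2 * y * ((x - 1) * x / 2) ^+ 2 +
   (x - 1) * x * (2 * x - 1) * (3 * x ^+ 2 - 3 * x - 1) / 30.
  elim: m => [|m IH]; first by rewrite big_ord0 /=; field.
  by rewrite big_ord_recr /= IH /= /profile -(natr1 m); field.
by rewrite H /= -(natr1 n); field.
Qed.

Lemma sum_profile_diff n :
  \sum_(k < n) (profile n k.+1 - profile n k) ^+ 2 = (n%:R ^+ 3 - n%:R) / 3%:R.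
Proof.
have H (m : nat) : \sum_(k < m) (profile n k.+1 - profile n k) ^+ 2 =
   let x : R := m%:R in let y : R := n%:R in
   x * (y - 1) ^+ 2 - 2 * (y - 1) * (x - 1) * x + 4 * ((x - 1) * x * (2 * x - 1) / 6).
  elim: m => [|m IH]; first by rewrite big_ord0 /=; field.
  by rewrite big_ord_recr /= IH /= /profile -(natr1 m); field.
by rewrite H /=; field.
Qed.

Let prof0 n : profile n 0 = 0. Proof. by rewrite /profile mul0r. Qed.
Let profn n : profile n n = 0. Proof. by rewrite /profile subrr mulr0. Qed.

Definition freq n (p : 'I_n.+1 * 'I_n.+1) : R := (p.1 : nat)%:R - (p.2 : nat)%:R.
Definition ampl n (p : 'I_n.+1 * 'I_n.+1) : R := profile n p.1 * profile n p.2.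
Definition kernel n t : R := \sum_p ampl p * cos (@freq n p * t).

Lemma kernel_ge0 n t : 0 <= kernel n t.
Proof.
have -> : kernel n t = (\sum_(k < n.+1) profile n k * cos (k%:R * t)) ^+ 2 +
                       (\sum_(k < n.+1) profile n k * sin (k%:R * t)) ^+ 2.
  rewrite !expr2 !mulr_suml -big_split /= /kernel.
  rewrite -(pair_bigA _ (fun i j : 'I_n.+1 => profile n i * profile n j * cos ((i%:R - j%:R) * t))) /=.
  apply: eq_bigr => i _; rewrite !mulr_sumr -big_split /=; apply: eq_bigr => j _.
  by rewrite mulrBl cosB; ring.
by rewrite addr_ge0 ?sqr_ge0.
Qed.

Lemma integral_cos_freq (i j : nat) :
  \int[leb]_(x in `[0, pi]) cos ((i%:R - j%:R) * x) = if i == j then pi else 0 :> R.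
Proof.
wlog le_ji : i j / (j <= i)%N => [H|].
  have [/H//|/ltnW/H] := leqP j i; rewrite eq_sym => <-.
  by apply: eq_Rintegral => x _; rewrite -opprB mulNr cosN.
rewrite -natrB// integral_cosM.
have -> : (i == j) = (i - j == 0)%N by rewrite subn_eq0 eqn_leq le_ji andbT.
by case: (i - j)%N.
Qed.

Lemma sum_ampl_diag n :
  \sum_(p : 'I_n.+1 * 'I_n.+1) ampl p * (p.1 == p.2)%:R = \sum_(k < n.+1) profile n k ^+ 2.
Proof.
rewrite -(pair_bigA _ (fun i j : 'I_n.+1 => profile n i * profile n j * (i == j)%:R)) /=.
apply: eq_bigr => i _; rewrite (bigD1 i)//= eqxx mulr1 big1 ?addr0// => j ji.
by rewrite eq_sym (negbTE ji) mulr0.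
Qed.

Lemma sum_ampl_offdiag n :
  \sum_(p : 'I_n.+1 * 'I_n.+1) ampl p * ((p.1).+1 == p.2 :> nat)%:R =
  \sum_(k < n) profile n k * profile n k.+1.
Proof.
rewrite -(pair_bigA _ (fun i j : 'I_n.+1 => profile n i * profile n j * (i.+1 == j :> nat)%:R)) /=.
rewrite big_ord_recr /= [X in _ + X]big1 ?addr0; last first.
  by move=> j _; rewrite profn !mul0r.
apply: eq_bigr => i _; rewrite (bigD1 (lift ord0 i))//= eqxx mulr1 big1 ?addr0// => j ji.
case: eqP => [e|_]; last by rewrite mulr0.
by move: ji; rewrite -val_eqE /= /bump add1n e eqxx.
Qed.

Lemma sum_ampl_offdiagC n :
  \sum_(p : 'I_n.+1 * 'I_n.+1) ampl p * (p.1 == (p.2).+1 :> nat)%:R =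
  \sum_(k < n) profile n k * profile n k.+1.
Proof.
rewrite -sum_ampl_offdiag (reindex_inj (inv_inj swap_pairK)) /=.
apply: eq_bigr => p _; rewrite /ampl /= (mulrC (profile _ _)); congr (_ * _).
by rewrite eq_sym.
Qed.

(** Expansion of the squares: as the profile vanishes at 0 and at [n], both shifted sums of squares
    are the full one. *)
Lemma profile_energy n :
  2 * (\sum_(k < n.+1) profile n k ^+ 2 - \sum_(k < n) profile n k * profile n k.+1) =
  \sum_(k < n) (profile n k.+1 - profile n k) ^+ 2.
Proof.
rewrite [RHS](eq_bigr (fun k : 'I_n => (profile n k.+1 ^+ 2 + profile n k ^+ 2) +
   - (2 * (profile n k * profile n k.+1)))); last first.
  by move=> k _; set u := profile _ _; set v := profile _ _; ring.
rewrite big_split /= big_split /= sumrN -mulr_sumr.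
have -> : \sum_(k < n) profile n k ^+ 2 = \sum_(k < n.+1) profile n k ^+ 2.
  by rewrite big_ord_recr /= profn expr0n addr0.
have -> : \sum_(k < n) profile n k.+1 ^+ 2 = \sum_(k < n.+1) profile n k ^+ 2.
  by rewrite big_ord_recl /= prof0 expr0n add0r.
by ring.
Qed.

Lemma continuous_kernel_term (c z b : R) : continuous (fun t : R => c * cos (z * (t + b))).
Proof.
move=> t; apply: continuousM; first exact: cst_continuous.
apply: (@continuous_comp _ _ _ (fun t => z * (t + b)) cos); last exact: continuous_cos.
apply: continuousM; first exact: cst_continuous.
by apply: continuousD; [exact: id|exact: cst_continuous].
Qed.

(** Centring at [b] and at [- b] together leaves the terms
    [2 * cos (freq p * b) * cos (freq p * x)], without sines, and on [0, pi] only frequency 0, that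
    is the diagonal, has a nonzero integral. *)
Lemma integral_kernel n b :
  \int[leb]_(x in `[0, pi]) (kernel n (x - b) + kernel n (x + b)) =
  2 * pi * \sum_(k < n.+1) profile n k ^+ 2.
Proof.
(* The [+ 0] gives the terms the shape of [continuous_kernel_term]. *)
transitivity (\int[leb]_(x in `[0, pi]) \sum_(p : 'I_n.+1 * 'I_n.+1)
   (2 * ampl p * cos (freq p * b)) * cos (freq p * (x + 0))).
  apply: eq_Rintegral => x _; rewrite /kernel -big_split /=; apply: eq_bigr => p _.
  by rewrite addr0 !mulrDr mulrN cosB cosD; ring.
rewrite Rintegral_sum//; last first.
  by move=> p; apply/continuous_itv_integrable/continuous_kernel_term.
rewrite -sum_ampl_diag mulr_sumr; apply: eq_bigr => p _.
rewrite RintegralZl//; last first.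
  apply: (@continuous_itv_integrable _ (fun x => cos (freq p * (x + 0)))).
  by move=> x; have := @continuous_kernel_term 1 (freq p) 0 x; under eq_fun do rewrite mul1r.
under eq_Rintegral do rewrite addr0.
rewrite integral_cos_freq (_ : (p.1 == p.2 :> nat) = (p.1 == p.2))//.
case: eqP => [e|_]; last by rewrite !mulr0.
have -> : freq p = 0 by rewrite /freq e subrr.
by rewrite mul0r cos0 /=; ring.
Qed.

(** The factor [1 - cos] replaces the cosine of each frequency by its difference from the mean over
    the two neighbouring frequencies. Only the diagonal and the two adjacent diagonals then meet
    frequency 0, and they combine to the energy of [profile_energy]. *)
Lemma integral_kernel_moment n b :
  \int[leb]_(x in `[0, pi]) ((1 - cos (x - b)) * kernel n (x - b) +
                              (1 - cos (x + b)) * kernel n (x + b)) =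
  pi * \sum_(k < n) (profile n k.+1 - profile n k) ^+ 2.
Proof.
have e2 (x u : R) : cos (u * (x - b)) + cos (u * (x + b)) = 2 * cos (u * b) * cos (u * x).
  by rewrite !mulrDr mulrN cosB cosD; ring.
pose c (p : 'I_n.+1 * 'I_n.+1) z := ampl p * cos (z * b).
have cint (p : 'I_n.+1 * 'I_n.+1) z :
    leb.-integrable `[0, pi] (EFin \o (fun x => c p z * cos (z * (x + 0)))).
  exact/continuous_itv_integrable/continuous_kernel_term.
have intB (p : 'I_n.+1 * 'I_n.+1) z :
    leb.-integrable `[0, pi] (EFin \o (fun x => c p z * cos (z * (x + 0)) +
                                                 c p z * cos (z * (x + 0)))).
  by have := integrableD _ (cint p z) (cint p z); apply.
pose f (p : 'I_n.+1 * 'I_n.+1) x := c p (freq p) * cos (freq p * (x + 0)) +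
    c p (freq p) * cos (freq p * (x + 0)) -
    c p (freq p + 1) * cos ((freq p + 1) * (x + 0)) -
    c p (freq p - 1) * cos ((freq p - 1) * (x + 0)).
transitivity (\int[leb]_(x in `[0, pi]) \sum_(p : 'I_n.+1 * 'I_n.+1) f p x).
  apply: eq_Rintegral => x _; rewrite /kernel !mulr_sumr -big_split /=; apply: eq_bigr => p _.
  rewrite /f /c addr0; set z := freq p; have e2x := e2 x.
  have e1 (u : R) : (1 - cos u) * cos (z * u) =
      cos (z * u) - (cos ((z + 1) * u) + cos ((z - 1) * u)) / 2.
    by rewrite (mulrDl z) (mulrBl u z) mul1r cosD cosB; field.
  move: (ampl p) => a; rewrite !(mulrCA _ a) !e1 -mulrDr -!mulrA -!mulrDr -!mulrBr.
  congr (_ * _); by have := e2x (z + 1); have := e2x (z - 1); have := e2x z; lra.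
have fint p : leb.-integrable `[0, pi] (EFin \o f p).
  have := integrableB _ (integrableB _ (intB p (freq p)) (cint p (freq p + 1)))
     (cint p (freq p - 1)).
  by apply.
pose dg (p : 'I_n.+1 * 'I_n.+1) := pi * (ampl p * (p.1 == p.2)%:R).
have -> : pi * \sum_(k < n) (profile n k.+1 - profile n k) ^+ 2 =
    \sum_(p : 'I_n.+1 * 'I_n.+1) (dg p + dg p
      - pi * (ampl p * ((p.1).+1 == p.2 :> nat)%:R)
      - pi * (ampl p * (p.1 == (p.2).+1 :> nat)%:R)).
  rewrite -profile_energy !sumrB big_split /= -!mulr_sumr.
  by rewrite sum_ampl_diag sum_ampl_offdiag sum_ampl_offdiagC; ring.
rewrite Rintegral_sum//; apply: eq_bigr => p _.
have I1 z : \int[leb]_(x in `[0, pi]) (c p z * cos (z * (x + 0))) =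
    c p z * \int[leb]_(x in `[0, pi]) cos (z * x).
  rewrite RintegralZl//; last first.
    apply: (@continuous_itv_integrable _ (fun x => cos (z * (x + 0)))).
    by move=> x; have := @continuous_kernel_term 1 z 0 x; under eq_fun do rewrite mul1r.
  by under eq_Rintegral do rewrite addr0.
rewrite RintegralB//; last first.
  by have := integrableB _ (intB p (freq p)) (cint p (freq p + 1)); apply.
rewrite RintegralB// RintegralD// !I1.
have cE z (i j : nat) : z = i%:R - j%:R ->
    c p z * \int[leb]_(x in `[0, pi]) cos (z * x) = pi * (ampl p * (i == j)%:R).
  move=> ->; rewrite integral_cos_freq; case: eqP => [->|_]; last by rewrite !mulr0.
  by rewrite /c subrr mul0r cos0 /=; ring.
rewrite (cE _ p.1 p.2)// (cE _ p.1.+1 p.2); last by rewrite /freq -natr1 addrAC.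
rewrite (cE _ p.1 p.2.+1); last by rewrite /freq -natr1 opprD addrA.
by rewrite (_ : (p.1 == p.2 :> nat) = (p.1 == p.2))//; ring.
Qed.

End trigonometric_kernel.

(** * Discrepancy of a rule that is exact on polynomials of high degree *)

Section discrepancy.
Context {R : realType}.
Implicit Types (b t x : R).
Notation leb := (@lebesgue_measure R).

(* As E grows at most linearly, it is at least [E b - dl] on [b - 2 dl, b]; the
   difference of the kernels centred at [b - dl] and [dl - b] is an odd
   trigonometric polynomial, to which E is orthogonal. *)
Lemma one_sided_bound (n : nat) (E : R -> R) (A dl : R) : (0 < n)%N ->
  measurable_fun `[0, pi] E ->
  (forall x, 0 <= x <= pi -> `|E x| <= A) ->
  (forall m, (0 < m <= n)%N -> \int[leb]_(x in `[0, pi]) (E x * sin (m%:R * x)) = 0) ->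
  E 0 <= 0 ->
  (forall x y, 0 <= x <= y -> y <= pi -> E y - E x <= (y - x) / 2) ->
  0 < dl <= 1 -> 80%:R <= (n%:R * dl) ^+ 2 ->
  forall b, 0 <= b <= pi -> E b <= dl + A / 2.
Proof.
move=> n0 mE EA Eorth E0 Elip /andP[dl0 dl1] ndl b /andP[b0 bpi].
have A0 : 0 <= A by apply: le_trans (EA b _); rewrite ?b0.
(* Near 0, growth from [E 0 <= 0] at rate 1/2 already gives [E b <= dl]. *)
have [b2|b2] := ltP b (2 * dl).
  by have := Elip 0 b; rewrite lexx b0 => /(_ isT bpi); lra.
set e := E b; pose c := b - dl; pose q := 1 - cos dl.
have q0 : 0 < q.
  apply: lt_le_trans (one_sub_cos_ge _); last by rewrite ltW.
  by rewrite divr_gt0 ?exprn_gt0.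
have c_dl : dl <= c by rewrite /c; lra.
(* Since [dl <= c <= pi - dl], every [x + c] with [x] in [0, pi] falls in this range, and so does
   the distance of [x] to [c] when it exceeds [dl]. *)
have cospi t : dl <= t <= 2 * pi - dl -> q <= 1 - cos t.
  move=> /andP[t1 t2]; rewrite lerD2l lerN2.
  have pi2 := pi_ge2 R.
  have le_cos u : dl <= u <= pi -> cos u <= cos dl.
    move=> /andP[u1 u2]; have [->//|ne] := eqVneq u dl.
    rewrite ltW// ltr_cos ?in_itv/= ?u2 ?andbT; first by rewrite lt_neqAle eq_sym ne.
    - by lra.
    - by lra.
  have [tpi|tpi] := leP t pi; first by apply: le_cos; rewrite t1.
  have -> : cos t = cos (pi *+ 2 - t) by rewrite cosB cos2pi sin2pi mul1r mul0r addr0.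
  by apply: le_cos; rewrite mulr2n; lra.
pose k1 x := kernel n (x - c); pose k2 x := kernel n (x + c).
pose W x := (1 - cos (x - c)) * k1 x + (1 - cos (x + c)) * k2 x.
have cker : continuous (@kernel R n).
  have E1 : kernel n = fun t => \sum_(p : 'I_n.+1 * 'I_n.+1) ampl p * cos (freq p * (t + 0)).
    by apply/funext => t; apply: eq_bigr => p _; rewrite addr0.
  rewrite E1; apply: continuous_big => [|p _]; first exact: add_continuous.
  exact: continuous_kernel_term.
have cshift a : continuous (fun x : R => kernel n (x + a)).
  move=> x; apply: (@continuous_comp _ _ _ (fun x => x + a) (kernel n)); last exact: cker.
  by apply: continuousD; [exact: id|exact: cst_continuous].
have cw a : continuous (fun x : R => (1 - cos (x + a)) * kernel n (x + a)).
  move=> x; apply: (@continuousM _ _ (fun x => 1 - cos (x + a)) (fun x => kernel n (x + a))).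
    2: exact: cshift.
  by apply: continuous_of_derivable => y; exact: ex_derive.
(* Within [dl] of [c], [x] lies in [b - 2 dl, b] and the growth bound gives [E x >= e - dl].
   Elsewhere only the bound [A] on |E| is available; the term in [W] pays for it, because [1 - cos]
   is at least [q] there. *)
have pointwise x : 0 <= x <= pi ->
    (e - dl) * (k1 x + k2 x) - 2 * A / q * W x <= E x * (k1 x - k2 x).
  move=> xpi; have /andP[x0 xpi'] := xpi.
  have k1_ge0 : 0 <= k1 x by exact: kernel_ge0.
  have k2_ge0 : 0 <= k2 x by exact: kernel_ge0.
  have eA : e <= A by apply: le_trans (EA b _); rewrite ?ler_norm// b0.
  have EAx := EA x xpi; rewrite ler_norml in EAx; have /andP[EA1 EA2] := EAx.
  have h2 : (e - dl) * k2 x - 2 * A / q * ((1 - cos (x + c)) * k2 x) <= - E x * k2 x.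
    rewrite mulrA -mulrBl ler_wpM2r//.
    have h : 2 * A <= 2 * A / q * (1 - cos (x + c)).
      rewrite mulrAC ler_pdivlMr// ler_wpM2l ?mulr_ge0//.
      by apply: cospi; rewrite /c; lra.
    by lra.
  have h1 : (e - dl) * k1 x - 2 * A / q * ((1 - cos (x - c)) * k1 x) <= E x * k1 x.
    rewrite mulrA -mulrBl ler_wpM2r//.
    have [xc|xc] := leP `|x - c| dl.
      have := Elip x b; rewrite x0; move: xc; rewrite ler_norml /c => /andP[xc1 xc2].
      have xb : x <= b by lra.
      move=> /(_ xb bpi).
      have : 0 <= 2 * A / q * (1 - cos (x - c)).
        apply: mulr_ge0; last by rewrite subr_ge0 cos_le1.
        by rewrite divr_ge0 ?mulr_ge0 ?(ltW q0).
      rewrite -/e /c; lra.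
    have h : 2 * A <= 2 * A / q * (1 - cos (x - c)).
      rewrite mulrAC ler_pdivlMr// ler_wpM2l ?mulr_ge0// -cos_norm.
      apply: cospi; rewrite ltW//= ler_norml /c; lra.
    by lra.
  rewrite /W mulrDr mulrDr mulrBr; lra.
have int1 : leb.-integrable `[0, pi] (EFin \o (fun x => (e - dl) * (k1 x + k2 x) - 2 * A / q * W x)).
  apply: continuous_itv_integrable; apply: contB; apply: contM; (try exact: contC).
  - by apply: contD; exact: cshift.
  - by apply: contD; exact: cw.
have Esin_int z : leb.-integrable `[0, pi] (EFin \o (fun x => E x * sin (z * x))).
  apply: measurable_bounded_integrable => //.
  - by rewrite /= lebesgue_measure_itv /=; case: ifP => _; rewrite ?ltry.
  - apply: measurable_funM => //; apply: measurable_funTS.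
    apply: continuous_measurable_fun => x.
    apply: (@continuous_comp _ _ _ (fun x => z * x) sin); last exact: continuous_sin.
    exact: mulrl_continuous.
  - exists A; split; first exact: num_real.
    move=> r Ar x /=; rewrite in_itv /= => xpi; rewrite normrM.
    apply: (le_trans (ler_pM _ _ (EA x xpi) (sin_max _))) => //.
    by rewrite mulr1 ltW.
have Esin0 (i j : nat) : (i <= n)%N -> (j <= n)%N ->
    \int[leb]_(x in `[0, pi]) (E x * sin ((i%:R - j%:R) * x)) = 0.
  have H (k l : nat) : (k <= n)%N -> (l <= k)%N ->
      \int[leb]_(x in `[0, pi]) (E x * sin ((k%:R - l%:R) * x)) = 0.
    move=> kn lk; rewrite -natrB//; case kl : (k - l)%N => [|m].
      transitivity (\int[leb]_(x in `[0, pi]) (0 : R)).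
        by apply: eq_Rintegral => x _; rewrite mul0r sin0 mulr0.
      by rewrite Rintegral_cst// mul0r.
    by apply: Eorth; rewrite -kl /= (leq_trans (leq_subr _ _))// andbT kl.
  move=> iN jN; have [/H->//|/ltnW ij] := leqP j i.
  transitivity (\int[leb]_(x in `[0, pi]) ((-1) * (E x * sin ((j%:R - i%:R) * x)))).
    by apply: eq_Rintegral => x _; rewrite -(opprB (j%:R : R)) [in LHS]mulNr sinN mulrN mulN1r.
  by rewrite RintegralZl// H// mulr0.
have k12alg (a z y d : R) :
    a * cos (z * (y - d)) - a * cos (z * (y + d)) = 2 * a * sin (z * d) * sin (z * y).
  by rewrite !mulrDr mulrN cosB cosD; ring.
have k12 x : k1 x - k2 x = \sum_(p : 'I_n.+1 * 'I_n.+1)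
    (2 * ampl p * sin (freq p * c)) * sin (freq p * x).
  rewrite /k1 /k2 /kernel -sumrB; apply: eq_bigr => p _.
  exact: k12alg.
pose tm (p : 'I_n.+1 * 'I_n.+1) x := (2 * ampl p * sin (freq p * c)) * (E x * sin (freq p * x)).
have eqE : (fun x => E x * (k1 x - k2 x)) = fun x => \sum_(p : 'I_n.+1 * 'I_n.+1) tm p x.
  by apply/funext => x; rewrite k12 mulr_sumr; apply: eq_bigr => p _; rewrite mulrCA.
have tint (p : 'I_n.+1 * 'I_n.+1) : leb.-integrable `[0, pi] (EFin \o tm p).
  have := @integrableZl _ _ _ leb `[0, pi] _ (2 * ampl p * sin (freq p * c)) _ (Esin_int (freq p)).
  by apply.
have int2 : leb.-integrable `[0, pi] (EFin \o (fun x => E x * (k1 x - k2 x))).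
  rewrite eqE (_ : _ \o _ = fun x => (\sum_(p : 'I_n.+1 * 'I_n.+1) (EFin \o tm p) x)%E).
    exact: integrable_sum.
  by apply/funext => x; rewrite /= sumEFin.
have Z : \int[leb]_(x in `[0, pi]) (E x * (k1 x - k2 x)) = 0.
  rewrite eqE Rintegral_sum//; apply: big1 => p _.
  by rewrite RintegralZl// Esin0 ?mulr0// -ltnS.
have := @le_Rintegral _ _ _ leb `[0, pi] _ _ _ int1 int2.
rewrite Z RintegralB//; last 2 first.
- apply: continuous_itv_integrable; apply: contM; first exact: contC.
  by apply: contD; exact: cshift.
- apply: continuous_itv_integrable; apply: contM; first exact: contC.
  by apply: contD; exact: cw.
rewrite RintegralZl//; last first.
  by apply: continuous_itv_integrable; apply: contD; exact: cshift.
rewrite RintegralZl//; last first.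
  by apply: continuous_itv_integrable; apply: contD; exact: cw.
rewrite integral_kernel integral_kernel_moment sum_profile_sqr sum_profile_diff.
have ptw x : `[0, pi]%classic x ->
    (e - dl) * (k1 x + k2 x) - 2 * A / q * W x <= E x * (k1 x - k2 x).
  by rewrite /= in_itv /=; exact: pointwise.
have mI : measurable (`[0, pi]%classic : set R) by exact: measurable_itv.
move=> /(_ mI ptw).
set y : R := n%:R; have pi0 := pi_gt0 R.
have y2 : 80%:R <= y ^+ 2.
  by apply: (le_trans ndl); rewrite exprMn ler_piMr ?sqr_ge0// expr_le1// ltW.
have y0 : 0 < y by rewrite /y ltr0n.
(* The hypothesis with 80 is made for this 20: the ratio of moment to mass below puts the factor 10
   before [A], and 10 / 20 is the 1/2 of the conclusion. *)
have q4 : 20%:R <= q * (y ^+ 2 + 1).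
  have : dl ^+ 2 / 4 <= q by apply: one_sub_cos_ge; rewrite ltW.
  rewrite exprMn -/y in ndl.
  move=> h; apply: le_trans (_ : dl ^+ 2 / 4 * y ^+ 2 <= _); first by lra.
  by apply: ler_pM; rewrite ?divr_ge0 ?sqr_ge0//; lra.
have -> : (e - dl) * (2 * pi * ((y ^+ 5 - y) / 30)) - 2 * A / q * (pi * ((y ^+ 3 - y) / 3)) =
   (pi * (y * (y ^+ 2 - 1)) / (15 * q)) * ((e - dl) * (q * (y ^+ 2 + 1)) - 10 * A).
  by field; rewrite (gt_eqF q0).
have c0 : 0 < pi * (y * (y ^+ 2 - 1)) / (15 * q).
  by rewrite divr_gt0 ?mulr_gt0// subr_gt0; lra.
rewrite pmulr_rle0// => h.
have [ed|ed] := leP e dl; first by lra.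
have : (e - dl) * 20%:R <= (e - dl) * (q * (y ^+ 2 + 1)).
  by apply: ler_wpM2l => //; rewrite subr_ge0 ltW.
by move: h; lra.
Qed.

(** The Chebyshev polynomials, transported to [0, 1] with a reflection. Their recurrence has three
    terms, so the induction carries two consecutive degrees. *)
Lemma cheb_poly (m : nat) : exists p : {poly R}, (size p <= m.+1)%N /\
  forall x, p.[(1 - cos x) / 2] = cos (m%:R * x).
Proof.
suff [] : (exists p : {poly R}, (size p <= m.+1)%N /\
    forall x, p.[(1 - cos x) / 2] = cos (m%:R * x)) /\
  (exists p : {poly R}, (size p <= m.+2)%N /\
    forall x, p.[(1 - cos x) / 2] = cos (m.+1%:R * x)) by [].
elim: m => [|m [[p [sp pE]] [q [sq qE]]]].
  split; first by exists 1; rewrite size_poly1; split => // x; rewrite hornerC mul0r cos0.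
  exists (1 - 2 *: 'X); split.
    rewrite (leq_trans (size_polyD _ _))// size_poly1 size_polyN.
    by rewrite geq_max /= (leq_trans (size_scale_leq _ _))// size_polyX.
  by move=> x; rewrite hornerD hornerN hornerZ hornerX hornerC mul1r; field.
split; first by exists q.
exists (2 *: (1 - 2 *: 'X) * q - p); split.
  rewrite (leq_trans (size_polyD _ _))// size_polyN geq_max; apply/andP; split.
    rewrite (leq_trans (size_polyMleq _ _))//.
    have : (size (2 *: (1 - 2 *: 'X) : {poly R})%R <= 2)%N.
      rewrite (leq_trans (size_scale_leq _ _))// (leq_trans (size_polyD _ _))//.
      rewrite size_poly1 size_polyN.
      by rewrite geq_max /= (leq_trans (size_scale_leq _ _))// size_polyX.
    by move: sq; lia.
  by rewrite (leq_trans sp)//; lia.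
move=> x; rewrite hornerD hornerN hornerM !hornerZ hornerD hornerN hornerZ hornerX.
rewrite hornerC pE qE.
have -> : cos (m%:R * x) = cos (m.+1%:R * x - x) by congr cos; rewrite -natr1; ring.
have -> : cos (m.+2%:R * x) = cos (m.+1%:R * x + x) by congr cos; rewrite -(natr1 m.+1); ring.
by rewrite cosB cosD; field.
Qed.

(** Unlike [gauss_legendre], this imposes no order on the nodes, so it survives their reflection to
    [1 - mu k]. [K] bounds the size, that is the degree plus one. *)
Definition quadrature (n K : nat) (mu w : 'I_n -> R) :=
  [/\ forall k, 0 <= mu k <= 1, forall k, 0 <= w k & forall p : {poly R}, (size p <= K)%N ->
     \sum_(k < n) w k * p.[mu k] = \int[leb]_(x in unit_itv) p.[x]].

Lemma quadrature_reflect n K (mu w : 'I_n -> R) :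
  quadrature K mu w -> quadrature K (fun k => 1 - mu k) w.
Proof.
move=> [mu01 w0 ex]; split => [k||p pK]; first by have := mu01 k; lra.
- exact: w0.
have sq : size (1 - 'X : {poly R}) = 2%N.
  by rewrite -opprB size_polyN -[1]/(1%:P) size_XsubC.
have pE x : (p \Po (1 - 'X)).[x] = p.[1 - x] by rewrite horner_comp !hornerE.
transitivity (\sum_(k < n) w k * (p \Po (1 - 'X)).[mu k]).
  by apply: eq_bigr => k _; rewrite pE.
rewrite ex ?size_comp_poly2// /unit_itv.
rewrite [RHS]Rintegration_by_substitution_onem ?ler01 ?lexx//; last first.
  by apply: continuous_subspaceT; exact: continuous_horner.
by rewrite /unstable.onem subrr; apply: eq_Rintegral => x _; rewrite pE.
Qed.

Lemma quadrature_sum1 n K (mu w : 'I_n -> R) : (0 < K)%N -> quadrature K mu w ->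
  \sum_(k < n) w k = 1.
Proof.
move=> K0 [_ _ /(_ 1)]; rewrite size_poly1 => /(_ K0).
under eq_bigr do rewrite hornerC mulr1.
by move=> ->; have := @Rintegral_deriv_poly R 'X; rewrite derivX !hornerX subr0.
Qed.

(* The discrepancy of the nodes in the variable theta, [mu = (1 - cos theta) / 2],
   in which polynomials of degree m become cosine polynomials. *)
Definition angular_discrepancy n (mu w : 'I_n -> R) x :=
  (1 - cos x) / 2 - \sum_(k < n) w k * (acos (1 - 2 * mu k) < x)%R%:R.

Section node_angles.
Context {n K : nat} {mu w : 'I_n -> R}.
Hypothesis quad : quadrature K mu w.
Hypothesis K1 : (1 < K)%N.

Let th k := acos (1 - 2 * mu k).
Local Notation D := (angular_discrepancy mu w).

Let mu01 k : -1 <= 1 - 2 * mu k <= 1.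
Proof. by have [/(_ k) + _ _] := quad; lra. Qed.

Let cos_th k : cos (th k) = 1 - 2 * mu k.
Proof. by rewrite /th acosK// in_itv /=. Qed.

Let th0 k : 0 <= th k <= pi.
Proof. by rewrite acos_ge0 ?acos_lepi. Qed.

Lemma angular_discrepancy_bound x : `|D x| <= 1.
Proof.
rewrite /angular_discrepancy.
have [_ w0 _] := quad.
have s0 : 0 <= \sum_(k < n) w k * (th k < x)%R%:R by rewrite sumr_ge0// => k _; rewrite mulr_ge0.
have s1 : \sum_(k < n) w k * (th k < x)%R%:R <= 1.
  rewrite -[leRHS](quadrature_sum1 (ltnW K1) quad); apply: ler_sum => k _.
  by case: (_ < _); rewrite ?mulr1 ?mulr0.
by have := cos_le1 x; have := cos_geN1 x; rewrite ler_norml; lra.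
Qed.

Lemma angular_discrepancy0 : D 0 <= 0.
Proof.
rewrite /angular_discrepancy cos0 subrr mul0r sub0r oppr_le0 sumr_ge0// => k _.
by have [_ w0 _] := quad; rewrite mulr_ge0.
Qed.

Lemma angular_discrepancy_lip x y : 0 <= x <= y -> D y - D x <= (y - x) / 2.
Proof.
move=> /andP[x0 xy]; rewrite /angular_discrepancy.
have : \sum_(k < n) w k * (th k < x)%R%:R <= \sum_(k < n) w k * (th k < y)%R%:R.
  apply: ler_sum => k _; have [_ w0 _] := quad; rewrite ler_wpM2l// ler_nat.
  by case: (ltP (th k) x) => // h; rewrite (lt_le_trans h).
have := @nondecreasing_of_derive _ (fun t => 1 - sin t) (fun t => t + cos t) x y xy.
set s1 := \sum_(_ < _) _; set s2 := \sum_(_ < _) _.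
have h1 t : is_derive t 1 (fun t : R => t + cos t) (1 - sin t).
  by apply: is_derive_eq; rewrite /GRing.scale /=; ring.
have h2 : continuous (fun t : R => 1 - sin t).
  by apply: continuous_of_derivable => t; exact: ex_derive.
move=> /(_ h1 h2).
have h3 t : x <= t <= y -> 0 <= 1 - sin t by rewrite subr_ge0 sin_le1.
by move=> /(_ h3); lra.
Qed.

Lemma angular_discrepancy_measurable : measurable_fun `[0, pi] D.
Proof.
apply: measurable_funTS; rewrite /angular_discrepancy; apply: measurable_funB.
  apply: continuous_measurable_fun; apply: continuous_of_derivable => t; exact: ex_derive.
apply: measurable_sum => k; apply: measurable_funM => //.
apply: nondecreasing_measurable => // x y xy; rewrite ler_nat.
by case: (ltP (th k) x) => // h; rewrite (lt_le_trans h).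
Qed.

(** Integration by parts turns the integral into a multiple of the error of the rule for the
    polynomial that represents cos(m theta), whose degree is below [K]. It is carried out by hand
    because the discrepancy jumps at the nodes: the smooth part has the primitive [F], and each node
    contributes the integral of the sine beyond [th k]. *)
Lemma angular_discrepancy_orth m : (0 < m < K)%N ->
  \int[leb]_(x in `[0, pi]) (D x * sin (m%:R * x)) = 0.
Proof.
move=> /andP[m0 mK]; have [p [sp pE]] := cheb_poly m.
have m_neq0 : m%:R != 0 :> R by rewrite pnatr_eq0 -lt0n.
have [_ _ /(_ p (leq_trans sp mK))] := quad.
pose P := poly_primitive m.+1 p; have dP : P^`() = p by exact: deriv_poly_primitive.
rewrite -{2}dP Rintegral_deriv_poly => ex.
have contS : continuous (fun x : R => sin (m%:R * x)).
  by apply: continuous_of_derivable => x; exact: ex_derive.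
pose F x := m%:R^-1 * (P.[(1 - cos x) / 2] - (1 - cos x) / 2 * cos (m%:R * x)).
have dF x : is_derive x (1 : R) F ((1 - cos x) / 2 * sin (m%:R * x)).
  have hP : is_derive x (1 : R) (fun x : R => P.[(1 - cos x) / 2]) (sin x / 2 * p.[(1 - cos x) / 2]).
    have dg : is_derive x (1 : R) (fun x : R => (1 - cos x) / 2) (sin x / 2).
      by apply: is_derive_eq; rewrite /GRing.scale /=; ring.
    rewrite mulrC -dP; have := is_derive_poly P ((1 - cos x) / 2).
    by move=> dPx; exact: (@is_derive1_comp R (horner P) (fun x => (1 - cos x) / 2) x _ _ dPx dg).
  by apply: is_derive_eq; rewrite /GRing.scale /= pE; field.
have cF : continuous (fun x : R => (1 - cos x) / 2 * sin (m%:R * x)).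
  by apply: continuous_of_derivable => x; exact: ex_derive.
pose f k x := w k * ((th k < x)%R%:R * sin (m%:R * x)).
have mstep k : measurable_fun setT (fun x : R => (th k < x)%R%:R : R).
  apply: nondecreasing_measurable => // x y xy; rewrite ler_nat.
  by case: (ltP (th k) x) => // h; rewrite (lt_le_trans h).
have fint k : leb.-integrable `[0, pi] (EFin \o (fun x => (th k < x)%R%:R * sin (m%:R * x))).
  apply: measurable_bounded_integrable => //.
  - by rewrite /= lebesgue_measure_itv /=; case: ifP => _; rewrite ?ltry.
  - apply: measurable_funTS; apply: measurable_funM; first exact: mstep.
    exact: continuous_measurable_fun.
  - exists 1; split; first exact: num_real.
    move=> r r1 x _ /=; rewrite normrM (le_trans _ (ltW r1))// mulr_ile1// ?sin_max//.
    by case: (_ < _); rewrite ?normr1 ?normr0.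
have fint' k : leb.-integrable `[0, pi] (EFin \o f k).
  by have := @integrableZl _ _ _ leb `[0, pi] _ (w k) _ (fint k); apply.
transitivity (\int[leb]_(x in `[0, pi]) ((1 - cos x) / 2 * sin (m%:R * x) - \sum_(k < n) f k x)).
  apply: eq_Rintegral => x _; rewrite /D mulrBl mulr_suml; congr (_ - _).
  by apply: eq_bigr => k _; rewrite /f -mulrA.
rewrite RintegralB//; last 2 first.
- exact: continuous_itv_integrable.
- rewrite (_ : _ \o _ = fun x => (\sum_(k < n) (EFin \o f k) x)%E).
    exact: integrable_sum.
  by apply/funext => x; rewrite /= sumEFin.
rewrite (FTC_smooth (pi_ge0 R) dF cF) Rintegral_sum//.
have fE k : \int[leb]_(x in `[0, pi]) f k x = w k * (m%:R^-1 * (cos (m%:R * th k) - cos (m%:R * pi))).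
  rewrite RintegralZl//; congr (_ * _).
  have /andP[t0 tpi] := th0 k.
  have dG x : is_derive x (1 : R) (fun x => - (m%:R^-1 * cos (m%:R * x))) (sin (m%:R * x)).
    by apply: is_derive_eq; rewrite /GRing.scale /=; field.
  transitivity (\int[leb]_(x in `[0, pi] `&` `]th k, pi]) sin (m%:R * x)).
    rewrite Rintegral_mkcondr; apply: eq_Rintegral => x.
    rewrite inE /= in_itv /= => /andP[x0 xpi]; rewrite /patch.
    by rewrite mem_setE in_itv /= xpi andbT; case: (_ < _); rewrite ?mul1r ?mul0r.
  have -> : `[0, pi]%classic `&` `]th k, pi]%classic = `]th k, pi]%classic :> set R.
    apply/seteqP; split => x /=; first by case.
    by rewrite !in_itv /= => /andP[xt xpi]; rewrite xpi xt (le_trans t0 (ltW xt)).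
  rewrite Rintegral_itv_obnd_cbnd; last first.
    apply: (@integrableS _ _ _ leb `[th k, pi]%classic) => //.
      by move=> x /=; rewrite !in_itv /= => /andP[/ltW -> ->].
    exact: continuous_itv_integrable.
  by rewrite (FTC_smooth tpi dG contS); ring.
have th_ex : \sum_(k < n) w k * cos (m%:R * th k) = P.[1] - P.[0].
  by rewrite -ex; apply: eq_bigr => k _; rewrite -pE cos_th; congr (_ * p.[_]); field.
have -> : \sum_(k < n) \int[leb]_(x in `[0, pi]) f k x =
  m%:R^-1 * (\sum_(k < n) w k * cos (m%:R * th k) - (\sum_(k < n) w k) * cos (m%:R * pi)).
  by rewrite mulr_suml -sumrB mulr_sumr; apply: eq_bigr => k _; rewrite fE; ring.
rewrite th_ex (quadrature_sum1 (ltnW K1) quad) /F cospi cos0 subrr mul0r.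
have -> : (1 - -1) / 2 = 1 :> R by field.
by rewrite mul0r; ring.
Qed.

Lemma angle_lt x k : 0 <= x <= pi -> (th k < x) = (mu k < (1 - cos x) / 2).
Proof.
move=> xpi; have /andP[t0 t1] := th0 k.
have := @ltr_cos R (th k) x; rewrite !in_itv /= t0 t1 xpi => /(_ isT isT) <-.
by rewrite cos_th ltr_pdivlMr// ltrBrDl -ltrBrDr (mulrC 2).
Qed.

End node_angles.

(** Reflecting the nodes amounts to theta -> pi - theta and changes the sign of the discrepancy,
    except that a node at the threshold now counts. Upper bounds for a rule and for its reflection
    are therefore two-sided bounds. *)
Lemma angular_discrepancy_reflect n K (mu w : 'I_n -> R) x :
  (1 < K)%N -> quadrature K mu w -> 0 <= x <= pi ->
  angular_discrepancy (fun k => 1 - mu k) w (pi - x) =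
  \sum_(k < n) w k * (mu k <= (1 - cos x) / 2)%R%:R - (1 - cos x) / 2.
Proof.
move=> K1 quad xpi; rewrite /angular_discrepancy.
have refl := quadrature_reflect quad.
have pix : 0 <= pi - x <= pi by move: xpi; lra.
have cosx : cos (pi - x) = - cos x by rewrite cosB cospi sinpi mul0r addr0 mulN1r.
rewrite (eq_bigr (fun k => w k - w k * (mu k <= (1 - cos x) / 2)%R%:R)); last first.
  move=> k _; rewrite (angle_lt refl k pix) cosx opprK.
  have -> : (1 - mu k < (1 + cos x) / 2) = ~~ (mu k <= (1 - cos x) / 2).
    by rewrite -ltNge; apply/idP/idP; lra.
  by case: (_ <= _) => /=; rewrite ?mulr1 ?mulr0 ?subrr ?subr0.
rewrite sumrB (quadrature_sum1 (ltnW K1) quad) cosx; lra.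
Qed.

Lemma angular_discrepancy_le n (N : nat) (mu w : 'I_n -> R) :
  (8 < N)%N -> quadrature N.*2 mu w ->
  (forall x, 0 <= x <= pi -> angular_discrepancy mu w x <= 18%:R / N%:R) /\
  (forall x, 0 <= x <= pi -> angular_discrepancy (fun k => 1 - mu k) w x <= 18%:R / N%:R).
Proof.
move=> N8 quad; have K1 : (1 < N.*2)%N by lia.
have quad' := quadrature_reflect quad.
set D1 := angular_discrepancy mu w; set D2 := angular_discrepancy _ w.
pose S := (D1 @` `[0, pi]) `|` (D2 @` `[0, pi]).
have S_sup : has_sup S.
  split; first by exists (D1 0); left; exists 0 => //=; rewrite in_itv/= lexx pi_ge0.
  exists 1 => _ [] [x _ <-]; rewrite (le_trans (ler_norm _))//.
  - exact: angular_discrepancy_bound quad K1 x.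
  - exact: angular_discrepancy_bound quad' K1 x.
(* By reflection, the supremum of both discrepancies also bounds their absolute values.
   [one_sided_bound] then improves it to [A <= dl + A / 2], hence [A <= 2 * dl]. *)
pose A := sup S.
have D1A x : 0 <= x <= pi -> D1 x <= A.
  by move=> xpi; apply: sup_upper_bound => //; left; exists x => //=; rewrite in_itv.
have D2A x : 0 <= x <= pi -> D2 x <= A.
  by move=> xpi; apply: sup_upper_bound => //; right; exists x => //=; rewrite in_itv.
have pix x : 0 <= x <= pi -> 0 <= pi - x <= pi by lra.
have reflN (mu' : 'I_n -> R) x : quadrature N.*2 mu' w -> 0 <= x <= pi ->
    - angular_discrepancy mu' w x <= angular_discrepancy (fun k => 1 - mu' k) w (pi - x).
  move=> q xpi; rewrite (angular_discrepancy_reflect K1 q xpi).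
  rewrite /angular_discrepancy opprB lerD2r; apply: ler_sum => k _.
  have [_ w0 _] := q; rewrite ler_wpM2l// ler_nat.
  by have := angle_lt q k xpi => /= ->; case: ltP => // /ltW ->.
have D1N x : 0 <= x <= pi -> `|D1 x| <= A.
  move=> xpi; rewrite ler_norml D1A// andbT lerNl.
  by apply: le_trans (reflN _ _ quad xpi) (D2A _ (pix _ xpi)).
have D2N x : 0 <= x <= pi -> `|D2 x| <= A.
  move=> xpi; rewrite ler_norml D2A// andbT lerNl.
  apply: le_trans (reflN _ _ quad' xpi) _.
  have -> : (fun k => 1 - (1 - mu k)) = mu by apply/funext => k; rewrite subKr.
  exact: D1A _ (pix _ xpi).
have n0 : (0 < N.*2.-1)%N by lia.
have NR : (9%:R : R) <= N%:R by rewrite ler_nat.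
have Np : (0 : R) < N%:R by lra.
(* There are 2N - 1 >= N orthogonality relations, so that (2N - 1) dl >= 9 and its square is at
   least 81; [dl <= 1] holds because N >= 9, and 18 is twice 9. *)
pose dl : R := 9%:R / N%:R.
have dl1 : 0 < dl <= 1 by rewrite divr_gt0//= ler_pdivrMr// mul1r.
have ndl : 80%:R <= (N.*2.-1%:R * dl) ^+ 2.
  apply: (@le_trans _ _ (9%:R ^+ 2)); first by lra.
  have dl0 : 0 <= dl by case/andP: dl1 => /ltW.
  apply: lerXn2r; rewrite ?nnegrE ?ler0n ?mulr_ge0//.
  rewrite /dl mulrCA ler_peMr// ler_pdivlMr// mul1r ler_nat; lia.
have bnd (mu' : 'I_n -> R) : quadrature N.*2 mu' w ->
    (forall x, 0 <= x <= pi -> `|angular_discrepancy mu' w x| <= A) ->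
    forall x, 0 <= x <= pi -> angular_discrepancy mu' w x <= dl + A / 2.
  move=> q DA; apply: (@one_sided_bound N.*2.-1) => //.
  - exact: angular_discrepancy_measurable.
  - by move=> m /andP[m0 mN]; apply: (angular_discrepancy_orth q K1); lia.
  - exact: angular_discrepancy0 q.
  - by move=> x y xy _; exact: angular_discrepancy_lip q _ _ xy.
have A2 : A <= dl + A / 2.
  apply: ge_sup; first by case: S_sup.
  move=> y [] [x /= + <-]; rewrite in_itv /= => xpi.
  - exact: bnd quad D1N x xpi.
  - exact: bnd quad' D2N x xpi.
have A3 : A <= 18%:R / N%:R by move: A2; rewrite /dl; lra.
by split => x xpi; apply: le_trans A3; [exact: D1A|exact: D2A].
Qed.

Lemma quadrature_discrepancy n (N : nat) (mu w : 'I_n -> R) a :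
  (0 < N)%N -> quadrature N.*2 mu w -> 0 <= a <= 1 ->
  a - \sum_(k < n) w k * (mu k < a)%R%:R <= 18%:R / N%:R /\
  \sum_(k < n) w k * (mu k <= a)%R%:R - a <= 18%:R / N%:R.
Proof.
move=> N0 quad a01; have K1 : (1 < N.*2)%N by lia.
(* For small [N] the bound exceeds 1, and both differences are at most 1. *)
have [N8|N8] := leqP N 8.
  have N2 : 1 <= 18%:R / N%:R :> R.
    by rewrite ler_pdivlMr ?ltr0n// mul1r ler_nat (leq_trans N8).
  have [_ w0 _] := quad; have w1 := quadrature_sum1 (ltnW K1) quad.
  have s0 : 0 <= \sum_(k < n) w k * (mu k < a)%R%:R by rewrite sumr_ge0// => k _; rewrite mulr_ge0.
  have s1 : \sum_(k < n) w k * (mu k <= a)%R%:R <= 1.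
    rewrite -[leRHS]w1; apply: ler_sum => k _.
    by case: (mu k <= a) => /=; rewrite ?mulr1 ?mulr0.
  by split; lra.
pose x := acos (1 - 2 * a).
have cx : cos x = 1 - 2 * a by rewrite acosK ?in_itv//=; lra.
have xpi : 0 <= x <= pi by rewrite acos_ge0 ?acos_lepi//; lra.
have ax : a = (1 - cos x) / 2 by rewrite cx; field.
have [D1 D2] := angular_discrepancy_le N8 quad.
split.
  apply: le_trans (D1 x xpi); rewrite /angular_discrepancy -ax lerD2l lerN2.
  by apply: ler_sum => k _; have := angle_lt quad k xpi => /= ->; rewrite -ax.
have pix : 0 <= pi - x <= pi by move: xpi; lra.
by have := D2 _ pix; rewrite (angular_discrepancy_reflect K1 quad xpi) -ax.
Qed.

End discrepancy.

(** * The Koksma inequality for the double Gauss rule *)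

Section koksma.
Context {R : realType} {N : nat} {mu w : 'I_N.+1 -> R}.
Hypothesis gauss : gauss_legendre mu w.
Notation leb := (@lebesgue_measure R).
Let eps : R := 18%:R / N.+1%:R.

Let quad : quadrature N.+1.*2 mu w.
Proof.
split=> [k|k|p pN].
- by have [/(_ k) + _ _] := gauss; rewrite /unit_itv /= in_itv.
- exact: (gauss_weight_ge0 gauss).
- by have [_ _ ->] := gauss.
Qed.

Let w0 k : 0 <= w k. Proof. by have [_ + _] := quad. Qed.

Lemma gauss_sum1 : \sum_(k < N.+1) w k = 1.
Proof. exact: quadrature_sum1 quad. Qed.

(** The points [U j] cut [0, 1] into cells of lengths [w k]; the discrepancy bound at the nodes
    places [mu k] within [eps] of both ends of its cell. *)
Let U (j : nat) := \sum_(k < N.+1 | (k < j)%N) w k.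

Let US (k : 'I_N.+1) : U k.+1 = U k + w k.
Proof.
rewrite /U (bigD1 k)//= addrC; congr (_ + _); apply: eq_bigl => i.
by rewrite ltnS (ltn_neqAle i k) andbC.
Qed.

Let UN : U N.+1 = 1.
Proof. by rewrite -gauss_sum1 /U; apply: eq_bigl => i; rewrite ltn_ord. Qed.

Let mu_lt (i k : 'I_N.+1) : (mu i < mu k) = (i < k)%N.
Proof.
have [_ lt_mu _] := gauss.
have [ik|ki|/val_inj ->] := ltngtP i k; last by rewrite ltxx.
- by rewrite lt_mu.
- by apply/negbTE; rewrite -leNgt ltW// lt_mu.
Qed.

Let mu_le_U (k : 'I_N.+1) : mu k <= U k + eps.
Proof.
have [mu01 _ _] := quad.
have [+ _] := quadrature_discrepancy (ltn0Sn N) quad (mu01 k).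
rewrite -/eps lerBlDl; congr (_ <= _ + _).
rewrite /U [RHS]big_mkcond; apply: eq_bigr => i _; rewrite mu_lt.
by case: (i < k)%N; rewrite ?mulr1 ?mulr0.
Qed.

Let U_le_mu (k : 'I_N.+1) : U k.+1 - eps <= mu k.
Proof.
have [mu01 _ _] := quad.
have [_ +] := quadrature_discrepancy (ltn0Sn N) quad (mu01 k).
rewrite -/eps lerBlDl lerBlDr addrC; congr (_ <= _ + _).
rewrite /U [RHS]big_mkcond; apply: eq_bigr => i _; rewrite leNgt mu_lt -leqNgt ltnS.
by case: (i <= k)%N; rewrite ?mulr1 ?mulr0.
Qed.

(** When the cells of [U] are shifted right by [eps], each [mu k] lies to the left of its cell and
    [w k * F (mu k)] is at most the integral of [F] there; when they are shifted left, it is at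
    least that. What the shift moves out of [0, 1] costs [eps * M]. The integral enters as an
    abstract additive [I] with mean value bounds, so that one argument serves both signs of the
    direction, and [F] is constrained on ]0, 1] only. *)
Lemma koksma_monotone (F : R -> R) (I : R -> R -> R) (M : R) :
  (forall a b c, 0 <= a <= b -> b <= c <= 1 -> I a c = I a b + I b c) ->
  (forall a b m, 0 <= a <= b -> b <= 1 -> (forall x, a < x <= b -> m <= F x) ->
     m * (b - a) <= I a b) ->
  (forall a b m, 0 <= a <= b -> b <= 1 -> (forall x, a < x <= b -> F x <= m) ->
     I a b <= m * (b - a)) ->
  (forall x y, 0 < x <= y -> y <= 1 -> F x <= F y) ->
  (forall x, 0 < x <= 1 -> 0 <= F x <= M) ->
  `|\sum_(k < N.+1) w k * F (mu k) - I 0 1| <= eps * M.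
Proof.
move=> Iadd Ilo Ihi Fmono FM.
have eps0 : 0 < eps by rewrite divr_gt0// ltr0n.
have M0 : 0 <= M by have := FM 1; rewrite ltr01 lexx => /(_ isT); lra.
have mupos k : 0 < mu k <= 1.
  by rewrite (gauss_node_gt0 gauss)//=; have [/(_ k) + _ _] := quad; lra.
have U0 j : 0 <= U j by rewrite sumr_ge0.
have U0E : U 0 = 0 by rewrite /U big_pred0.
pose S (j : nat) := \sum_(k < N.+1 | (k < j)%N) w k * F (mu k).
have SS (k : 'I_N.+1) : S k.+1 = S k + w k * F (mu k).
  rewrite /S (bigD1 k)//= addrC; congr (_ + _); apply: eq_bigl => i.
  by rewrite ltnS (ltn_neqAle i k) andbC.
have S0E : S 0 = 0 by rewrite /S big_pred0.
have SN : S N.+1 = \sum_(k < N.+1) w k * F (mu k).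
  by rewrite /S; apply: eq_bigl => i; rewrite ltn_ord.
rewrite -SN.
pose c1 j := Num.min 1 (U j + eps).
pose c0 j := Num.max 0 (U j - eps).
have U1 j : U j <= 1.
  rewrite -gauss_sum1 /U [leRHS](bigID (fun k : 'I_N.+1 => (k < j)%N)) /=.
  by rewrite lerDl sumr_ge0.
(* Where the shifted cells are cut off at 1 there is no integral to compare with; the last term
   replaces [F] by [M] on that length. *)
have up j : (j <= N.+1)%N -> S j <= I (c1 0) (c1 j) + M * (U j - (c1 j - c1 0)).
  elim: j => [_|j IH jN].
    rewrite S0E U0E subrr subr0 mulr0 addr0.
    have := Ilo (c1 0) (c1 0) 0; rewrite mul0r; apply.
    - by rewrite lexx andbT /c1 le_min ler01 U0E add0r ltW.
    - by rewrite /c1 ge_min lexx.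
    - by move=> x /andP[h1 h2]; have := lt_le_trans h1 h2; rewrite ltxx.
  pose k := Ordinal jN; have -> : j.+1 = (k : nat).+1 by [].
  rewrite SS US /= -/(U j).
  have jN' : (j <= N.+1)%N by apply: ltnW.
  have := IH jN'; set c := c1 j; set d := Num.min 1 (U j + w k + eps).
  have dE : c1 k.+1 = d by rewrite /c1 US.
  rewrite dE; have wk := w0 k.
  have cd : c <= d.
    by rewrite /c /d /c1 le_min !ge_min lexx /=; apply/orP; right; lra.
  have dc : d - c <= w k.
    rewrite /c /d /c1; case: (leP 1 (U j + eps)); case: (leP 1 (U j + w k + eps)); lra.
  have d1 : d <= 1 by rewrite /d ge_min lexx.
  have c10 : 0 <= c1 0 <= c.
    rewrite /c /c1 U0E add0r le_min ler01 (ltW eps0)/= le_min !ge_min lexx /=.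
    by apply/orP; right; have := U0 j; lra.
  have := Iadd (c1 0) c d c10; rewrite cd d1 => /(_ isT) ->.
  have Fk := FM _ (mupos k).
  have : F (mu k) * (d - c) <= I c d.
    apply: Ilo => //; first by case/andP: c10 => a b; rewrite cd (le_trans a b).
    move=> x /andP[cx xd]; apply: Fmono; last by lra.
    case/andP: (mupos k) => -> _ /=; apply: le_trans (ltW cx).
    have cU : c = U j + eps by rewrite /c /c1; case: leP => // h; move: cx; rewrite /c /c1 min_l//; lra.
    by rewrite cU; exact: mu_le_U k.
  have : F (mu k) * (w k - (d - c)) <= M * (w k - (d - c)).
    by apply: ler_wpM2r; lra.
  lra.
(* The cut is now at 0, and the lost part of each weight is simply dropped, as [F >= 0]. *)
have lo j : (j <= N.+1)%N -> I 0 (c0 j) <= S j.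
  elim: j => [_|j IH jN].
    have c00 : c0 0 = 0 by rewrite /c0 U0E max_l//; lra.
    have := Ihi 0 0 0; rewrite S0E c00 mul0r lexx; apply => //.
    by move=> x /andP[h1 h2]; have := lt_le_trans h1 h2; rewrite ltxx.
  pose k := Ordinal jN; have -> : j.+1 = (k : nat).+1 by [].
  rewrite SS /=.
  have := IH (ltnW jN); set c := c0 j; set d := c0 _.
  have dE : d = Num.max 0 (U j + w k - eps) by rewrite /d /c0 (US k).
  have wk := w0 k.
  have cd : c <= d.
    by rewrite dE /c /c0 ge_max !le_max lexx /=; apply/orP; right; lra.
  have dc : d - c <= w k.
    rewrite dE /c /c0; case: (leP 0 (U j - eps)); case: (leP 0 (U j + w k - eps)); lra.
  have d1 : d <= 1 by rewrite /d /c0 ge_max ler01 /=; have := U1 j.+1; lra.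
  have c10 : (0 : R) <= 0 <= c by rewrite lexx /c /c0 le_max lexx.
  have := Iadd 0 c d c10; rewrite cd d1 => /(_ isT) ->.
  have Fk := FM _ (mupos k).
  have : I c d <= F (mu k) * (d - c).
    apply: Ihi => //; first by rewrite cd andbT; case/andP: c10.
    move=> x /andP[cx xd].
    have x0 : 0 < x by apply: le_lt_trans cx; case/andP: c10.
    apply: Fmono; last by case/andP: (mupos k).
    rewrite x0 /=; apply: (le_trans xd).
    have dU : d = U j.+1 - eps.
      by rewrite /d /c0; case: leP => // h; move: xd; rewrite /d /c0 max_l; [lra|exact: ltW].
    by rewrite dU; exact: U_le_mu k.
  have : F (mu k) * (d - c) <= F (mu k) * w k by apply: ler_wpM2l; lra.
  rewrite [w k * _]mulrC; lra.
have := up _ (leqnn _); have := lo _ (leqnn _).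
set s := S N.+1; have -> : c1 N.+1 = 1 by rewrite /c1 UN min_l//; lra.
have -> : c0 N.+1 = Num.max 0 (1 - eps) by rewrite /c0 UN.
have -> : c1 0 = Num.min 1 eps by rewrite /c1 U0E add0r.
set e1 := Num.min 1 eps; set e0 := Num.max 0 (1 - eps).
have e1b : 0 <= e1 <= 1 by rewrite /e1 le_min ler01 (ltW eps0) ge_min lexx.
have e1e : e1 <= eps by rewrite /e1 ge_min lexx orbT.
have e0b : 0 <= e0 <= 1 by rewrite /e0 le_max lexx ge_max ler01 /=; lra.
have e0e : 1 - e0 <= eps by rewrite lerBlDl -lerBlDr /e0 le_max lexx orbT.
case/andP: e0b => e00 e01; case/andP: e1b => e10 e11.
have h1 : I 0 1 = I 0 e1 + I e1 1 by apply: Iadd; rewrite ?lexx ?e10 ?e11.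
have h0 : I 0 1 = I 0 e0 + I e0 1 by apply: Iadd; rewrite ?lexx ?e00 ?e01.
have hh : 0 <= I 0 e1.
  have := Ilo 0 e1 0; rewrite mul0r; apply; rewrite ?lexx//.
  by move=> x /andP[x0 xe]; have := FM x; rewrite x0 (le_trans xe)// => /(_ isT) /andP[].
have hh0 : I e0 1 <= M * (1 - e0).
  apply: Ihi; rewrite ?e00// => x /andP[x0 x1].
  by have := FM x; rewrite x1 andbT (le_lt_trans e00 x0) => /(_ isT) /andP[].
have h2 : M * e1 <= eps * M by rewrite mulrC ler_wpM2r.
have h3 : M * (1 - e0) <= eps * M by rewrite mulrC ler_wpM2r.
rewrite UN ler_norml; lra.
Qed.

Lemma Rintegral_ge_cst (D : set R) (f : R -> R) m l : measurable D ->
  leb D = l%:E -> leb.-integrable D (EFin \o f) -> (forall x, D x -> m <= f x) ->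
  m * l <= \int[leb]_(x in D) f x.
Proof.
move=> mD Dl fi mf; have -> : m * l = \int[leb]_(x in D) m.
  by rewrite Rintegral_cst//; congr (_ * _); exact: (esym (congr1 fine Dl)).
apply: le_Rintegral => //; apply: measurable_bounded_integrable => //.
  by rewrite /= Dl ltry.
exists `|m|; split; first exact: num_real.
by move=> r mr x _ /=; exact: ltW.
Qed.

Lemma Rintegral_le_cst (D : set R) (f : R -> R) m l : measurable D ->
  leb D = l%:E -> leb.-integrable D (EFin \o f) -> (forall x, D x -> f x <= m) ->
  \int[leb]_(x in D) f x <= m * l.
Proof.
move=> mD Dl fi mf; have -> : m * l = \int[leb]_(x in D) m.
  by rewrite Rintegral_cst//; congr (_ * _); exact: (esym (congr1 fine Dl)).
apply: le_Rintegral => //; apply: measurable_bounded_integrable => //.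
  by rewrite /= Dl ltry.
exists `|m|; split; first exact: num_real.
by move=> r mr x _ /=; exact: ltW.
Qed.

Lemma leb_oc (a b : R) : a <= b -> leb `]a, b]%classic = (b - a)%:E.
Proof.
move=> ab; rewrite lebesgue_measure_itv /= lte_fin.
by case: ltP => // ba; rewrite (le_anti (introT andP (conj ab ba))) subrr.
Qed.

Lemma leb_oo (a b : R) : a <= b -> leb `]a, b[%classic = (b - a)%:E.
Proof.
move=> ab; rewrite lebesgue_measure_itv /= lte_fin.
by case: ltP => // ba; rewrite (le_anti (introT andP (conj ab ba))) subrr.
Qed.

Lemma koksma_monotone_pos (F : R -> R) m M :
  leb.-integrable `[0, 1] (EFin \o F) ->
  (forall x y, 0 < x <= y -> y <= 1 -> F x <= F y) ->
  (forall x, 0 < x <= 1 -> m <= F x <= M) ->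
  `|\sum_(k < N.+1) w k * F (mu k) - \int[leb]_(x in `[0, 1]) F x| <= eps * (M - m).
Proof.
move=> Fi Fmono FM.
have Fi' a b : 0 <= a -> b <= 1 -> leb.-integrable `]a, b]%classic (EFin \o F).
  move=> a0 b1; apply: integrableS Fi => // x /=; rewrite !in_itv /= => /andP[ax xb].
  by rewrite (le_trans xb)// andbT (le_trans a0)// ltW.
pose I a b := \int[leb]_(x in `]a, b]) F x - m * (b - a).
have := @koksma_monotone (fun x => F x - m) I (M - m).
have -> : \sum_(k < N.+1) w k * (F (mu k) - m) = \sum_(k < N.+1) w k * F (mu k) - m.
  by rewrite -[m in RHS]mul1r -gauss_sum1 mulr_suml -sumrB; apply: eq_bigr => k _; ring.
have I01 : I 0 1 = \int[leb]_(x in `[0, 1]) F x - m.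
  by rewrite /I subr0 mulr1 Rintegral_itv_obnd_cbnd//; exact: Fi'.
rewrite I01 opprB addrA subrK; apply.
- move=> a b c /andP[a0 ab] /andP[bc c1]; rewrite /I.
  have := @Rintegral_itvB _ F (BRight a) (BRight c) b (Fi' _ _ a0 c1).
  by rewrite !bnd_simp => /(_ ab bc) <-; ring.
- move=> a b l /andP[a0 ab] b1 lF; rewrite /I.
  have := @Rintegral_ge_cst `]a, b]%classic F (l + m) (b - a) _ (leb_oc ab) (Fi' _ _ a0 b1).
  rewrite mulrDl lerBrDr; apply => //.
  by move=> x; rewrite /= in_itv /= => /lF; lra.
- move=> a b l /andP[a0 ab] b1 lF; rewrite /I.
  have := @Rintegral_le_cst `]a, b]%classic F (l + m) (b - a) _ (leb_oc ab) (Fi' _ _ a0 b1).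
  rewrite mulrDl lerBlDr; apply => //.
  by move=> x; rewrite /= in_itv /= => /lF; lra.
- by move=> x y xy y1; rewrite lerD2r Fmono.
- by move=> x /FM; lra.
Qed.

Lemma koksma_monotone_neg (F : R -> R) m M :
  leb.-integrable `[-1, 0] (EFin \o F) ->
  (forall x y, 0 < x <= y -> y <= 1 -> F (- x) <= F (- y)) ->
  (forall x, 0 < x <= 1 -> m <= F (- x) <= M) ->
  `|\sum_(k < N.+1) w k * F (- mu k) - \int[leb]_(x in `[-1, 0]) F x| <= eps * (M - m).
Proof.
move=> Fi Fmono FM.
have Fi' (b1 b2 : bool) a b : 0 <= a -> b <= 1 ->
    leb.-integrable [set` Interval (BSide b1 (- b)) (BSide b2 (- a))] (EFin \o F).
  move=> a0 b1'; apply: integrableS Fi => // x /=; rewrite !in_itv /= => /andP[ax xb].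
  apply/andP; split; first by have := lteifW ax; lra.
  by have := lteifW xb; lra.
pose I a b := \int[leb]_(x in `]- b, - a[) F x - m * (b - a).
have := @koksma_monotone (fun x => F (- x) - m) I (M - m).
have -> : \sum_(k < N.+1) w k * (F (- mu k) - m) = \sum_(k < N.+1) w k * F (- mu k) - m.
  by rewrite -[m in RHS]mul1r -gauss_sum1 mulr_suml -sumrB; apply: eq_bigr => k _; ring.
have I01 : I 0 1 = \int[leb]_(x in `[-1, 0]) F x - m.
  rewrite /I subr0 mulr1 Rintegral_itv_obnd_cbnd; last exact: Fi'.
  by rewrite Rintegral_itv_bndo_bndc ?oppr0//; have := Fi' true true 0 1; rewrite oppr0; apply.
rewrite I01 opprB addrA subrK; apply.
- move=> a b c /andP[a0 ab] /andP[bc c1]; rewrite /I.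
  have := @Rintegral_itvB _ F (BRight (- c)) (BLeft (- a)) (- b) (Fi' false true _ _ a0 c1).
  have [->|ab'] := eqVneq a b; first by move=> _; rewrite (set_itv_ge (b1 := BRight (- b)) (b2 := BLeft (- b))) ?bnd_simp ?ltxx// Rintegral_set0; ring.
  rewrite !bnd_simp lerN2 bc ltrN2 lt_neqAle ab' ab => /(_ isT isT).
  rewrite -(Rintegral_itv_bndo_bndc (r := - b)); last by apply: Fi' => //; lra.
  by move=> <-; ring.
- move=> a b l /andP[a0 ab] b1 lF; rewrite /I.
  have ab' : - b <= - a by rewrite lerN2.
  have := @Rintegral_ge_cst `]- b, - a[%classic F (l + m) (- a - - b) _ (leb_oo ab') (Fi' false true _ _ a0 b1).
  have -> : - a - - b = b - a by ring.
  rewrite mulrDl lerBrDr; apply => //.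
  move=> x; rewrite /= in_itv /= => /andP[x1 x2].
  by have := lF (- x); rewrite opprK => h; have : a < - x <= b by [lra]; move/h; lra.
- move=> a b l /andP[a0 ab] b1 lF; rewrite /I.
  have ab' : - b <= - a by rewrite lerN2.
  have := @Rintegral_le_cst `]- b, - a[%classic F (l + m) (- a - - b) _ (leb_oo ab') (Fi' false true _ _ a0 b1).
  have -> : - a - - b = b - a by ring.
  rewrite mulrDl lerBlDr; apply => //.
  move=> x; rewrite /= in_itv /= => /andP[x1 x2].
  by have := lF (- x); rewrite opprK => h; have : a < - x <= b by [lra]; move/h; lra.
- by move=> x y xy y1; rewrite lerD2r Fmono.
- by move=> x /FM; lra.
Qed.

(* V dominates the variation of F, so V + F and V - F are monotone. *)
Lemma koksma_itv (F V : R -> R) A B :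
  leb.-integrable `[-1, 1] (EFin \o F) ->
  (forall x, -1 <= x <= 1 -> x != 0 -> `|F x| <= A) ->
  (forall x y, 0 < x <= y -> y <= 1 -> V x <= V y) ->
  (forall x, 0 < x <= 1 -> 0 <= V x <= B) ->
  (forall s x y, `|s| = 1 -> 0 < x <= y -> y <= 1 ->
     `|F (s * y) - F (s * x)| <= V y - V x) ->
  `|\sum_(k < N.+1) w k * (F (mu k) + F (- mu k)) - \int[leb]_(x in `[-1, 1]) F x| <=
  2 * eps * (2 * A + B).
Proof.
move=> Fi FA Vmono VB FV.
(* The extension of [V] to a monotone function on the whole line is measurable, although [V] is
   constrained on ]0, 1] only. *)
pose Vp x := if x <= 0 then 0 else if x <= 1 then V x else B.
have Vp_mono x y : x <= y -> Vp x <= Vp y.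
  rewrite /Vp => xy; case: (leP y 0) => y0; first by rewrite (le_trans xy y0).
  case: (leP x 0) => x0.
    by case: (leP y 1) => y1; [have := VB y; rewrite y0 y1 | have := VB 1; rewrite ltr01 lexx]; move=> /(_ isT); lra.
  case: (leP y 1) => y1.
    by rewrite (le_trans xy y1) Vmono// x0.
  by case: (leP x 1) => x1 //; have := VB x; rewrite x0 x1 => /(_ isT) /andP[].
have VpE x : 0 < x <= 1 -> Vp x = V x by rewrite /Vp => /andP[x0 ->]; rewrite leNgt x0.
have B0 : 0 <= B by have := VB 1; rewrite ltr01 lexx => /(_ isT); lra.
have Vp_bnd x : 0 <= Vp x <= B.
  rewrite /Vp; case: (leP x 0) => x0; first by rewrite lexx.
  by case: (leP x 1) => x1; [apply: VB; rewrite x0|rewrite B0 lexx].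
have Vint (s a b : R) : `|s| = 1 -> leb.-integrable `[a, b] (EFin \o (fun x => Vp (s * x))).
  move=> s1; apply: measurable_bounded_integrable => //.
  - by rewrite /= lebesgue_measure_itv /=; case: ifP => _; rewrite ?ltry.
  - apply: measurable_funTS; have [s0|s0] := leP 0 s.
      by apply: nondecreasing_measurable => // x y xy; apply: Vp_mono; rewrite ler_wpM2l.
    apply: nonincreasing_measurable => // x y xy; apply: Vp_mono.
    by rewrite ler_wnM2l// ltW.
  - exists B; split; first exact: num_real.
    by move=> r Br x _ /=; have := Vp_bnd (s * x); rewrite ler_norml; lra.
have Fi0 : leb.-integrable `[0, 1] (EFin \o F).
  by apply: integrableS Fi => // x /=; rewrite !in_itv /= => /andP[x0 ->]; lra.
have Fi1 : leb.-integrable `[-1, 0] (EFin \o F).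
  by apply: integrableS Fi => // x /=; rewrite !in_itv /= => /andP[-> x0]; lra.
have split01 : \int[leb]_(x in `[-1, 1]) F x =
    \int[leb]_(x in `[-1, 0]) F x + \int[leb]_(x in `[0, 1]) F x.
  have := @Rintegral_itvB _ F (BLeft (-1)) (BRight 1) 0 Fi.
  rewrite !bnd_simp => /(_ _ _)/esym; rewrite lerN10 ler01 => /(_ isT isT).
  rewrite Rintegral_itv_obnd_cbnd; first lra.
  by apply: integrableS Fi0 => // x /=; rewrite !in_itv /= => /andP[/ltW -> ->].
have bnd (e x y : R) : `|e| = 1 -> -1 <= x <= 1 -> x != 0 -> - A <= Vp y + e * F x <= A + B.
  move=> e1 x1 x0; have : `|e * F x| <= A by rewrite normrM e1 mul1r FA.
  by rewrite ler_norml; have := Vp_bnd y; lra.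
have mono s (e : R) : `|s| = 1 -> `|e| = 1 -> forall x y, 0 < x <= y -> y <= 1 ->
    Vp x + e * F (s * x) <= Vp y + e * F (s * y).
  move=> s1 e1 x y /andP[x0 xy] y1; rewrite !VpE ?x0 ?(le_trans xy)//; last by rewrite (lt_le_trans x0).
  have := FV s x y s1; rewrite x0 xy y1 => /(_ isT isT) h.
  have : `|e * (F (s * y) - F (s * x))| <= V y - V x by rewrite normrM e1 mul1r.
  by rewrite ler_norml mulrBr; lra.
have sumVF (x : 'I_N.+1 -> R) (e : R) : \sum_(k < N.+1) w k * (Vp (mu k) + e * F (x k)) =
    \sum_(k < N.+1) w k * Vp (mu k) + e * \sum_(k < N.+1) w k * F (x k).
  by rewrite mulr_sumr -big_split; apply: eq_bigr => k _ /=; ring.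
have AB : 2 * A + B = (A + B) - (- A) by ring.
have Vi0 : leb.-integrable `[0, 1] (EFin \o Vp).
  have := Vint 1 0 1 (normr1 _); rewrite (_ : (fun x => Vp (1 * x)) = Vp)//.
  by apply/funext => x; rewrite mul1r.
have Vi1 : leb.-integrable `[-1, 0] (EFin \o (fun x => Vp (- x))).
  have N1 : `|-1 : R| = 1 by rewrite normrN1.
  have := Vint (-1) (-1) 0 N1; rewrite (_ : (fun x => Vp (-1 * x)) = fun x => Vp (- x))//.
  by apply/funext => x; rewrite mulN1r.
have pos (e : R) : `|e| = 1 -> `|\sum_(k < N.+1) w k * (Vp (mu k) + e * F (mu k)) -
     (\int[leb]_(x in `[0, 1]) Vp x + e * \int[leb]_(x in `[0, 1]) F x)| <= eps * (2 * A + B).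
  move=> e1.
  have eF : leb.-integrable `[0, 1] (EFin \o (fun x => e * F x)).
    by have := @integrableZl _ _ _ leb `[0, 1] _ e _ Fi0; apply.
  rewrite -RintegralZl// -RintegralD// AB.
  apply: koksma_monotone_pos => //.
  - by have := integrableD _ Vi0 eF; apply.
  - by move=> x y xy y1; have := mono 1 e (normr1 _) e1 x y xy y1; rewrite !mul1r.
  - by move=> x /andP[x0 x1]; apply: bnd => //; rewrite ?gt_eqF//; lra.
have neg (e : R) : `|e| = 1 -> `|\sum_(k < N.+1) w k * (Vp (mu k) + e * F (- mu k)) -
     (\int[leb]_(x in `[-1, 0]) Vp (- x) + e * \int[leb]_(x in `[-1, 0]) F x)| <= eps * (2 * A + B).
  move=> e1.
  have eF : leb.-integrable `[-1, 0] (EFin \o (fun x => e * F x)).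
    by have := @integrableZl _ _ _ leb `[-1, 0] _ e _ Fi1; apply.
  rewrite -RintegralZl// -RintegralD// AB.
  have := @koksma_monotone_neg (fun x => Vp (- x) + e * F x) (- A) (A + B).
  under eq_bigr do rewrite opprK.
  apply => //.
  - by have := integrableD _ Vi1 eF; apply.
  - move=> x y xy y1; rewrite !opprK.
    by have := mono (-1) e _ e1 x y xy y1; rewrite normrN1 !mulN1r; apply.
  - move=> x /andP[x0 x1]; rewrite opprK; apply: bnd => //; first by lra.
    by rewrite oppr_eq0 gt_eqF.
(* On each half range, subtracting the estimates for [V + F] and [V - F] cancels [V] and leaves
   twice the error of [F], so each half contributes [eps * (2 * A + B)]. *)
have := pos 1 (normr1 _); have := neg 1 (normr1 _).
have N1 : `|-1 : R| = 1 by rewrite normrN1.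
have := pos (-1) N1; have := neg (-1) N1; rewrite !sumVF.
under [\sum_(k < _) _ * (F _ + F _)]eq_bigr do rewrite mulrDr.
rewrite big_split /= split01.
move: (\sum_(k < _) _) (\sum_(k < _) _) (\sum_(k < _) _) => s1 s2 s3.
move: (\int[_]_(_ in _) _) (\int[_]_(_ in _) _) (\int[_]_(_ in _) _) (\int[_]_(_ in _) _) => i1 i2 i3 i4.
rewrite !ler_norml; lra.
Qed.

End koksma.

(** * Transport along one direction *)

Section continuity_on_segments.
Context {R : realType}.
Implicit Types (a b c x y : R) (f g u : R -> R) (s : seq R).

Lemma within_contP f a b : {within `[a, b], continuous f} <->
  (forall x, a <= x <= b -> forall e, 0 < e -> exists2 d, 0 < d &
    forall y, a <= y <= b -> `|y - x| < d -> `|f y - f x| < e).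
Proof.
split=> [/subspace_continuousP fc x xab e e0|H].
  have xab' : `[a, b]%classic x by rewrite /= in_itv.
  have /cvgrPdist_lt/(_ e e0) := fc x xab'.
  move=> /nbhs_ballP[d /= d0 dP]; exists d => // y yab yx.
  rewrite distrC; apply: dP; last by rewrite in_itv.
  by rewrite /ball /= distrC.
apply/subspace_continuousP => x; rewrite /= in_itv /= => xab.
apply/cvgrPdist_lt => e e0; have [d d0 dP] := H x xab e e0.
apply/nbhs_ballP; exists d => //= y /= yx; rewrite in_itv /= => yab.
by rewrite distrC; apply: dP => //; rewrite distrC.
Qed.

Lemma within_cont_sub f a b c d : a <= c -> d <= b ->
  {within `[a, b], continuous f} -> {within `[c, d], continuous f}.
Proof.
move=> ac db; apply: continuous_subspaceW => x /=; rewrite !in_itv /=.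
by move=> /andP[cx xd]; rewrite (le_trans ac cx) (le_trans xd db).
Qed.

Lemma within_contD f g a b : {within `[a, b], continuous f} ->
  {within `[a, b], continuous g} -> {within `[a, b], continuous (fun x => f x + g x)}.
Proof. by move=> cf cg x; apply: continuousD; [exact: cf|exact: cg]. Qed.

Lemma within_contB f g a b : {within `[a, b], continuous f} ->
  {within `[a, b], continuous g} -> {within `[a, b], continuous (fun x => f x - g x)}.
Proof. by move=> cf cg x; apply: continuousB; [exact: cf|exact: cg]. Qed.

Lemma within_contZ f k a b : {within `[a, b], continuous f} ->
  {within `[a, b], continuous (fun x => k * f x)}.
Proof.
by move=> cf x; apply: continuousM; [exact: cst_continuous|exact: cf].
Qed.

Lemma within_cont_of_cont f a b : continuous f -> {within `[a, b], continuous f}.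
Proof. exact: continuous_subspaceT. Qed.

(** Induction on the exceptional points: one that lies inside splits the interval, and continuity
    joins the halves. Continuity is all that a transport solution offers at the jumps of the
    data. *)
Lemma nondecreasing_off_finite s a b f : a <= b ->
  {within `[a, b], continuous f} ->
  (forall x, a < x < b -> x \notin s -> exists2 d, is_derive x (1 : R) f d & 0 <= d) ->
  f a <= f b.
Proof.
elim: s a b => [|c s IH] a b ab fc fd.
  pose df x := 'D_1 f x.
  have dfP x : x \in `]a, b[%R -> is_derive x (1 : R) f (df x).
    by rewrite in_itv /= => /fd /(_ isT) [d fd' _]; apply: DeriveDef; [exact: ex_derive|].
  have [|altb] := eqVneq a b; first by move=> ->.
  have {}altb : a < b by rewrite lt_neqAle altb.
  have [c] := MVT altb dfP fc.
  rewrite in_itv /= => /fd /(_ isT) [d fd' d0] e.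
  by rewrite -subr_ge0 e mulr_ge0 ?subr_ge0// /df derive_val.
have [cab|cab] := boolP (a < c < b); last first.
  apply: IH => // x xab xs; apply: fd => //; rewrite inE negb_or xs andbT.
  by apply: contraNneq cab => <-.
case/andP: cab => ac cb; apply: (@le_trans _ _ (f c)).
- apply: IH; [exact: ltW|by apply: within_cont_sub fc; rewrite // ltW|].
  move=> x /andP[ax xc] xs; apply: fd; first by rewrite ax (lt_trans xc).
  by rewrite inE negb_or xs andbT lt_eqF.
- apply: IH; [exact: ltW|by apply: within_cont_sub fc; rewrite // ltW|].
  move=> x /andP[cx xb] xs; apply: fd; first by rewrite xb (lt_trans ac).
  by rewrite inE negb_or xs andbT gt_eqF.
Qed.

Lemma lipschitz_off_finite s a b f k : a <= b ->
  {within `[a, b], continuous f} ->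
  (forall x, a < x < b -> x \notin s -> exists2 d, is_derive x (1 : R) f d & `|d| <= k) ->
  `|f b - f a| <= k * (b - a).
Proof.
move=> ab fc fd.
have idc : {within `[a, b], continuous (fun x => k * x)}.
  by apply: within_cont_of_cont; exact: mulrl_continuous.
have up : k * a - f a <= k * b - f b.
  apply: (@nondecreasing_off_finite s _ _ (fun x => k * x - f x)) => //.
    exact: within_contB.
  move=> x xab xs; have [d fd' dk] := fd x xab xs; exists (k - d).
    by apply: is_derive_eq; rewrite /GRing.scale /=; ring.
  by rewrite subr_ge0 (le_trans _ dk)// ler_norm.
have lo : k * a + f a <= k * b + f b.
  apply: (@nondecreasing_off_finite s _ _ (fun x => k * x + f x)) => //.
    exact: within_contD.
  move=> x xab xs; have [d fd' dk] := fd x xab xs; exists (k + d).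
    by apply: is_derive_eq; rewrite /GRing.scale /=; ring.
  by move: dk; rewrite ler_norml; lra.
by rewrite ler_norml; lra.
Qed.

(* Beyond the last point where f >= 0, the differential inequality makes the
   negative function f nondecreasing. *)
Lemma comparison s a b f (sigma : R -> R) (m : R) : a <= b -> 0 < m ->
  {within `[a, b], continuous f} ->
  (forall x, a < x < b -> 0 <= sigma x) ->
  (forall x, a < x < b -> x \notin s ->
     exists2 d, is_derive x (1 : R) f d & 0 <= m * d + sigma x * f x) ->
  0 <= f a -> 0 <= f b.
Proof.
move=> ab m0 fc sg0 fd fa; rewrite leNgt; apply/negP => fb.
pose S := [set t | a <= t <= b /\ 0 <= f t].
have aS : S a by split => //; rewrite lexx.
have S_sup : has_sup S by split; [exists a|exists b => t [/andP[]]].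
pose y := sup S.
have ay : a <= y by exact: sup_upper_bound.
have yb : y <= b by apply: ge_sup; [exists a|move=> t [/andP[]]].
have yab : a <= y <= b by rewrite ay yb.
have neg t : y < t <= b -> f t < 0.
  move=> /andP[yt tb]; rewrite ltNge; apply/negP => ft.
  by have := sup_upper_bound S_sup (conj (introT andP (conj (le_trans ay (ltW yt)) tb)) ft : S t);
    rewrite leNgt yt.
have fy : 0 <= f y.
  rewrite leNgt; apply/negP => fy.
  have nfy : 0 < - f y by rewrite oppr_gt0.
  have [d d0 dP] := (within_contP _ _ _).1 fc y yab _ nfy.
  have [t [tab ft] yt] := sup_adherent d0 S_sup.
  have ty : t <= y by exact: sup_upper_bound.
  have tyd : `|t - y| < d by rewrite ler0_norm ?subr_le0// opprB; rewrite -/y in yt; lra.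
  by have /ltr_normlW := dP t tab tyd; lra.
have : f y <= f b.
  apply: (@nondecreasing_off_finite s) => //; first exact: within_cont_sub fc.
  move=> x /andP[yx xb] xs.
  have xab : a < x < b by rewrite (le_lt_trans ay yx) xb.
  have [d fd' h] := fd x xab xs; exists d => //.
  have fx : f x < 0 by apply: neg; rewrite yx ltW.
  have : sigma x * f x <= 0 by rewrite mulr_ge0_le0 ?sg0// ltW.
  by rewrite -(pmulr_rge0 _ m0); lra.
by lra.
Qed.

Lemma barrier s a b f B (sigma : R -> R) (m : R) : a <= b -> 0 < m ->
  {within `[a, b], continuous f} -> {within `[a, b], continuous B} ->
  (forall x, a < x < b -> 0 <= sigma x) ->
  (forall x, a < x < b -> x \notin s -> exists df dB, [/\ is_derive x (1 : R) f df,
     is_derive x (1 : R) B dB & `|m * df + sigma x * f x| <= m * dB + sigma x * B x]) ->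
  `|f a| <= B a -> `|f b| <= B b.
Proof.
move=> ab m0 fc Bc sg0 fd; rewrite !ler_norml => fa.
have up : 0 <= B b - f b.
  apply: (@comparison s a b (fun x => B x - f x) sigma m) => //; last by lra.
    exact: within_contB.
  move=> x xab xs; have [df [dB [h1 h2 h3]]] := fd x xab xs; exists (dB - df).
    by apply: is_derive_eq.
  by move: h3; rewrite ler_norml !mulrBr; lra.
have lo : 0 <= B b + f b.
  apply: (@comparison s a b (fun x => B x + f x) sigma m) => //; last by lra.
    exact: within_contD.
  move=> x xab xs; have [df [dB [h1 h2 h3]]] := fd x xab xs; exists (dB + df).
    by apply: is_derive_eq.
  by move: h3; rewrite ler_norml !mulrDr; lra.
by lra.
Qed.

Lemma powR_bernoulli (t e : R) : 0 <= t -> 0 < e < 1 -> t `^ e <= e * t + (1 - e).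
Proof.
move=> t0 /andP[e0 e1].
have := @conjugate_powR R (t `^ e) 1 e^-1 (1 - e)^-1 (powR_ge0 _ _) ler01.
rewrite !invr_gt0 e0 subr_gt0 e1 !invrK => /(_ isT isT).
have -> : e + (1 - e) = 1 by ring.
move=> /(_ erefl); rewrite mulr1 -powRrM mulfV ?gt_eqF// powRr1// powR1 mul1r.
by rewrite mulrC.
Qed.

Lemma powR_sub_ge (x y e : R) : 0 < x <= y -> 0 < e < 1 ->
  e * y `^ (e - 1) * (y - x) <= y `^ e - x `^ e.
Proof.
move=> /andP[x0 xy] e01; have y0 : 0 < y by apply: lt_le_trans xy.
have h := @powR_bernoulli (x / y) e (divr_ge0 (ltW x0) (ltW y0)) e01.
have ye : 0 < y `^ e by exact: powR_gt0.
have -> : x = (x / y) * y by rewrite divfK// gt_eqF.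
rewrite powRM ?(ltW y0) ?divr_ge0 ?(ltW x0)//.
rewrite -(@mulr_powRB1 _ y e (ltW y0)); last by case/andP: e01.
have yp : 0 <= y * y `^ (e - 1) by rewrite mulr_ge0 ?powR_ge0 ?ltW.
have := ler_wpM2r yp h; rewrite divfK ?gt_eqF//.
have -> : y - x = y * (1 - x / y) by field; rewrite gt_eqF.
by lra.
exact: ltW.
Qed.

(** A bound affine in [t], obtained by comparing [t] with [m]: it lets an affine barrier absorb a
    Hoelder perturbation in [streams_source_gap]. *)
Lemma powR_le_add (t m e : R) : 0 <= t -> 0 < m -> 0 < e < 1 ->
  t `^ e <= m `^ e + t * m `^ (e - 1).
Proof.
move=> t0 m0 /andP[e0 e1]; have [tm|mt] := leP t m.
  by rewrite (le_trans (ge0_ler_powR (ltW e0) _ _ tm)) ?nnegrE ?(ltW m0)// lerDl mulr_ge0 ?powR_ge0.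
have t0' : 0 < t by apply: lt_trans mt.
rewrite -(@mulr_powRB1 _ t e)//; apply: le_trans (_ : t * m `^ (e - 1) <= _).
  2: by rewrite lerDr powR_ge0.
rewrite ler_wpM2l//.
have -> : e - 1 = - (1 - e) by ring.
rewrite !powRN lef_pV2 ?posrE ?powR_gt0//.
by apply: ge0_ler_powR; rewrite ?nnegrE ?subr_ge0 ?ltW.
Qed.

End continuity_on_segments.

(** * A stream in one direction: size, layers, dependence on the direction *)

Section one_direction.
Context {R : realType}.
Variables (cs : seq R) (sigma g : R -> R) (sm sM Gam L eta : R).
Hypothesis sm0 : 0 < sm.
Hypothesis sigma_bnd : forall x : R, 0 < x < 1 -> sm <= sigma x <= sM.
Hypothesis L0 : 0 <= L.
Hypothesis g_bnd : forall x : R, 0 < x < 1 -> `|g x| <= Gam * sigma x.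
Hypothesis eta01 : 0 < eta < 1.
Hypothesis data_hoelder : forall x y : R, 0 < x <= y -> y < 1 ->
  (forall c, c \in cs -> ~~ (x <= c <= y)) ->
  `|g x - g y| + Gam * `|sigma x - sigma y| <= L * (y - x) `^ eta.

Definition streams (m : R) (u : R -> R) := {within `[0, 1], continuous u} /\
  forall x : R, 0 < x < 1 -> x \notin cs ->
    exists2 d, is_derive x (1 : R) u d & m * d + sigma x * u x = g x.

Let sg_gt0 (x : R) : 0 < x < 1 -> 0 < sigma x.
Proof. by move/sigma_bnd => /andP[+ _]; exact: lt_le_trans. Qed.

Let half01 : 0 < (2^-1 : R) < 1.
Proof. by apply/andP; split; lra. Qed.

Let Gam0 : 0 <= Gam.
Proof.
rewrite -(pmulr_lge0 _ (sg_gt0 half01)).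
exact: le_trans (normr_ge0 _) (g_bnd half01).
Qed.

Let sM0 : 0 < sM.
Proof.
have /andP[s1 s2] := sigma_bnd half01.
exact: lt_le_trans sm0 (le_trans s1 s2).
Qed.

Let oo_sub (a b x : R) : 0 <= a -> b <= 1 -> a < x < b -> 0 < x < 1.
Proof. by move=> a0 b1 /andP[ax xb]; rewrite (le_lt_trans a0 ax) (lt_le_trans xb b1). Qed.

Section fixed_direction.
Variables (m : R) (u : R -> R).
Hypotheses (m01 : 0 < m <= 1) (su : streams m u) (u0 : u 0 = 0).

Let m0 : 0 < m. Proof. by case/andP: m01. Qed.

Let uc (a b : R) : 0 <= a -> b <= 1 -> {within `[a, b], continuous u}.
Proof. by move=> a0 b1; apply: within_cont_sub su.1. Qed.

Lemma streams_le (x : R) : 0 <= x <= 1 -> `|u x| <= Gam.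
Proof.
move=> /andP[x0 x1].
apply: (@barrier _ cs 0 x u (fun=> Gam) sigma m) => //.
- exact: uc.
- by apply: within_cont_of_cont; exact: contC.
- by move=> y /(oo_sub (lexx 0) x1)/sg_gt0/ltW.
- move=> y /(oo_sub (lexx 0) x1) y01 ycs; have [d ud e] := su.2 y y01 ycs.
  exists d, 0; split => //; first exact: is_derive_cst.
  by rewrite e mulr0 add0r mulrC g_bnd.
- by rewrite u0 normr0 Gam0.
Qed.

Lemma streams_derive_le (x d : R) : 0 < x < 1 -> m * d + sigma x * u x = g x ->
  `|d| <= 2 * sM * Gam / m.
Proof.
move=> x01 e; rewrite ler_pdivlMr// -[X in _ * X <= _](gtr0_norm m0) -normrM.
have ux : `|u x| <= Gam by apply: streams_le; case/andP: x01 => /ltW -> /ltW ->.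
have -> : d * m = g x - sigma x * u x by rewrite -e; ring.
have /andP[s1 s2] := sigma_bnd x01; have s0 := sg_gt0 x01.
apply: (le_trans (ler_normB _ _)); rewrite normrM (gtr0_norm s0).
have h1 := g_bnd x01; have h2 := ler_wpM2l (ltW s0) ux.
have h3 := ler_wpM2r Gam0 s2.
by rewrite (mulrC Gam) in h1; lra.
Qed.

Lemma streams_lipschitz (x y : R) : 0 <= x <= y -> y <= 1 ->
  `|u y - u x| <= 2 * sM * Gam / m * (y - x).
Proof.
move=> /andP[x0 xy] y1; apply: (@lipschitz_off_finite _ cs) => //; first exact: uc.
move=> z /(oo_sub x0 y1) z01 zcs; have [d ud e] := su.2 z z01 zcs.
by exists d => //; exact: streams_derive_le e.
Qed.

(** [r] is the consistency error of the box scheme. It is the increment over the cell of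
    [m * u t - k * t], whose derivative is [g t - sigma t * u t - k]. The first bound uses the
    regularity of the data and of the stream and degenerates like 1 / m; the second uses sizes only
    and is uniform in [m]. *)
Lemma streams_cell (a b z : R) : 0 <= a < b -> b <= 1 -> (forall c, c \in cs -> ~~ (a < c < b)) ->
  a < z < b ->
  let r := `|m * (u b - u a) - (b - a) * (g z - sigma z * ((u a + u b) / 2))| in
  r <= (b - a) * (L * (b - a) `^ eta + 2 * sM ^+ 2 * Gam * (b - a) / m) /\
  r <= (b - a) * (4 * sM * Gam).
Proof.
move=> /andP[a0 ab] b1 abcs zab /=.
pose ub := (u a + u b) / 2; pose k := g z - sigma z * ub.
have z01 := oo_sub a0 b1 zab.
have /andP[sz1 sz2] := sigma_bnd z01; have sz0 := sg_gt0 z01.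
have ua := streams_le (x := a); have ub' := streams_le (x := b).
have ubG : `|ub| <= Gam.
  have : `|u a| <= Gam by apply: ua; rewrite a0 (le_trans (ltW ab)).
  have : `|u b| <= Gam by apply: ub'; rewrite b1 (le_trans a0 (ltW ab)).
  by rewrite /ub !ler_norml; lra.
have fE : m * (u b - u a) - (b - a) * k = (m * u b - k * b) - (m * u a - k * a) by ring.
have fc : {within `[a, b], continuous (fun t => m * u t - k * t)}.
  apply: within_contB; first by apply: within_contZ; exact: uc.
  by apply: within_cont_of_cont; exact: mulrl_continuous.
have key rho : (forall t, a < t < b -> `|g t - sigma t * u t - k| <= rho) ->
    `|m * (u b - u a) - (b - a) * k| <= (b - a) * rho.
  move=> H; rewrite fE [leRHS]mulrC.
  apply: (@lipschitz_off_finite _ cs a b (fun t => m * u t - k * t)) => //; first exact: ltW.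
  move=> t tab tcs; have [d ud e] := su.2 t (oo_sub a0 b1 tab) tcs.
  exists (m * d - k).
    by apply: is_derive_eq; rewrite /GRing.scale /=; ring.
  by have := H t tab; rewrite -e; have -> : m * d + sigma t * u t - sigma t * u t - k = m * d - k by ring.
split; apply: key => t tab; have t01 := oo_sub a0 b1 tab;
  have /andP[st1 st2] := sigma_bnd t01; have st0 := sg_gt0 t01;
  have utG : `|u t| <= Gam by [apply: streams_le; case/andP: t01 => /ltW -> /ltW ->].
  have -> : g t - sigma t * u t - k =
     (g t - g z) - (sigma t - sigma z) * u t - sigma z * (u t - ub) by rewrite /k; ring.
  apply: (le_trans (ler_normB _ _)); apply: lerD.
    apply: (le_trans (ler_normB _ _)); rewrite normrM.
    have tz : `|g t - g z| + Gam * `|sigma t - sigma z| <= L * `|t - z| `^ eta.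
      have [tz|zt] := leP t z.
        have -> : `|t - z| = z - t by rewrite distrC ger0_norm ?subr_ge0.
        apply: data_hoelder.
        - by case/andP: t01 => -> _.
        - by case/andP: z01.
        - move=> c /abcs; apply: contra => /andP[tc cz].
          by case/andP: tab => h _; case/andP: zab => _ h'; rewrite (lt_le_trans h tc) (le_lt_trans cz h').
      have -> : `|t - z| = t - z by rewrite gtr0_norm ?subr_gt0.
      rewrite (distrC (g t)) (distrC (sigma t)); apply: data_hoelder.
      - by case/andP: z01 => -> _; rewrite ltW.
      - by case/andP: t01.
      - move=> c /abcs; apply: contra => /andP[tc cz].
        by case/andP: zab => h _; case/andP: tab => _ h'; rewrite (lt_le_trans h tc) (le_lt_trans cz h').
    have h1 : `|sigma t - sigma z| * `|u t| <= Gam * `|sigma t - sigma z|.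
      by rewrite mulrC ler_wpM2r.
    have h2 : L * `|t - z| `^ eta <= L * (b - a) `^ eta.
      rewrite ler_wpM2l//; apply: ge0_ler_powR; rewrite ?nnegrE//.
      - by case/andP: eta01 => /ltW.
      - by rewrite subr_ge0 ltW.
      - by rewrite ler_norml; lra.
    by lra.
  rewrite normrM (gtr0_norm sz0).
  have hu : `|u t - ub| <= 2 * sM * Gam / m * (b - a).
    case/andP: tab => at_ tb.
    have h1 : `|u t - u a| <= 2 * sM * Gam / m * (t - a).
      by apply: streams_lipschitz; [rewrite a0 ltW|rewrite (le_trans (ltW tb))].
    have h2 : `|u b - u t| <= 2 * sM * Gam / m * (b - t).
      by apply: streams_lipschitz; [rewrite (ltW tb) (le_trans a0 (ltW at_))|].
    have -> : u t - ub = (u t - u a) / 2 - (u b - u t) / 2 by rewrite /ub; field.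
    have K0 : 0 <= 2 * sM * Gam / m.
      by rewrite divr_ge0 ?mulr_ge0 ?(ltW sM0) ?(ltW m0).
    have hn : `|2^-1 : R| = 2^-1 by rewrite ger0_norm ?invr_ge0.
    apply: (le_trans (ler_normB _ _)); rewrite !normrM hn.
    have p1 : t - a <= b - a by lra.
    have p2 : b - t <= b - a by lra.
    have := ler_wpM2l K0 p1; have := ler_wpM2l K0 p2.
    by lra.
  have -> : 2 * sM ^+ 2 * Gam * (b - a) / m = sM * (2 * sM * Gam / m * (b - a)) by ring.
  by apply: ler_pM => //; exact: ltW.
apply: (le_trans (ler_normB _ _)).
have h1 : `|g t - sigma t * u t| <= 2 * sM * Gam.
  apply: (le_trans (ler_normB _ _)); rewrite normrM (gtr0_norm st0).
  have := g_bnd t01; have := ler_wpM2l (ltW st0) utG; have := ler_wpM2r Gam0 st2; lra.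
have h2 : `|k| <= 2 * sM * Gam.
  apply: (le_trans (ler_normB _ _)); rewrite normrM (gtr0_norm sz0).
  have := g_bnd z01; have := ler_wpM2l (ltW sz0) ubG; have := ler_wpM2r Gam0 sz2; lra.
by lra.
Qed.

(** The equation pulls [u] towards [g / sigma] on the length scale [m / sm]. After the last jump [c]
    the initial gap, at most [2 * Gam], decays exponentially, and over a distance of order [m] the
    data change by order m^eta. *)
Lemma streams_source_gap (c y : R) : 0 <= c < y -> y < 1 ->
  (forall c', c' \in cs -> ~~ (c < c' <= y)) ->
  `|u y - g y / sigma y| <= 2 * Gam * expR (- (sm * (y - c) / m)) +
     L * ((1 + sm^-1) / sm) * m `^ eta.
Proof.
move=> /andP[c0 cy] y1 ccs.
have y01 : 0 < y < 1 by rewrite y1 andbT (le_lt_trans c0 cy).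
have sy := sg_gt0 y01; have sn : sm != 0 by rewrite gt_eqF.
have mn : m != 0 by rewrite gt_eqF.
pose q := g y / sigma y; pose K := (1 + sm^-1) / sm.
have qG : `|q| <= Gam.
  by rewrite /q normrM normfV (gtr0_norm sy) ler_pdivrMr// g_bnd.
(* An exponential starting at the jump plus an affine function decreasing towards [y]. Of the
   constant [K], the part [sm^-1] balances the source and the part [sm^-1 / sm] the loss caused by
   the slope of the affine function. *)
pose B t := 2 * Gam * expR (- (sm * (t - c) / m)) +
   L * (K * m `^ eta + (y - t) * m `^ (eta - 1) / sm).
have -> : 2 * Gam * expR (- (sm * (y - c) / m)) + L * K * m `^ eta = B y.
  by rewrite /B subrr !mul0r addr0 -[L * K * _]mulrA.
have dB t : is_derive t (1 : R) B
   (- (sm / m) * (2 * Gam * expR (- (sm * (t - c) / m))) - L * m `^ (eta - 1) / sm).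
  by apply: is_derive_eq; rewrite /GRing.scale /=; ring.
apply: (@barrier _ cs c y (fun t => u t - q) B sigma m) => //.
- exact: ltW.
- by apply: within_contB; [exact: uc (ltW y1)|apply: within_cont_of_cont; exact: contC].
- by apply: within_cont_of_cont; apply: continuous_of_derivable => t; exact: ex_derive.
- by move=> t /(oo_sub c0 (ltW y1))/sg_gt0/ltW.
- move=> t tcy tcs; have t01 := oo_sub c0 (ltW y1) tcy; have [d ud e] := su.2 t t01 tcs.
  do 2 eexists; split; [|exact: dB|].
    by apply: is_derive_eq; rewrite subr0.
  have /andP[s1 s2] := sigma_bnd t01; have st := sg_gt0 t01.
  case/andP: tcy => ct ty.
  have -> : m * d + sigma t * (u t - q) = (g t - g y) + (sigma y - sigma t) * q.
    by rewrite mulrBr addrA e /q; field; rewrite gt_eqF.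
  have hL : `|g t - g y| + Gam * `|sigma t - sigma y| <= L * (y - t) `^ eta.
    apply: data_hoelder => //; first by case/andP: t01 => -> _; rewrite ltW.
    by move=> c' /ccs; apply: contra => /andP[tc' ->]; rewrite (lt_le_trans ct tc').
  apply: (@le_trans _ _ (L * (y - t) `^ eta)).
    apply: (le_trans (ler_normD _ _)); rewrite normrM (distrC (sigma y)).
    by have := ler_wpM2l (normr_ge0 (sigma t - sigma y)) qG; rewrite (mulrC Gam) in hL; lra.
  have yt : 0 <= y - t by rewrite subr_ge0 ltW.
  have hp := powR_le_add yt m0 eta01.
  have := ler_wpM2l L0 hp => {}hp.
  set X := m `^ eta in hp *; set Y := m `^ (eta - 1) in hp *.
  have XY : m * Y = X by rewrite /Y mulr_powRB1 ?ltW//; case/andP: eta01.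
  set E := expR _.
  have E0 : 0 <= 2 * Gam * E by rewrite mulr_ge0 ?mulr_ge0 ?expR_ge0.
  have X0 : 0 <= X by exact: powR_ge0.
  have Y0 : 0 <= Y by exact: powR_ge0.
  apply: (le_trans hp).
  have -> : m * (- (sm / m) * (2 * Gam * E) - L * Y / sm) + sigma t * B t =
     (sigma t - sm) * (2 * Gam * E) + L * (sigma t * (K * X) - X / sm + sigma t / sm * ((y - t) * Y)).
    by rewrite /B -/E -/X -/Y -XY; field; rewrite mn sn.
  have h1 : 0 <= (sigma t - sm) * (2 * Gam * E) by rewrite mulr_ge0// subr_ge0.
  have h2 : X + (y - t) * Y <= sigma t * (K * X) - X / sm + sigma t / sm * ((y - t) * Y).
    apply: lerD; last first.
      by rewrite ler_peMl ?mulr_ge0// ler_pdivlMr// mul1r.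
    have : sm * (K * X) <= sigma t * (K * X).
      by rewrite ler_wpM2r// mulr_ge0// divr_ge0 ?addr_ge0 ?invr_ge0 ?ltW.
    have -> : sm * (K * X) = X + X / sm by rewrite /K; field.
    by lra.
  by have := ler_wpM2l L0 h2; lra.
- have h1 : `|u c| <= Gam by apply: streams_le; rewrite c0 (le_trans (ltW cy) (ltW y1)).
  apply: (le_trans (ler_normB _ _)).
  rewrite /B subrr mulr0 mul0r oppr0 expR0 mulr1.
  have K0 : 0 <= K by rewrite /K divr_ge0 ?addr_ge0 ?invr_ge0 ?ltW.
  have : 0 <= L * (K * m `^ eta + (y - c) * m `^ (eta - 1) / sm).
    apply: mulr_ge0 => //; apply: addr_ge0; first by rewrite mulr_ge0 ?powR_ge0.
    by rewrite divr_ge0 ?(ltW sm0)// mulr_ge0 ?powR_ge0// subr_ge0 ltW.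
  by lra.
Qed.

End fixed_direction.

(* [layers] is nondecreasing in the direction m and dominates the increments of
   the streams in m, see [streams_increment]. *)
Definition layer (c m y : R) : R := expR (- (sm * Num.max 0 (y - c) / m)).

Definition layers (m y : R) : R :=
  2 * sM * Gam / sm * (\sum_(c <- 0 :: cs) layer c m y) +
  sM * L * ((1 + sm^-1) / sm) / (sm * eta) * m `^ eta.

Let eta0 : 0 < eta. Proof. by case/andP: eta01. Qed.

Lemma layer_cont (c m : R) : continuous (layer c m).
Proof.
have mc : continuous (fun t : R => Num.max 0 (t - c)).
  move=> t; apply: (@continuous_max R R (fun=> 0) (fun t => t - c)); first exact: cst_continuous.
  by apply: cvgB; [exact: cvg_id|exact: cvg_cst].
move=> t; apply: (@cvg_comp _ _ _ (fun t => - (sm * Num.max 0 (t - c) / m)) expR); last exact: continuous_expR.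
apply: cvgN; apply: cvgM; last exact: cvg_cst.
by apply: cvgM; [exact: cvg_cst|exact: mc].
Qed.

Lemma layer_mono (c m1 m2 y : R) : 0 < m1 <= m2 -> layer c m1 y <= layer c m2 y.
Proof.
move=> /andP[m10 m12]; rewrite ler_expR lerN2 ler_wpM2l//.
  by rewrite mulr_ge0 ?(ltW sm0)// le_max lexx.
by rewrite lef_pV2 ?posrE// (lt_le_trans m10).
Qed.

Lemma layers_mono (m1 m2 y : R) : 0 < m1 <= m2 -> layers m1 y <= layers m2 y.
Proof.
move=> m12; have /andP[m10 m12'] := m12; apply: lerD; apply: ler_wpM2l.
- by rewrite divr_ge0 ?mulr_ge0 ?(ltW sM0) ?(ltW sm0).
- by apply: ler_sum => c _; exact: layer_mono.
- by rewrite divr_ge0 ?mulr_ge0 ?addr_ge0 ?invr_ge0 ?(ltW sM0) ?(ltW sm0) ?(ltW eta0).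
- by apply: ge0_ler_powR; rewrite ?nnegrE ?(ltW eta0) ?(ltW m10)// (le_trans (ltW m10)).
Qed.

Lemma layers_bound (m y : R) : 0 < m <= 1 -> 0 <= layers m y <=
  2 * sM * Gam / sm * (size cs).+1%:R + sM * L * ((1 + sm^-1) / sm) / (sm * eta).
Proof.
move=> /andP[m0 m1].
have k1 : 0 <= 2 * sM * Gam / sm by rewrite divr_ge0 ?mulr_ge0 ?(ltW sM0) ?(ltW sm0).
have k2 : 0 <= sM * L * ((1 + sm^-1) / sm) / (sm * eta).
  by rewrite divr_ge0 ?mulr_ge0 ?addr_ge0 ?invr_ge0 ?(ltW sM0) ?(ltW sm0) ?(ltW eta0).
apply/andP; split.
  apply: addr_ge0; apply: mulr_ge0 => //; last exact: powR_ge0.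
  by rewrite sumr_ge0// => c _; exact: expR_ge0.
apply: lerD.
  rewrite ler_wpM2l// (_ : (size cs).+1 = size (0 :: cs))// -sum1_size natr_sum.
  apply: ler_sum => c _; rewrite expR_le1 oppr_le0 divr_ge0 ?(ltW m0)//.
  by rewrite mulr_ge0 ?(ltW sm0)// le_max lexx.
rewrite ler_piMr//.
have := ge0_ler_powR (ltW eta0) (_ : m \in Num.nneg) (_ : 1 \in Num.nneg) m1.
by rewrite powR1 !nnegrE (ltW m0) ler01; apply.
Qed.

(** Beyond [c] the layer of direction [m] solves [m * l' + sm * l = 0]; with [m1] before the
    derivative, the layer of [m2] therefore leaves [sm * (1 - m1 / m2)] times itself. Before [c]
    both layers are 1 and cancel; at [c] there may be a kink. *)
Lemma layer_difference (c m1 m2 y sg : R) : 0 < m1 <= m2 -> sm <= sg -> y != c ->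
  exists2 d, is_derive y (1 : R) (fun t => layer c m2 t - layer c m1 t) d &
  0 <= m1 * d + sg * (layer c m2 y - layer c m1 y) /\
  (c < y -> sm * (1 - m1 / m2) * expR (- (sm * (y - c) / m2)) <=
   m1 * d + sg * (layer c m2 y - layer c m1 y)).
Proof.
move=> m12 smg yc; have /andP[m10 m12'] := m12; have m20 := lt_le_trans m10 m12'.
have ll := layer_mono c y m12; rewrite -subr_ge0 in ll.
have sg0 : 0 < sg by exact: lt_le_trans smg.
have [cy|yc'] := ltP c y; last first.
  have {}yc' : y < c by rewrite lt_neqAle yc.
  exists 0; last by rewrite mulr0 add0r; split=> //; rewrite mulr_ge0// ltW.
  apply: (@near_eq_is_derive _ _ _ (fun=> 0)); rewrite ?oner_eq0//.
  near=> t; rewrite /layer; have -> : Num.max 0 (t - c) = 0; last by rewrite mulr0 !mul0r subrr.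
  apply/max_idPl; rewrite subr_le0 ltW//.
  by near: t; exact: lt_nbhsl.
pose l (m t : R) := expR (- (sm * (t - c) / m)).
have layE m : layer c m y = l m y by rewrite /layer /l max_r // subr_ge0 ltW.
exists (- (sm / m2) * l m2 y + sm / m1 * l m1 y).
  apply: (@near_eq_is_derive _ _ _ (fun t => l m2 t - l m1 t)); rewrite ?oner_eq0//.
    near=> t; rewrite /layer; have -> // : Num.max 0 (t - c) = t - c.
    apply/max_idPr; rewrite subr_ge0 ltW//.
    by near: t; exact: lt_nbhsr.
  by rewrite /l; apply: is_derive_eq; rewrite /GRing.scale /=; ring.
have E : sm * (1 - m1 / m2) * l m2 y <=
    m1 * (- (sm / m2) * l m2 y + sm / m1 * l m1 y) + sg * (layer c m2 y - layer c m1 y).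
  have -> : m1 * (- (sm / m2) * l m2 y + sm / m1 * l m1 y) =
     - (sm * (m1 / m2) * l m2 y) + sm * l m1 y by field; rewrite !gt_eqF.
  have := ler_wpM2r ll smg; rewrite !layE.
  by lra.
split=> //; apply: le_trans E.
by rewrite mulr_ge0 ?expR_ge0// mulr_ge0 ?(ltW sm0)// subr_ge0 ler_pdivrMr// mul1r.
Unshelve. all: by end_near. Qed.

Lemma layers_difference (s : seq R) (m1 m2 y sg : R) : 0 < m1 <= m2 -> sm <= sg -> y \notin s ->
  exists2 d, is_derive y (1 : R)
    (fun t => \sum_(c <- s) layer c m2 t - \sum_(c <- s) layer c m1 t) d &
  0 <= m1 * d + sg * (\sum_(c <- s) layer c m2 y - \sum_(c <- s) layer c m1 y) /\
  (forall c, c \in s -> c < y -> sm * (1 - m1 / m2) * expR (- (sm * (y - c) / m2)) <=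
   m1 * d + sg * (\sum_(c <- s) layer c m2 y - \sum_(c <- s) layer c m1 y)).
Proof.
move=> m12 smg; elim: s => [|c s IH].
  move=> _; exists 0; last by rewrite !big_nil subrr !mulr0 addr0.
  rewrite (_ : (fun _ => _) = fun=> 0); first exact: is_derive_cst.
  by apply/funext => t; rewrite !big_nil subrr.
rewrite inE negb_or => /andP[yc ys].
have [d1 D1 [A1 B1]] := IH ys; have [d2 D2 [A2 B2]] := layer_difference m12 smg yc.
exists (d2 + d1).
  rewrite (_ : (fun _ => _) = (fun t => layer c m2 t - layer c m1 t) +
     (fun t => \sum_(c <- s) layer c m2 t - \sum_(c <- s) layer c m1 t)); first exact: is_deriveD.
  by apply/funext => t; rewrite !big_cons fctE; ring.
rewrite !big_cons.
split; first by have := addr_ge0 A1 A2; lra.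
move=> c'; rewrite inE => /predU1P[->|c's] c'y.
  by have := B2 c'y; lra.
by have := B1 c' c's c'y; lra.
Qed.

Lemma last_jump (y : R) : 0 < y -> exists c, [/\ c \in 0 :: cs, 0 <= c < y &
  forall c', c' \in 0 :: cs -> ~~ (c < c' < y)].
Proof.
move=> y0.
pose c := \big[Num.max/0]_(x <- cs | x < y) x.
have cy : c < y by rewrite /c; elim/big_ind: _ => // a b ay by_; rewrite gt_max ay.
have c0 : 0 <= c by rewrite /c; exact: bigmax_ge_id.
exists c; split; rewrite ?c0//.
  rewrite /c -big_filter.
  suff : forall s : seq R, \big[Num.max/0]_(x <- s) x \in 0 :: s.
    move=> /(_ [seq x <- cs | x < y]); rewrite !inE mem_filter => /orP[->//|/andP[_ ->]].
    by rewrite orbT.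
  elim=> [|a s IH]; first by rewrite big_nil inE.
  rewrite big_cons; case: leP => _; rewrite !inE ?eqxx ?orbT//.
  by move: IH; rewrite !inE => /orP[->//|->]; rewrite !orbT.
move=> c'; rewrite inE => /predU1P[->|c'cs]; first by rewrite ltNge c0.
apply/negP => /andP[cc' c'y]; move: cc'; apply/negP; rewrite -leNgt /c.
by apply: (@le_bigmax_seq _ _ _ _ 0 c' (fun x => x < y) id).
Qed.

(** The difference of the streams solves the equation of direction [m1] with source (1 - m1 / m2)
    sigma (u2 - g / sigma), which [streams_source_gap] controls. [layers] is built to dominate this
    source: the exponential of the last jump through [layer_difference], whence the factor
    [sM / sm], and the power of [m2] through the concavity bound [powR_sub_ge], whence the divisor
    [sm * eta]. *)
Lemma streams_increment (m1 m2 x : R) (u1 u2 : R -> R) : 0 < m1 <= m2 -> m2 <= 1 ->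
  streams m1 u1 -> streams m2 u2 -> u1 0 = 0 -> u2 0 = 0 -> 0 <= x <= 1 ->
  `|u2 x - u1 x| <= layers m2 x - layers m1 x.
Proof.
move=> m12 m21 su1 su2 u10 u20 /andP[x0 x1]; have /andP[m10 m12'] := m12; have m20 := lt_le_trans m10 m12'.
have lc m : 0 < m -> {within `[0, x], continuous (layers m)}.
  move=> m0'; apply: within_cont_of_cont => t; apply: cvgD; last exact: cvg_cst.
  apply: cvgM; first exact: cvg_cst.
  elim: (0 :: cs) => [|c s IH].
    by under eq_fun do rewrite big_nil; rewrite big_nil; exact: cvg_cst.
  by under eq_fun do rewrite big_cons; rewrite big_cons; apply: cvgD => //; exact: layer_cont.
have K0 : 0 <= (1 + sm^-1) / sm by rewrite divr_ge0 ?addr_ge0 ?invr_ge0 ?ltW.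
apply: (@barrier _ cs 0 x (fun t => u2 t - u1 t) (fun t => layers m2 t - layers m1 t) sigma m1) => //.
- by apply: within_contB; [apply: within_cont_sub su2.1|apply: within_cont_sub su1.1].
- by apply: within_contB; apply: lc.
- by move=> t /(oo_sub (lexx 0) x1)/sg_gt0/ltW.
- move=> t /(oo_sub (lexx 0) x1) t01 tcs.
  have /andP[s1 s2] := sigma_bnd t01; have st := sg_gt0 t01.
  have [d2 D2 e2] := su2.2 t t01 tcs; have [d1 D1 e1] := su1.2 t t01 tcs.
  have tcs' : t \notin 0 :: cs by rewrite inE negb_or tcs andbT gt_eqF//; case/andP: t01.
  have [D LD [_ LB]] := layers_difference m12 s1 tcs'.
  pose A := 2 * sM * Gam / sm; pose A' := sM * L * ((1 + sm^-1) / sm) / (sm * eta).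
  have A0 : 0 <= A by rewrite divr_ge0 ?mulr_ge0 ?(ltW sM0) ?(ltW sm0).
  have A0' : 0 <= A' by rewrite divr_ge0 ?mulr_ge0 ?addr_ge0 ?invr_ge0 ?(ltW sM0) ?(ltW sm0) ?(ltW eta0).
  exists (d2 - d1), (A * D); split.
  + exact: is_deriveB.
  + rewrite (_ : (fun t => layers m2 t - _) = (fun t => A *
       (\sum_(c <- 0 :: cs) layer c m2 t - \sum_(c <- 0 :: cs) layer c m1 t) + A' * (m2 `^ eta - m1 `^ eta))).
      by apply: is_derive_eq; rewrite /GRing.scale /=; ring.
    by apply/funext => z; rewrite /layers -/A -/A'; ring.
  have [c [ccs /andP[c0 ct] cgap]] : exists c, [/\ c \in 0 :: cs, 0 <= c < t &
      forall c', c' \in 0 :: cs -> ~~ (c < c' < t)] by apply: last_jump; case/andP: t01.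
  have t1 : t < 1 by case/andP: t01.
  have m21' : 0 < m2 <= 1 by rewrite m20.
  have gap : `|u2 t - g t / sigma t| <= 2 * Gam * expR (- (sm * (t - c) / m2)) +
     L * ((1 + sm^-1) / sm) * m2 `^ eta.
    apply: (streams_source_gap m21' su2 u20) => //; first by rewrite c0.
    move=> c' c'cs; have c'in : c' \in 0 :: cs by rewrite inE c'cs orbT.
    have := cgap c' c'in.
    apply: contra => /andP[-> /=]; rewrite le_eqVlt => /predU1P[c't|//].
    by move: tcs; rewrite -c't c'cs.
  have -> : m1 * (d2 - d1) + sigma t * (u2 t - u1 t) =
     (1 - m1 / m2) * (sigma t * (u2 t - g t / sigma t)).
    have dE : d2 = (g t - sigma t * u2 t) / m2 by rewrite -e2; field; rewrite gt_eqF.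
    have -> : m1 * (d2 - d1) + sigma t * (u2 t - u1 t) =
      m1 * d2 + sigma t * u2 t - (m1 * d1 + sigma t * u1 t) by ring.
    by rewrite e1 dE; field; rewrite !gt_eqF.
  have r0 : 0 <= 1 - m1 / m2 by rewrite subr_ge0 ler_pdivrMr// mul1r.
  rewrite normrM (ger0_norm r0) normrM (gtr0_norm st).
  have := ler_wpM2l A0 (LB c ccs ct).
  set S := \sum_(c <- _) _ - _.
  have -> : A * (sm * (1 - m1 / m2) * expR (- (sm * (t - c) / m2))) =
    (1 - m1 / m2) * (sM * (2 * Gam * expR (- (sm * (t - c) / m2)))).
    by rewrite /A; field; rewrite !gt_eqF.
  move=> hA.
  have -> : m1 * (A * D) + sigma t * (layers m2 t - layers m1 t) =
     A * (m1 * D + sigma t * S) + sigma t * A' * (m2 `^ eta - m1 `^ eta).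
    by rewrite /layers -/A -/A' /S; ring.
  have hB : (1 - m1 / m2) * (sM * (L * ((1 + sm^-1) / sm) * m2 `^ eta)) <=
      sigma t * A' * (m2 `^ eta - m1 `^ eta).
    have pp := powR_sub_ge m12 eta01.
    have hm : (1 - m1 / m2) * m2 `^ eta = m2 `^ (eta - 1) * (m2 - m1).
      by rewrite -(@mulr_powRB1 _ m2 eta (ltW m20) eta0); field; rewrite gt_eqF.
    have -> : (1 - m1 / m2) * (sM * (L * ((1 + sm^-1) / sm) * m2 `^ eta)) =
       sm * A' * (eta * m2 `^ (eta - 1) * (m2 - m1)).
      rewrite -[eta * _ * _]mulrA -hm /A'; field; rewrite !gt_eqF//.
    apply: ler_pM => //.
    - by rewrite mulr_ge0// ltW.
    - by rewrite mulr_ge0 ?mulr_ge0 ?powR_ge0 ?subr_ge0// ltW.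
    - by rewrite ler_wpM2r.
  have hC : (1 - m1 / m2) * (sigma t * `|u2 t - g t / sigma t|) <=
     (1 - m1 / m2) * (sM * (2 * Gam * expR (- (sm * (t - c) / m2)))) +
     (1 - m1 / m2) * (sM * (L * ((1 + sm^-1) / sm) * m2 `^ eta)).
    rewrite -mulrDr -mulrDr ler_wpM2l//; apply: ler_pM => //; exact: ltW.
  by lra.
- by rewrite u10 u20 subrr normr0 subr_ge0; exact: layers_mono.
Qed.

End one_direction.

(** * The box scheme *)

Section partition.
Context {R : realType}.
Variables (xs : seq R).
Hypothesis xs01 : itv_partition 0 1 xs.

Local Notation X j := ((0 :: xs)`_j).
Local Notation M := (size xs).

Lemma part_lt (j : nat) : (j < M)%N -> X j < X j.+1.
Proof. by case: xs01 => /(pathP 0) + _; apply. Qed.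

Lemma part_last : X M = 1.
Proof. by case: xs01 => _ /eqP; rewrite (last_nth 0). Qed.

Lemma part_size : (0 < M)%N.
Proof.
rewrite lt0n; apply/eqP => M0; have := part_last; rewrite M0 /= => /eqP.
by rewrite eq_sym oner_eq0.
Qed.

Lemma part_le (i j : nat) : (i <= j)%N -> (j <= M)%N -> X i <= X j.
Proof.
move=> ij; rewrite -(subnK ij); elim: (j - i)%N => [//|n IH] nM.
by apply: le_trans (IH (ltnW nM)) _; rewrite addSn ltW// part_lt.
Qed.

Lemma part_range (j : nat) : (j <= M)%N -> 0 <= X j <= 1.
Proof.
by move=> jM; rewrite (@part_le 0 j)//= -part_last part_le.
Qed.

Lemma part_find (x : R) : 0 <= x < 1 -> exists2 j, (j < M)%N & X j <= x < X j.+1.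
Proof.
move=> /andP[x0]; rewrite -part_last; elim: {-2 4}M (leqnn M) => [|n IH] nM xn.
  by move: xn; rewrite /= ltNge x0.
have [xn'|nx] := ltP x (X n); first exact: IH (ltnW nM) xn'.
by exists n => //; rewrite nx.
Qed.

Lemma part_gap (i j : nat) : (i <= M)%N -> (j < M)%N -> ~~ (X j < X i < X j.+1).
Proof.
move=> iM jM; apply/negP => /andP[ji ij].
have [i_j|j_i] := leqP i j.
  by move: ji; rewrite ltNge part_le// ltnW.
by move: ij; rewrite ltNge part_le.
Qed.

Lemma part_mem (c : R) : c \in xs -> exists2 i, (i <= M)%N & c = X i.
Proof. by move=> /(nthP 0)[i iM <-]; exists i.+1. Qed.

Definition mid (j : nat) : R := (X j + X j.+1) / 2.

Lemma part_mid (j : nat) : (j < M)%N -> X j < mid j < X j.+1.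
Proof. by move=> /part_lt h; rewrite /mid; apply/andP; split; lra. Qed.

Lemma mid01 (j : nat) : (j < M)%N -> 0 < mid j < 1.
Proof.
move=> jM; have /andP[m1 m2] := part_mid jM.
have /andP[a _] := part_range (ltnW jM); have /andP[_ b] := part_range jM.
by apply/andP; split; lra.
Qed.

Lemma cell_disjoint (i j : nat) (x : R) : (i < M)%N -> (j < M)%N ->
  X i < x < X i.+1 -> X j < x < X j.+1 -> i = j.
Proof.
move=> iM jM /andP[a1 a2] /andP[b1 b2].
have [ij|ji|//] := ltngtP i j.
  have h := part_le ij (ltnW jM); move: (lt_le_trans a2 h) => {}h.
  by move: (lt_trans b1 h); rewrite ltxx.
have h := part_le ji (ltnW iM); move: (lt_le_trans b2 h) => {}h.
by move: (lt_trans a1 h); rewrite ltxx.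
Qed.

Lemma Ph_cell (v : R -> R) (j : nat) (x : R) : (j < M)%N -> X j < x < X j.+1 ->
  Ph xs v x = v (mid j).
Proof.
move=> jM xj; rewrite /Ph (bigD1 (Ordinal jM))//= big1 => [|i ij].
  by rewrite addr0 indicE mem_set ?mulr1//= in_itv.
rewrite indicE memNset ?mulr0// /cell /= in_itv /= => xi.
by move/eqP: ij; apply; apply/val_inj => /=; exact: cell_disjoint xi xj.
Qed.

Definition clamp (j : nat) (x : R) : R := Num.max (X j) (Num.min x (X j.+1)).

Lemma clamp_cont (j : nat) : continuous (clamp j).
Proof.
move=> x; apply: (@continuous_max R R (fun=> X j) (fun t => Num.min t (X j.+1))).
  exact: cst_continuous.
by apply: (@continuous_min R R id (fun=> X j.+1)); [exact: cvg_id|exact: cst_continuous].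
Qed.

(** As one global sum of slopes times clamped variables, the interpolant is continuous without any
    gluing; at a point of cell [j] the summands below [j] telescope and those above vanish. *)
Lemma interpolant (U : nat -> R) : exists2 u, Vh xs u & forall j, (j <= M)%N -> u (X j) = U j.
Proof.
pose s j := (U j.+1 - U j) / (X j.+1 - X j).
pose u x := U 0%N + \sum_(0 <= j < M) s j * (clamp j x - X j).
have above (n : nat) (x : R) : (n <= M)%N -> X n <= x ->
    \sum_(0 <= j < n) s j * (clamp j x - X j) = U n - U 0%N.
  elim: n => [|n IH] nM nx; first by rewrite big_geq// subrr.
  have n_lt := part_lt nM.
  rewrite big_nat_recr//= IH ?(le_trans (ltW n_lt))//; last exact: ltnW.
  have -> : clamp n x = X n.+1.
    by rewrite /clamp min_r// max_r// ltW.
  by rewrite /s divfK; [ring|rewrite subr_eq0 gt_eqF].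
have uE (j : nat) (x : R) : (j < M)%N -> X j <= x <= X j.+1 -> u x = U j + s j * (x - X j).
  move=> jM /andP[jx xj]; rewrite /u (@big_cat_nat _ _ _ j.+1)//=.
  rewrite big_nat_recr//= above//; last exact: ltnW.
  rewrite big_nat_cond big1 ?addr0 => [|i /andP[/andP[ji iM] _]].
    by rewrite /clamp min_l// max_r//; ring.
  have xi : x <= X i by apply: le_trans xj (part_le ji (ltnW iM)).
  by rewrite /clamp max_l ?subrr ?mulr0// ge_min xi.
exists u.
  split.
    apply: within_cont_of_cont => x; apply: cvgD; first exact: cvg_cst.
    elim: M => [|n IH].
      by under eq_fun do rewrite big_geq//; rewrite big_geq//; exact: cvg_cst.
    under eq_fun do rewrite big_nat_recr//=; rewrite big_nat_recr//=.
    apply: cvgD => //; apply: cvgM; first exact: cvg_cst.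
    by apply: cvgB; [exact: clamp_cont|exact: cvg_cst].
  move=> j jM; exists (s j), (U j - s j * X j) => x; rewrite /cell /= in_itv /= => /andP[jx xj].
  by rewrite (uE j)//; [ring|rewrite !ltW].
move=> j; rewrite leq_eqVlt => /predU1P[->|jM]; last first.
  by rewrite (uE j) ?lexx ?subrr ?mulr0 ?addr0// ltW// part_lt.
have M0 := part_size.
have M1 : (M.-1 < M)%N by rewrite prednK.
have E : X M = X M.-1.+1 by rewrite prednK.
have lt1 := part_lt M1.
rewrite E (uE M.-1)//; last by rewrite lexx (ltW lt1).
rewrite /s divfK; last by rewrite subr_eq0 gt_eqF.
by rewrite prednK//; ring.
Qed.

(** [Vh] prescribes the affine form on open cells only. The difference to the affine function is
    continuous on the closed cell with derivative 0 inside, which extends the formula to the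
    nodes. *)
Lemma affine_closure (u : R -> R) (a b p q : R) : p < q -> {within `[p, q], continuous u} ->
  (forall x, p < x < q -> u x = a * x + b) ->
  forall x, p <= x <= q -> u x = a * x + b.
Proof.
move=> pq uc ue.
pose d x := u x - (a * x + b).
have dc : {within `[p, q], continuous d}.
  apply: within_contB => //; apply: within_cont_of_cont.
  by apply: continuous_of_derivable => t; exact: ex_derive.
have dd (x : R) : p < x < q -> is_derive x (1 : R) d 0.
  move=> /andP[px xq]; apply: (@near_eq_is_derive _ _ _ (fun=> 0)); rewrite ?oner_eq0//.
  near=> t; rewrite /d ue ?subrr//; apply/andP; split; near: t.
    exact: lt_nbhsr.
  exact: lt_nbhsl.
have m1 : p < (p + q) / 2 by lra.
have m2 : (p + q) / 2 < q by lra.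
have d0 : d ((p + q) / 2) = 0 by rewrite /d ue ?subrr// m1 m2.
have Z (x y : R) : p <= x <= y -> y <= q -> d x = d y.
  move=> /andP[px xy] yq; apply/esym/eqP; rewrite -subr_eq0 -normr_le0.
  rewrite -(mul0r (y - x)); apply: (@lipschitz_off_finite _ [::]) => //.
    by apply: within_cont_sub dc.
  move=> t /andP[xt ty] _; exists 0; last by rewrite normr0.
  by apply: dd; rewrite (le_lt_trans px xt) (lt_le_trans ty yq).
move=> x /andP[px xq]; apply/eqP; rewrite -subr_eq0 -/(d x) -d0; apply/eqP.
have [xm|/ltW mx] := leP x ((p + q) / 2); first by apply: Z; [rewrite px|exact: ltW].
by apply/esym; apply: Z; rewrite ?(ltW m1).
Unshelve. all: by end_near. Qed.

Lemma Vh_affine (u : R -> R) (j : nat) : Vh xs u -> (j < M)%N ->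
  exists a b, forall x, X j <= x <= X j.+1 -> u x = a * x + b.
Proof.
move=> [uc uj] jM; have [a [b H]] := uj j jM; exists a, b.
apply: affine_closure; first exact: part_lt.
  have /andP[a0 _] := part_range (ltnW jM); have /andP[_ b1] := part_range jM.
  exact: within_cont_sub uc.
by move=> x xj; apply: H; rewrite /cell /= in_itv.
Qed.

Lemma Rintegral_cell (j : nat) (F f f' : R -> R) : (j < M)%N ->
  (forall x, X j < x < X j.+1 -> f' x = f x) ->
  (forall x, is_derive x (1 : R) F (f x)) -> continuous f ->
  \int[lebesgue_measure]_(x in cell xs j) f' x = F (X j.+1) - F (X j).
Proof.
move=> jM ff' dF cf; rewrite -(@FTC_smooth _ f F)//; last exact/ltW/part_lt.
transitivity (\int[lebesgue_measure]_(x in cell xs j) f x).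
  by apply: eq_Rintegral => x; rewrite inE /cell /= in_itv /= => /ff'.
have fi : lebesgue_measure.-integrable `[X j, X j.+1] (EFin \o f) by exact: continuous_itv_integrable.
rewrite /cell Rintegral_itv_obnd_cbnd ?Rintegral_itv_bndo_bndc//; apply: integrableS fi => //;
  by apply: subset_itv; rewrite bnd_simp.
Qed.

Lemma Rintegral_cell_Ph (g : R -> R) (j : nat) : (j < M)%N ->
  \int[lebesgue_measure]_(x in cell xs j) Ph xs g x = (X j.+1 - X j) * g (mid j).
Proof.
move=> jM; have dF (x : R) : is_derive x (1 : R) (fun x => g (mid j) * x) (g (mid j)).
  by apply: is_derive_eq; rewrite /GRing.scale /=; ring.
rewrite (Rintegral_cell jM _ dF (@contC _ _)); first by ring.
by move=> x; exact: Ph_cell.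
Qed.

Lemma Rintegral_cell_scheme (sigma u : R -> R) (mu : R) (j : nat) : (j < M)%N -> Vh xs u ->
  \int[lebesgue_measure]_(x in cell xs j) (mu * derive1 u x + Ph xs sigma x * u x) =
  mu * (u (X j.+1) - u (X j)) +
  (X j.+1 - X j) * (sigma (mid j) * ((u (X j) + u (X j.+1)) / 2)).
Proof.
move=> jM uV; have [a [b H]] := Vh_affine uV jM.
have lt1 := part_lt jM.
rewrite !H ?lexx ?ltW//.
have dF (x : R) : is_derive x (1 : R)
    (fun x => mu * a * x + sigma (mid j) * (a * x ^+ 2 / 2 + b * x))
    (mu * a + sigma (mid j) * (a * x + b)).
  by apply: is_derive_eq; rewrite /GRing.scale /=; field.
have cf : continuous (fun x : R => mu * a + sigma (mid j) * (a * x + b)).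
  by apply: continuous_of_derivable => t; exact: ex_derive.
rewrite (Rintegral_cell jM _ dF cf) /mid; first by field.
move=> x xj; rewrite (Ph_cell _ jM xj) H; last by case/andP: xj => /ltW-> /ltW->.
congr (_ * _ + _); rewrite derive1E; apply: derive_val.
apply: (@near_eq_is_derive _ _ _ (fun x => a * x + b)); rewrite ?oner_eq0//.
  case/andP: xj => jx xj; near=> t; rewrite [in RHS]H//; apply/andP; split; apply/ltW; near: t.
    exact: lt_nbhsr.
  exact: lt_nbhsl.
by apply: is_derive_eq; rewrite /GRing.scale /=; ring.
Unshelve. all: by end_near. Qed.

Lemma Sh_nodes (sigma g u : R -> R) (mu : R) : Sh_spec xs sigma mu (Ph xs g) u ->
  forall j, (j < M)%N -> mu * (u (X j.+1) - u (X j)) +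
  (X j.+1 - X j) * (sigma (mid j) * ((u (X j) + u (X j.+1)) / 2)) = (X j.+1 - X j) * g (mid j).
Proof.
move=> [uV ue _ _] j jM; rewrite -Rintegral_cell_Ph// -ue//.
by rewrite Rintegral_cell_scheme.
Qed.

(** On nodal values the scheme is a recurrence with coefficients [mu + al j] and [mu - al j]. For
    [mu > 0] the first is nonzero and the recurrence is solved from the left; for [mu < 0] the
    second is nonzero and it is solved from the right. *)
Lemma Sh_specP (sigma g : R -> R) (mu : R) : mu != 0 ->
  (forall j, (j < M)%N -> 0 < sigma (mid j)) ->
  Sh_spec xs sigma mu (Ph xs g) (Sh xs sigma mu (Ph xs g)).
Proof.
move=> mu0 sg0; apply: (@getPex _ (Sh_spec xs sigma mu (Ph xs g))).
pose h j := X j.+1 - X j; pose al j := h j * sigma (mid j) / 2.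
have al0 j : (j < M)%N -> 0 < al j.
  by move=> jM; rewrite /al divr_gt0// mulr_gt0 ?sg0// subr_gt0 part_lt.
suff [U [Ue U0 U1]] : exists U : nat -> R, [/\ forall j, (j < M)%N ->
    (mu + al j) * U j.+1 - (mu - al j) * U j = h j * g (mid j),
    0 < mu -> U 0%N = 0 & mu < 0 -> U M = 0].
  have [u uV uU] := interpolant U; exists u; split => //.
  - move=> j jM; rewrite Rintegral_cell_scheme// Rintegral_cell_Ph//.
    by rewrite (uU j) 1?ltnW// (uU j.+1)// -[RHS]Ue// /al /h; field.
  - by move=> /U0 e0; have := uU 0%N isT; rewrite e0.
  - by move=> /U1 e1; have := uU M (leqnn M); rewrite part_last e1.
have [mp|mn] : 0 < mu \/ mu < 0 by move: mu0; rewrite neq_lt => /orP[]; [right|left].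
  pose U := fix U n := if n is n'.+1 then (h n' * g (mid n') + (mu - al n') * U n') / (mu + al n') else 0.
  exists U; split=> // [j jM|]; last by rewrite ltNge ltW.
  rewrite /= mulrC divfK; first by ring.
  by rewrite gt_eqF// addr_gt0// al0.
(* [V n] is the value at the node [n] steps to the left of 1. *)
pose V := fix V n := if n is n'.+1 then
   ((mu + al (M - n'.+1)%N) * V n' - h (M - n'.+1)%N * g (mid (M - n'.+1)%N)) / (mu - al (M - n'.+1)%N) else 0.
exists (fun j => V (M - j)%N); split=> [j jM||]; last 2 first.
- by rewrite ltNge ltW.
- by rewrite subnn.
have -> : (M - j)%N = (M - j.+1).+1 by rewrite subnSK.
have jE : (M - (M - j.+1).+1)%N = j by rewrite subnSK// subKn// ltnW.
rewrite [V _.+1]/= jE (mulrC (mu - al j)) divfK; first by ring.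
by rewrite lt_eqF// subr_lt0 (lt_trans mn) ?al0.
Qed.

End partition.

(** * Error propagation in the box scheme *)

Section scheme_error.
Context {R : realType}.
Implicit Types (m h sg e B rho y : R).

(* The bound B survives both regimes of h sg / (2 m): below 1 the update is a
   convex combination, above 1 the source term is amplified by that factor. *)
Lemma scheme_step m h sg e (e' : R) B rho y : 0 < m -> 0 < h -> 0 < sg ->
  `|m * (e' - e) + h * (sg * ((e + e') / 2))| <= h * (rho + sg * y) ->
  rho / sg + y <= B -> h * (rho + sg * y) / (2 * m) <= B -> `|e| <= B -> `|e'| <= B.
Proof.
move=> m0 h0 s0 H B1 B2 eB.
pose a := h * sg / 2.
have a0 : 0 < a by rewrite /a divr_gt0// mulr_gt0.
have E : h * (rho + sg * y) = 2 * a * (rho / sg + y) by rewrite /a; field; rewrite gt_eqF.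
have ma : 0 < m + a by rewrite addr_gt0.
have H1 : (m + a) * `|e'| <= `|m - a| * `|e| + h * (rho + sg * y).
  rewrite -[X in X * _](gtr0_norm ma) -!normrM.
  have -> : (m + a) * e' = (m - a) * e + (m * (e' - e) + h * (sg * ((e + e') / 2))) by rewrite /a; field.
  by apply: (le_trans (ler_normD _ _)); rewrite lerD2l.
have B0 : 0 <= B := le_trans (normr_ge0 _) eB.
rewrite -(ler_pM2l ma); apply: (le_trans H1).
have [am|ma'] := leP a m.
  rewrite ger0_norm ?subr_ge0// E.
  have h1 : (m - a) * `|e| <= (m - a) * B by rewrite ler_wpM2l// subr_ge0.
  have h2 : 2 * a * (rho / sg + y) <= 2 * a * B by rewrite ler_wpM2l// mulr_ge0// ltW.
  by lra.
rewrite ltr0_norm ?subr_lt0//.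
have h1 : (a - m) * `|e| <= (a - m) * B by rewrite ler_wpM2l// subr_ge0 ltW.
have h2 : h * (rho + sg * y) <= 2 * m * B.
  by rewrite [leRHS]mulrC -ler_pdivrMr ?mulr_gt0.
by lra.
Qed.

Lemma forward_bound (X : nat -> R) (M : nat) (e : nat -> R) (B : R) : e 0%N = 0 -> 0 <= B ->
  (forall j, (j < M)%N -> `|e j| <= B -> `|e j.+1| <= B) ->
  forall j, (j <= M)%N -> `|e j| <= B.
Proof.
move=> e0 B0 H; elim=> [|j IH] jM; first by rewrite e0 normr0.
exact: H jM (IH (ltnW jM)).
Qed.

Lemma backward_bound (M : nat) (e : nat -> R) (B : R) : e M = 0 -> 0 <= B ->
  (forall j, (j < M)%N -> `|e j.+1| <= B -> `|e j| <= B) ->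
  forall j, (j <= M)%N -> `|e j| <= B.
Proof.
move=> e0 B0 H j jM; rewrite -(subKn jM).
elim: (M - j)%N (leq_subr j M) => [_|n IH nM]; first by rewrite subn0 e0 normr0.
apply: H; last by rewrite subnSK//; exact: IH (ltnW nM).
by rewrite ltn_subrL (leq_trans _ nM).
Qed.

End scheme_error.

Section scheme_error_direction.
Context {R : realType}.
Variables (xs : seq R) (sigma g G u U : R -> R) (s m h sm sM r r' y K : R).
Hypothesis xs01 : itv_partition 0 1 xs.
Local Notation X j := ((0 :: xs)`_j).
Local Notation M := (size xs).
Hypotheses (m0 : 0 < m) (sm0 : 0 < sm) (s1 : s = 1 \/ s = -1).
Hypothesis sigma_mid : forall j, (j < M)%N -> sm <= sigma (mid xs j) <= sM.
Hypothesis h_cell : forall j, (j < M)%N -> X j.+1 - X j <= h.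
Hypothesis UV : Vh xs U.
Hypothesis U_cell : forall j, (j < M)%N -> s * m * (U (X j.+1) - U (X j)) +
  (X j.+1 - X j) * (sigma (mid xs j) * ((U (X j) + U (X j.+1)) / 2)) = (X j.+1 - X j) * G (mid xs j).
Hypothesis u_cell : forall j, (j < M)%N ->
  let c := `|s * m * (u (X j.+1) - u (X j)) -
    (X j.+1 - X j) * (g (mid xs j) - sigma (mid xs j) * ((u (X j) + u (X j.+1)) / 2))| in
  c <= (X j.+1 - X j) * r /\ c <= (X j.+1 - X j) * r'.
Hypothesis inflow0 : s = 1 -> u 0 = U 0.
Hypothesis inflow1 : s = -1 -> u 1 = U 1.
Hypothesis u_lip : forall a b : R, 0 <= a <= b -> b <= 1 -> `|u b - u a| <= K * (b - a).
Hypothesis source : forall j, (j < M)%N -> `|g (mid xs j) - G (mid xs j)| <= sigma (mid xs j) * y.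
Hypotheses (r0 : 0 <= r) (r'0 : 0 <= r') (y0 : 0 <= y) (K0 : 0 <= K).

(** Large enough for both regimes of [scheme_step]: [r / sm] serves the convex one and
    [h * r' / (2 * m)] the other, while [y] is amplified by at most [1 + h * sM / (2 * m)]. *)
Let B := r / sm + h * r' / (2 * m) + y * (1 + h * sM / (2 * m)).

Let h0 : 0 < h.
Proof.
have M0 := part_size xs01; apply: lt_le_trans (h_cell M0).
by rewrite subr_gt0 part_lt.
Qed.

Let sM0 : 0 < sM.
Proof.
have /andP[a b] := sigma_mid (part_size xs01).
exact: lt_le_trans sm0 (le_trans a b).
Qed.

Let B0 : 0 <= B.
Proof.
rewrite /B; apply: addr_ge0; first apply: addr_ge0.
- by rewrite divr_ge0// ltW.
- by rewrite divr_ge0// mulr_ge0// ltW.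
- by rewrite mulr_ge0// addr_ge0// divr_ge0// mulr_ge0// ltW.
Qed.

Let node_step (j : nat) : (j < M)%N ->
  (s = 1 -> `|u (X j) - U (X j)| <= B -> `|u (X j.+1) - U (X j.+1)| <= B) /\
  (s = -1 -> `|u (X j.+1) - U (X j.+1)| <= B -> `|u (X j) - U (X j)| <= B).
Proof.
move=> jM; have /andP[sg1 sg2] := sigma_mid jM; have sg0 : 0 < sigma (mid xs j) := lt_le_trans sm0 sg1.
have hj0 : 0 < X j.+1 - X j by rewrite subr_gt0 part_lt.
have hjh := h_cell jM.
set sg := sigma (mid xs j) in sg0 sg1 sg2 *; set hj := X j.+1 - X j in hj0 hjh *.
have m2 : 0 < 2 * m by rewrite mulr_gt0.
(* The residual enters as [Num.min r r'], so that one hypothesis of [scheme_step] can use [r] and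
   the other [r']. *)
have H : `|s * m * ((u (X j.+1) - U (X j.+1)) - (u (X j) - U (X j))) +
     hj * (sg * (((u (X j) - U (X j)) + (u (X j.+1) - U (X j.+1))) / 2))|
     <= hj * (Num.min r r' + sg * y).
  have -> : s * m * ((u (X j.+1) - U (X j.+1)) - (u (X j) - U (X j))) +
     hj * (sg * (((u (X j) - U (X j)) + (u (X j.+1) - U (X j.+1))) / 2)) =
     (s * m * (u (X j.+1) - u (X j)) -
      hj * (g (mid xs j) - sg * ((u (X j) + u (X j.+1)) / 2))) +
     hj * (g (mid xs j) - G (mid xs j)).
    have := U_cell jM; rewrite -/hj -/sg => /esym UE.
    by rewrite [in RHS](mulrBr hj (g _) (G _)) UE; field.
  apply: (le_trans (ler_normD _ _)); rewrite [leRHS]mulrDr; apply: lerD.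
    have [c1 c2] := u_cell jM.
    by have [_|_] := leP r r'.
  by rewrite normrM (gtr0_norm hj0) ler_wpM2l ?source// ltW.
have hB1 : Num.min r r' / sg + y <= B.
  have e1 : Num.min r r' / sg <= r / sm.
    apply: ler_pM; rewrite ?le_min ?r0 ?invr_ge0 ?(ltW sg0)//; first by rewrite ge_min lexx.
    by rewrite lef_pV2 ?posrE.
  have e2 : 0 <= h * r' / (2 * m) by rewrite divr_ge0 ?mulr_ge0// ltW.
  have e3 : 0 <= y * (h * sM / (2 * m)) by rewrite mulr_ge0// divr_ge0 ?mulr_ge0// ltW.
  by rewrite /B; lra.
have hB2 : hj * (Num.min r r' + sg * y) / (2 * m) <= B.
  have e1 : hj * (Num.min r r' + sg * y) / (2 * m) <= (h * (r' + sM * y)) / (2 * m).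
    rewrite ler_wpM2r ?invr_ge0 ?(ltW m2)//; apply: ler_pM => //; rewrite ?(ltW hj0)//.
      by rewrite addr_ge0 ?mulr_ge0 ?(ltW sg0)// le_min r0.
    by apply: lerD; [rewrite ge_min lexx orbT|rewrite ler_wpM2r].
  have e2 : 0 <= r / sm by rewrite divr_ge0// ltW.
  have e3 : (h * (r' + sM * y)) / (2 * m) = h * r' / (2 * m) + y * (h * sM / (2 * m)) by field; rewrite gt_eqF.
  apply: (le_trans e1); rewrite e3 /B mulrDr mulr1.
  by set T1 := h * r' / _; set T2 := y * (_ / _); move: e2 y0; set T3 := r / sm; lra.
split=> sE; rewrite sE in H.
  by rewrite mul1r in H; apply: scheme_step H hB1 hB2.
apply: (@scheme_step _ m hj sg _ _ _ (Num.min r r') y) => //.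
apply: le_trans H; rewrite le_eqVlt; apply/orP; left; apply/eqP; congr (Num.norm _); ring.
Qed.

Let node_bound (j : nat) : (j <= M)%N -> `|u (X j) - U (X j)| <= B.
Proof.
case: s1 => sE; move: j.
  apply: (@forward_bound _ (fun=> 0) M (fun j => u (X j) - U (X j))) => //.
    by rewrite /= inflow0// subrr.
  by move=> j jM; have [H _] := node_step jM; exact: H.
apply: (@backward_bound _ M (fun j => u (X j) - U (X j))) => //.
  by rewrite part_last// inflow1// subrr.
by move=> j jM; have [_ H] := node_step jM; exact: H.
Qed.

(** Inside a cell, [U] is a convex combination of its nodal values, and [u] differs from its own
    nodal values by at most [K * h]. *)
Lemma scheme_error (x : R) : 0 <= x <= 1 -> `|u x - U x| <= B + K * h.
Proof.
suff cellP (z : R) j : (j < M)%N -> X j <= z <= X j.+1 -> `|u z - U z| <= B + K * h.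
  move=> /andP[x0]; rewrite le_eqVlt => /predU1P[x1|x1]; last first.
    have [j jM /andP[jx xj]] : exists2 j, (j < M)%N & X j <= x < X j.+1 by apply: part_find; rewrite ?x0.
    by apply: (cellP x j) => //; rewrite jx ltW.
  have M0 := part_size xs01; have M1 : (M.-1 < M)%N by rewrite prednK.
  apply: (cellP x M.-1) => //; have := ltW (part_lt xs01 M1).
  by rewrite prednK// part_last// x1 lexx andbT.
move=> jM /andP[jz zj]; have [a [b E]] := Vh_affine xs01 UV jM.
have hj0 : 0 < X j.+1 - X j by rewrite subr_gt0 part_lt.
have e1 := node_bound (ltnW jM); have e2 := node_bound jM.
have /andP[j0 _] := part_range xs01 (ltnW jM); have /andP[_ j1] := part_range xs01 jM.
pose t := (z - X j) / (X j.+1 - X j).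
have t0 : 0 <= t by rewrite /t divr_ge0 ?(ltW hj0)// subr_ge0.
have t1 : t <= 1 by rewrite ler_pdivrMr// mul1r lerD2r.
have l1 : `|u z - u (X j)| <= K * (X j.+1 - X j).
  apply: (@le_trans _ _ (K * (z - X j))); first by apply: u_lip; rewrite ?j0 ?(le_trans zj).
  by rewrite ler_wpM2l// lerD2r.
have l2 : `|u z - u (X j.+1)| <= K * (X j.+1 - X j).
  rewrite distrC; apply: (@le_trans _ _ (K * (X j.+1 - z))).
    by apply: u_lip; rewrite ?zj ?(le_trans j0).
  by rewrite ler_wpM2l// lerB.
have Uz : U z = (1 - t) * U (X j) + t * U (X j.+1).
  have jj := ltW (part_lt xs01 jM).
  have -> : U z = a * z + b by apply: E; rewrite jz.
  have -> : U (X j) = a * X j + b by apply: E; rewrite lexx.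
  have -> : U (X j.+1) = a * X j.+1 + b by apply: E; rewrite jj lexx.
  have tE : t * (X j.+1 - X j) = z - X j by rewrite /t divfK// gt_eqF.
  have -> : z = t * (X j.+1 - X j) + X j by rewrite tE subrK.
  by ring.
have -> : u z - U z = (1 - t) * ((u z - u (X j)) + (u (X j) - U (X j))) +
   t * ((u z - u (X j.+1)) + (u (X j.+1) - U (X j.+1))) by rewrite Uz; ring.
have C0 : 0 <= 1 - t by rewrite subr_ge0.
apply: (le_trans (ler_normD _ _)); rewrite (normrM (1 - t)) (normrM t) (ger0_norm C0) (ger0_norm t0).
have Kh : K * (X j.+1 - X j) <= K * h by rewrite ler_wpM2l ?h_cell.
have n1 : `|(u z - u (X j)) + (u (X j) - U (X j))| <= B + K * h.
  by apply: (le_trans (ler_normD _ _)); lra.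
have n2 : `|(u z - u (X j.+1)) + (u (X j.+1) - U (X j.+1))| <= B + K * h.
  by apply: (le_trans (ler_normD _ _)); lra.
have k1 := ler_wpM2l C0 n1; have k2 := ler_wpM2l t0 n2.
apply: (le_trans (lerD k1 k2)).
by rewrite -mulrDl subrK mul1r.
Qed.

End scheme_error_direction.

Section transport_streams.
Context {R : realType}.
Variables (cs : seq R) (sigma sigmaS f : R -> R) (psi : R -> R -> R) (phi : R -> R).
Hypothesis Hts : transport_solution cs sigma sigmaS f psi phi.

Let g (x : R) : R := sigmaS x * phi x + f x.
Definition refl (s : seq R) : seq R := [seq 1 - c | c <- s].

Lemma refl_in01 (x : R) : (0 < 1 - x < 1) = (0 < x < 1).
Proof. by rewrite subr_gt0 ltrBlDr ltrDl andbC. Qed.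

Lemma refl_mem (s : seq R) (x : R) : (x \in refl s) = (1 - x \in s).
Proof.
apply/mapP/idP => [[c cs' ->]|H]; first by rewrite opprB addrC subrK.
by exists (1 - x) => //; rewrite opprB addrC subrK.
Qed.

Lemma streams_forward (m : R) : 0 < m <= 1 -> streams cs sigma g m (psi^~ m).
Proof.
move=> /andP[m0 m1]; have [H1 H2 _ _] := Hts.
have m11 : -1 <= m <= 1 by rewrite m1 andbT; apply: le_trans (ltW m0); rewrite lerN10.
have mn : m != 0 by rewrite gt_eqF.
split; first exact: H1.
move=> x x01 xcs; have [/(_ mn) dx e] := H2 m x m11 x01 xcs.
by exists (derive1 (psi^~ m) x) => //; rewrite derive1E; exact: DeriveDef.
Qed.

(** The reflection of [0, 1] turns a negative direction with inflow at 1 into a positive one with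
    inflow at 0, so that the estimates for streams cover both signs. *)
Lemma streams_backward (m : R) : 0 < m <= 1 ->
  streams (refl cs) (fun x => sigma (1 - x)) (fun x => g (1 - x)) m (fun x => psi (1 - x) (- m)).
Proof.
move=> /andP[m0 m1]; have [H1 H2 _ _] := Hts.
have m11 : -1 <= - m <= 1 by rewrite lerN2 m1 /=; apply: le_trans ler01; rewrite oppr_le0 ltW.
have mn : - m != 0 by rewrite oppr_eq0 gt_eqF.
split.
  apply/within_contP => x x01 e e0; have /within_contP H := H1 _ m11 mn.
  have x01' : 0 <= 1 - x <= 1 by lra.
  have [d d0 D] := H (1 - x) x01' e e0; exists d => // y y01 yx.
  apply: D; first by lra.
  by rewrite (_ : 1 - y - (1 - x) = - (y - x)) ?normrN//; ring.
move=> x x01; rewrite refl_mem => xcs.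
have x01' : 0 < 1 - x < 1 by rewrite refl_in01.
have [/(_ mn) dx e] := H2 (- m) (1 - x) m11 x01' xcs.
exists (- derive1 (psi^~ (- m)) (1 - x)); last by rewrite mulrN -mulNr.
have D1 : is_derive x (1 : R) (fun x : R => 1 - x) (-1).
  by apply: is_derive_eq; rewrite /GRing.scale /=; ring.
have D2 : is_derive (1 - x) (1 : R) (psi^~ (- m)) (derive1 (psi^~ (- m)) (1 - x)).
  by rewrite derive1E; exact: DeriveDef.
have := @is_derive1_comp _ (psi^~ (- m)) (fun x : R => 1 - x) x _ _ D2 D1.
by move=> H; apply: is_derive_eq; rewrite ?mulrN1.
Qed.

End transport_streams.

(** * Regularity and error of the scalar flux *)

Section log_kernel.
Context {R : realType}.
Local Notation leb := (@lebesgue_measure R).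

(** The angular flux is controlled for nonzero directions only; the direction 0 is a null set. *)
Lemma normr_Rintegral_le_off0 (F m : R -> R) :
  leb.-integrable `[-1, 1] (EFin \o F) -> leb.-integrable `[-1, 1] (EFin \o m) ->
  (forall x : R, -1 <= x <= 1 -> x != 0 -> `|F x| <= m x) ->
  `|\int[leb]_(x in `[-1, 1]) F x| <= \int[leb]_(x in `[-1, 1]) m x.
Proof.
move=> Fi mi Fm.
pose D : set R := `[-1, 1] `\ (0 : R).
have mD : measurable D by apply: measurableD.
have DS : D `<=` `[-1, 1] by move=> x [].
have remove (G : R -> R) : leb.-integrable `[-1, 1] (EFin \o G) ->
    \int[leb]_(x in `[-1, 1]) G x = \int[leb]_(x in D) G x.
  move=> Gi; rewrite /Rintegral integral_setD1//.
  have /integrableP[] // : leb.-integrable D (EFin \o G) by apply: integrableS Gi.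
have FiD : leb.-integrable D (EFin \o F) by apply: integrableS Fi.
have miD : leb.-integrable D (EFin \o m) by apply: integrableS mi.
rewrite (remove F Fi) (remove m mi).
have h := @le_normr_Rintegral _ _ _ leb D F mD FiD; apply: (le_trans h).
apply: le_Rintegral => //; first exact: integrable_norm FiD.
move=> x [/=]; rewrite in_itv /= => x1 x0; apply: Fm => //.
by apply/negP => /eqP; apply: x0.
Qed.

(* A substitute for [min 1 (t / `|x|)] with an explicit primitive. *)
Definition log_kernel (t x : R) : R := 2 * t / Num.sqrt (t ^+ 2 + x ^+ 2).

Section fixed_t.
Variable t : R.
Hypothesis t0 : 0 < t.

Let q (x : R) : R := t ^+ 2 + x ^+ 2.

Let q0 (x : R) : 0 < q x.
Proof. by rewrite /q ltr_pwDl ?exprn_gt0 ?sqr_ge0. Qed.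

Let sq (x : R) : Num.sqrt (q x) ^+ 2 = q x.
Proof. by rewrite sqr_sqrtr// ltW. Qed.

Let sq0 (x : R) : 0 < Num.sqrt (q x).
Proof. by rewrite sqrtr_gt0. Qed.

Let arg0 (x : R) : 0 < x + Num.sqrt (q x).
Proof.
have : `|x| < Num.sqrt (q x).
  by rewrite -sqrtr_sqr ltr_sqrt// /q ltrDr exprn_gt0.
by rewrite ltr_norml => /andP[+ _]; rewrite -subr_gt0 opprK addrC.
Qed.

Let dsqrt (x : R) : is_derive x (1 : R) (fun x => Num.sqrt (q x)) (x / Num.sqrt (q x)).
Proof.
have D1 : is_derive x (1 : R) q (2 * x).
  by rewrite /q; apply: is_derive_eq; rewrite /GRing.scale /=; ring.
have D2 := is_derive1_sqrt (q0 x).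
have := @is_derive1_comp _ Num.sqrt q x _ _ D2 D1.
move=> H; apply: is_derive_eq; field.
by rewrite gt_eqF.
Qed.

Let log_primitive (x : R) : is_derive x (1 : R)
  (fun x => 2 * t * ln (x + Num.sqrt (q x))) (log_kernel t x).
Proof.
have D1 : is_derive x (1 : R) (fun x => x + Num.sqrt (q x)) (1 + x / Num.sqrt (q x)).
  exact: is_deriveD.
have D2 := is_derive1_ln (arg0 x).
have D3 := @is_derive1_comp _ (@ln R) (fun x => x + Num.sqrt (q x)) x _ _ D2 D1.
apply: is_derive_eq; rewrite /GRing.scale /= /log_kernel -/(q x); field.
by rewrite !gt_eqF.
Qed.

Lemma log_kernel_cont : continuous (log_kernel t).
Proof.
move=> x; apply: cvgM; first exact: cvg_cst.
apply: cvgV; first exact: lt0r_neq0 (sq0 x).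
apply: (@cvg_comp _ _ _ q Num.sqrt); last exact: sqrt_continuous.
by apply: (@continuous_of_derivable _ q) => z; rewrite /q; exact: ex_derive.
Qed.

(** The primitive gives 4 t (ln(1 + S) - ln t). The logarithm is traded for a power through (1 -
    eta)(- ln t) <= t^(eta - 1) - 1, which is where [eta < 1] enters. *)
Lemma log_kernel_integral (eta : R) : t <= 1 -> 0 < eta < 1 ->
  \int[leb]_(x in `[-1, 1]) log_kernel t x <= 4 * (2 + (1 - eta)^-1) * t `^ eta.
Proof.
move=> t1 /andP[e0 e1].
rewrite (@FTC_smooth _ (log_kernel t) _ _ _ _ log_primitive log_kernel_cont); last by lra.
have qE : q (-1) = q 1 by rewrite /q sqrrN.
set S := Num.sqrt (q 1); have S0 : 0 < S := sq0 1.
have S2 : S ^+ 2 = t ^+ 2 + 1 by rewrite /S sq /q expr1n.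
have t2 : t ^+ 2 <= 1 by rewrite expr_le1// ltW.
have S_le : S <= 2 by rewrite -(ler_pXn2r (ltn0Sn 1)) ?nnegrE ?(ltW S0)// S2; lra.
have a1 : 0 < 1 + S by rewrite addr_gt0.
have a2 : 0 < -1 + S by have := arg0 (-1); rewrite qE.
have prodE : (1 + S) * (-1 + S) = t ^+ 2 by rewrite -[t ^+ 2](addrK 1) -S2; ring.
have lnE : ln (-1 + S) = 2 * ln t - ln (1 + S).
  have -> : 2 * ln t = ln (t ^+ 2) by rewrite lnXn// mulr_natl.
  by rewrite -prodE lnM ?posrE//; ring.
rewrite qE -/S lnE.
have ln3 : ln (1 + S) <= 2 by apply: (le_trans (ln_le_subr1 a1)); lra.
have lnt : (1 - eta) * - ln t <= t `^ (eta - 1) - 1.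
  have := @ln_le_subr1 R (t `^ (eta - 1)) (powR_gt0 _ t0).
  by rewrite ln_powR; lra.
have e1' : 0 < 1 - eta by rewrite subr_gt0.
have te : t * t `^ (eta - 1) = t `^ eta by rewrite mulr_powRB1// ltW.
have tle : t <= t `^ eta by rewrite -[leLHS](powRr1 (ltW t0)) ger_powR ?t0 ?t1// ltW.
have h1 : t * - ln t <= t `^ eta / (1 - eta).
  rewrite ler_pdivlMr// -te.
  have := ler_wpM2l (ltW t0) lnt; have := t0; lra.
have h2 : t * ln (1 + S) <= 2 * t `^ eta.
  have := ler_wpM2l (ltW t0) ln3; lra.
have -> : 2 * t * ln (1 + S) - 2 * t * (2 * ln t - ln (1 + S)) = 4 * (t * ln (1 + S) + t * - ln t) by ring.
have -> : 4 * (2 + (1 - eta)^-1) * t `^ eta = 4 * (2 * t `^ eta + t `^ eta / (1 - eta)) by ring.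
by rewrite ler_pM2l// lerD.
Qed.

Lemma log_kernel_ge (x a b D : R) : x != 0 -> 0 <= a -> 0 <= b -> D <= a -> D <= b * t / `|x| ->
  D <= (a + b) * log_kernel t x.
Proof.
move=> x0 a0 b0 Da Db; have nx : 0 < `|x| by rewrite normr_gt0.
have S_le : Num.sqrt (q x) <= t + `|x|.
  have tx : 0 <= t + `|x| by rewrite addr_ge0// ltW.
  rewrite -(ler_pXn2r (ltn0Sn 1)) ?nnegrE ?(ltW (sq0 x))// sq /q -(real_normK (num_real x)).
  have : 0 <= t * `|x| by rewrite mulr_ge0// ltW.
  by rewrite !expr2; lra.
have [xt|tx] := leP `|x| t.
  have L1 : 1 <= log_kernel t x.
    by rewrite /log_kernel -/(q x) ler_pdivlMr ?sq0// mul1r; apply: (le_trans S_le); lra.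
  apply: (le_trans Da); apply: (@le_trans _ _ (a + b)); first by rewrite lerDl.
  by rewrite ler_peMr// addr_ge0.
have L1 : t / `|x| <= log_kernel t x.
  rewrite /log_kernel -/(q x) (mulrC 2) -mulrA ler_pM2l// ler_pdivlMr ?sq0// mulrC ler_pdivrMr//.
  by apply: (le_trans S_le); lra.
apply: (le_trans Db); rewrite -mulrA; apply: ler_pM => //.
- by rewrite divr_ge0// ltW.
- by rewrite lerDr.
Qed.

End fixed_t.
End log_kernel.

(** * Size and Hoelder continuity of the scalar flux *)

Section flux_bounds.
Context {R : realType}.
Variables (cs : seq R) (sigma sigmaS f : R -> R) (psi : R -> R -> R) (phi : R -> R).
Variables (sm sM Gam : R).
Hypothesis Hts : transport_solution cs sigma sigmaS f psi phi.
Hypothesis Hphi : forall x, unit_itv x ->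
  lebesgue_measure.-integrable `[-1, 1] (EFin \o psi x) /\
  phi x = 2^-1 * \int[lebesgue_measure]_(mu in `[-1, 1]) psi x mu.
Hypothesis sm0 : 0 < sm.
Hypothesis sigma_bnd : forall x : R, 0 < x < 1 -> sm <= sigma x <= sM.
Local Notation g := (fun x : R => sigmaS x * phi x + f x).
Hypothesis g_bnd : forall x : R, 0 < x < 1 -> `|g x| <= Gam * sigma x.

Lemma sigma_bnd_refl (x : R) : 0 < x < 1 -> sm <= sigma (1 - x) <= sM.
Proof. by move=> x01; apply: sigma_bnd; rewrite refl_in01. Qed.

Lemma g_bnd_refl (x : R) : 0 < x < 1 -> `|g (1 - x)| <= Gam * sigma (1 - x).
Proof. by move=> x01; apply: g_bnd; rewrite refl_in01. Qed.

Lemma inflow_left (m : R) : 0 < m <= 1 -> psi 0 m = 0.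
Proof. by have [_ _ H _] := Hts; exact: H. Qed.

Lemma inflow_right (m : R) : 0 < m <= 1 -> psi (1 - 0) (- m) = 0.
Proof.
move=> /andP[m0 m1]; have [_ _ _ H] := Hts; rewrite subr0; apply: H.
by rewrite lerN2 m1 oppr_lt0.
Qed.

Lemma psi_dir (mu : R) : -1 <= mu <= 1 -> mu != 0 ->
  (0 < mu <= 1) \/ (0 < - mu <= 1).
Proof.
move=> /andP[a b]; rewrite neq_lt => /orP[m0|m0]; [right|left]; rewrite ?m0 ?b//.
by rewrite oppr_gt0 m0 lerNl.
Qed.

Lemma psi_le (x mu : R) : 0 <= x <= 1 -> -1 <= mu <= 1 -> mu != 0 -> `|psi x mu| <= Gam.
Proof.
move=> x01 m1 mn; have [m0|m0] := psi_dir m1 mn.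
  exact: (streams_le sm0 sigma_bnd g_bnd m0 (streams_forward Hts m0) (inflow_left m0)).
have x01' : 0 <= 1 - x <= 1 by lra.
have := streams_le sm0 sigma_bnd_refl g_bnd_refl m0 (streams_backward Hts m0) (inflow_right m0) x01'.
by rewrite /= opprK subKr.
Qed.

Lemma psi_lipschitz (x y mu : R) : 0 <= x <= y -> y <= 1 -> -1 <= mu <= 1 -> mu != 0 ->
  `|psi y mu - psi x mu| <= 2 * sM * Gam / `|mu| * (y - x).
Proof.
move=> /andP[x0 xy] y1 m1 mn; have [m0|m0] := psi_dir m1 mn.
  rewrite (@gtr0_norm _ mu); last by case/andP: m0.
  apply: (streams_lipschitz sm0 sigma_bnd g_bnd m0 (streams_forward Hts m0) (inflow_left m0)) => //.
  by rewrite x0.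
have m0' : mu < 0 by case/andP: m0; rewrite oppr_gt0.
rewrite (ltr0_norm m0') distrC.
have h1 : 0 <= 1 - y <= 1 - x by lra.
have h2 : 1 - x <= 1 by lra.
have := streams_lipschitz sm0 sigma_bnd_refl g_bnd_refl m0 (streams_backward Hts m0) (inflow_right m0) h1 h2.
by rewrite /= opprK !subKr (_ : 1 - x - (1 - y) = y - x)//; ring.
Qed.

Lemma flux_le (B : R) : (forall mu : R, -1 <= mu <= 1 -> mu != 0 -> forall x : R, 0 <= x <= 1 -> `|psi x mu| <= B) ->
  forall x : R, 0 <= x <= 1 -> `|phi x| <= B.
Proof.
move=> H x x01; have xu : unit_itv x by rewrite /unit_itv /= in_itv.
have [pint ->] := Hphi xu.
have ci : (@lebesgue_measure R).-integrable `[-1, 1] (EFin \o fun=> B).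
  by apply: continuous_itv_integrable; exact: contC.
have := @normr_Rintegral_le_off0 R (psi x) (fun=> B) pint ci (fun mu h1 h2 => H mu h1 h2 x x01).
rewrite Rintegral_cst//= lebesgue_measure_itv /= lte_fin ifT; last by lra.
by rewrite /= normrM ger0_norm ?invr_ge0//; lra.
Qed.

(** With t = y - x, the increment of [psi] is at most [2 * Gam] and also of order t / |mu|. The
    smaller of the two is dominated by a multiple of [log_kernel], whose integral over the
    directions is of order t log(1 / t), hence below a multiple of t^eta. *)
Lemma flux_hoelder (eta x y : R) : 0 < eta < 1 -> 0 <= Gam -> 0 <= sM -> 0 <= x <= y -> y <= 1 ->
  `|phi y - phi x| <= 4 * (2 + (1 - eta)^-1) * (1 + sM) * Gam * (y - x) `^ eta.
Proof.
move=> e01 G0 sM0 /andP[x0 xy] y1.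
move: (xy); rewrite le_eqVlt => /predU1P[->|xy'].
  by rewrite !subrr normr0 powR0 ?mulr0//; case/andP: e01 => /gt_eqF ->.
have xu : unit_itv x by rewrite /unit_itv /= in_itv /= x0 (le_trans xy).
have yu : unit_itv y by rewrite /unit_itv /= in_itv /= (le_trans x0 xy).
have [xi ->] := Hphi xu; have [yi ->] := Hphi yu.
have t0 : 0 < y - x by rewrite subr_gt0.
have t1 : y - x <= 1 by lra.
have ki : (@lebesgue_measure R).-integrable `[-1, 1] (EFin \o log_kernel (y - x)).
  exact: continuous_itv_integrable (log_kernel_cont t0).
have Di : (@lebesgue_measure R).-integrable `[-1, 1] (EFin \o (fun mu => psi y mu - psi x mu)).
  by have := integrableB _ yi xi; apply.
have mi : (@lebesgue_measure R).-integrable `[-1, 1]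
    (EFin \o (fun mu => (2 * Gam + 2 * sM * Gam) * log_kernel (y - x) mu)).
  by have := integrableZl _ (2 * Gam + 2 * sM * Gam) ki; apply.
have := @normr_Rintegral_le_off0 R _ _ Di mi.
rewrite RintegralB// RintegralZl// => H.
rewrite -mulrBr normrM ger0_norm ?invr_ge0//.
have H1 : `|\int[lebesgue_measure]_(mu in `[-1, 1]) psi y mu - \int[lebesgue_measure]_(mu in `[-1, 1]) psi x mu| <=
  (2 * Gam + 2 * sM * Gam) * \int[lebesgue_measure]_(x1 in `[-1, 1]) log_kernel (y - x) x1.
  apply: H => mu mu1 mu0; apply: log_kernel_ge => //.
  - by rewrite mulr_ge0.
  - by rewrite !mulr_ge0.
  - apply: (le_trans (ler_normB _ _)).
    have := @psi_le x mu; have := @psi_le y mu.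
    move: xu yu; rewrite /unit_itv /= !in_itv /= => -> -> /(_ isT mu1 mu0) + /(_ isT mu1 mu0); lra.
  - have -> : 2 * sM * Gam * (y - x) / `|mu| = 2 * sM * Gam / `|mu| * (y - x) by ring.
    by apply: psi_lipschitz => //; rewrite x0.
have H2 := log_kernel_integral t0 t1 e01.
have c0 : 0 <= 2 * Gam + 2 * sM * Gam by rewrite addr_ge0 ?mulr_ge0.
have H3 := ler_wpM2l c0 H2.
have half : 0 <= (2^-1 : R) by rewrite invr_ge0.
apply: (le_trans (ler_wpM2l half (le_trans H1 H3))).
rewrite le_eqVlt; apply/orP; left; apply/eqP; field.
by case/andP: e01 => _ e1; rewrite gt_eqF// subr_gt0.
Qed.

End flux_bounds.

(** * Error of the discrete scalar flux *)

Section flux_error.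
Context {R : realType}.
Variables (cs : seq R) (sigma sigmaS f : R -> R) (psi : R -> R -> R) (phi : R -> R).
Variables (sm sM Gam L eta kap : R).
Hypothesis Hts : transport_solution cs sigma sigmaS f psi phi.
Hypothesis Hphi : forall x, unit_itv x ->
  lebesgue_measure.-integrable `[-1, 1] (EFin \o psi x) /\
  phi x = 2^-1 * \int[lebesgue_measure]_(mu in `[-1, 1]) psi x mu.
Hypothesis sm0 : 0 < sm.
Hypothesis sigma_bnd : forall x : R, 0 < x < 1 -> sm <= sigma x <= sM.
Local Notation g := (fun x : R => sigmaS x * phi x + f x).
Hypothesis g_bnd : forall x : R, 0 < x < 1 -> `|g x| <= Gam * sigma x.
Hypotheses (L0 : 0 <= L) (eta01 : 0 < eta < 1).
Hypothesis data_hoelder : forall x y : R, 0 < x <= y -> y < 1 ->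
  (forall c, c \in cs -> ~~ (x <= c <= y)) ->
  `|g x - g y| + Gam * `|sigma x - sigma y| <= L * (y - x) `^ eta.
Hypothesis kap0 : 0 <= kap.
Hypothesis sigmaS_bnd : forall x : R, 0 < x < 1 -> 0 <= sigmaS x <= kap * sigma x.

Let data_hoelder_refl (x y : R) : 0 < x <= y -> y < 1 ->
  (forall c, c \in refl cs -> ~~ (x <= c <= y)) ->
  `|g (1 - x) - g (1 - y)| + Gam * `|sigma (1 - x) - sigma (1 - y)| <= L * (y - x) `^ eta.
Proof.
move=> /andP[x0 xy] y1 gap; rewrite distrC (distrC (sigma _)).
have -> : y - x = (1 - x) - (1 - y) by ring.
apply: data_hoelder; [lra|lra|move=> c cin].
have /gap : 1 - c \in refl cs by rewrite refl_mem subKr.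
by apply: contra => /andP[a b]; apply/andP; split; lra.
Qed.

Let half01 : 0 < (2^-1 : R) < 1.
Proof. by apply/andP; split; lra. Qed.

Let sM0 : 0 < sM.
Proof. by have /andP[a b] := sigma_bnd half01; exact: lt_le_trans sm0 (le_trans a b). Qed.

Let Gam0 : 0 <= Gam.
Proof.
have /andP[a _] := sigma_bnd half01; rewrite -(pmulr_lge0 _ (lt_le_trans sm0 a)).
exact: le_trans (normr_ge0 _) (g_bnd half01).
Qed.

Definition layers_max : R :=
  2 * sM * Gam / sm * (size cs).+1%:R + sM * L * ((1 + sm^-1) / sm) / (sm * eta).

Section discretized.
Variables (xs : seq R) (N : nat) (mu w : 'I_N.+1 -> R) (Phi : R -> R) (h : R).
Hypothesis gauss : gauss_legendre mu w.
Hypothesis xs01 : itv_partition 0 1 xs.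
Hypothesis cs_xs : {subset cs <= xs}.
Hypothesis h_cell : forall j, (j < size xs)%N -> xs`_j - (0 :: xs)`_j <= h.
Hypothesis HPhi : discrete_flux xs mu w sigma sigmaS f Phi.

Local Notation X j := ((0 :: xs)`_j).
Local Notation M := (size xs).
Local Notation G := (sigmaS \* Phi \+ f).

(** [koksma_itv] asks for one majorant of the increments at both signs of the direction. The layers
    seen from the left plus those seen from the right, after reflection, serve for both, since each
    of the two is monotone. *)
Lemma angular_error (x : R) : 0 <= x <= 1 ->
  `|2^-1 * \sum_(k < N.+1) w k * (psi x (mu k) + psi x (- mu k)) - phi x| <=
  18 / N.+1%:R * (2 * Gam + 2 * layers_max).
Proof.
move=> x01; have xu : unit_itv x by rewrite /unit_itv /= in_itv.
have [pint ->] := Hphi xu.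
have x01' : 0 <= 1 - x <= 1 by lra.
pose l1 m := layers cs sm sM Gam L eta m x.
pose l2 m := layers (refl cs) sm sM Gam L eta m (1 - x).
have mono1 (a b : R) : 0 < a <= b -> l1 a <= l1 b by move=> ab; exact: (layers_mono _ sm0 sigma_bnd L0 g_bnd eta01).
have mono2 (a b : R) : 0 < a <= b -> l2 a <= l2 b.
  by move=> ab; exact: (layers_mono _ sm0 (sigma_bnd_refl sigma_bnd) L0 (g_bnd_refl g_bnd) eta01).
have := @koksma_itv R N mu w gauss (psi x) (fun m => l1 m + l2 m) Gam (2 * layers_max) pint.
move=> H; rewrite -mulrBr normrM ger0_norm ?invr_ge0//.
have {}H : `|\sum_(k < N.+1) w k * (psi x (mu k) + psi x (- mu k)) -
     \int[lebesgue_measure]_(x0 in `[-1, 1]) psi x x0| <=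
     2 * (18 / N.+1%:R) * (2 * Gam + 2 * layers_max).
  apply: H.
  - by move=> m m1 m0; exact: (psi_le Hts sm0 sigma_bnd g_bnd).
  - by move=> a b ab _; apply: lerD; [exact: mono1|exact: mono2].
  - move=> m m01.
    have /andP[b1 b2] := layers_bound cs sm0 sigma_bnd L0 g_bnd eta01 x m01.
    have /andP[c1 c2] := layers_bound (refl cs) sm0 (sigma_bnd_refl sigma_bnd) L0 (g_bnd_refl g_bnd) eta01 (1 - x) m01.
    rewrite size_map in c2; rewrite addr_ge0//= /layers_max mulr_natl mulr2n.
    exact: lerD.
  - move=> s a b s1 ab b1; have /andP[a0 ab'] := ab; have b0 := lt_le_trans a0 ab'.
    have a01 : 0 < a <= 1 by rewrite a0 (le_trans ab').
    have b01 : 0 < b <= 1 by rewrite b0.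
    have [->|->] : s = 1 \/ s = -1 by move: s1; case: (ger0P s) => _ <-; [left|right; rewrite opprK].
      rewrite !mul1r; apply: (@le_trans _ _ (l1 b - l1 a)); last by have := mono2 a b ab; lra.
      exact: (streams_increment sm0 sigma_bnd L0 g_bnd eta01 data_hoelder ab b1
        (streams_forward Hts a01) (streams_forward Hts b01) (inflow_left Hts a01) (inflow_left Hts b01)).
    rewrite !mulN1r; apply: (@le_trans _ _ (l2 b - l2 a)); last by have := mono1 a b ab; lra.
    have := streams_increment sm0 (sigma_bnd_refl sigma_bnd) L0 (g_bnd_refl g_bnd) eta01 data_hoelder_refl ab b1
        (streams_backward Hts a01) (streams_backward Hts b01) (inflow_right Hts a01) (inflow_right Hts b01) x01'.
    by rewrite /= subKr.
have half : 0 <= (2^-1 : R) by rewrite invr_ge0.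
apply: (le_trans (ler_wpM2l half H)); rewrite le_eqVlt; apply/orP; left; apply/eqP; field.
by rewrite nat1r pnatr_eq0.
Qed.

Let h0 : 0 < h.
Proof.
have M0 := part_size xs01; apply: lt_le_trans (h_cell M0).
by rewrite subr_gt0 (part_lt xs01).
Qed.

Let node01 (k : 'I_N.+1) : 0 < mu k <= 1.
Proof.
rewrite (gauss_node_gt0 gauss) /=; have [H _ _] := gauss.
by have := H k; rewrite /unit_itv /= in_itv /= => /andP[].
Qed.

(** The bound of [scheme_error] with the residuals of [streams_cell] and the Lipschitz constant of
    [psi_lipschitz]; [y] is the error of the source relative to [sigma]. *)
Definition direction_bound (y m : R) : R :=
  (L * h `^ eta + 2 * sM ^+ 2 * Gam * h / m) / sm + h * (4 * sM * Gam) / (2 * m) +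
  y * (1 + h * sM / (2 * m)) + 2 * sM * Gam / m * h.

Lemma direction_error (E : R) (s : R) (k : 'I_N.+1) (x : R) :
  (forall j, (j < M)%N -> `|phi (mid xs j) - Phi (mid xs j)| <= E) -> 0 <= E ->
  s = 1 \/ s = -1 -> 0 <= x <= 1 ->
  `|psi x (s * mu k) - Sh xs sigma (s * mu k) (Ph xs G) x| <= direction_bound (kap * E) (mu k).
Proof.
move=> HE E0 s1 x01; have mk := node01 k; have /andP[m0 m1] := mk.
set m := mu k in mk m0 m1 *.
have sm_n0 : s * m != 0 by case: s1 => ->; rewrite ?mul1r ?mulN1r ?oppr_eq0 gt_eqF.
have sg_mid j : (j < M)%N -> 0 < sigma (mid xs j).
  by move=> jM; have /andP[a _] := sigma_bnd (mid01 xs01 jM); exact: lt_le_trans sm0 a.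
have US := Sh_specP xs01 G sm_n0 sg_mid.
have Unodes := Sh_nodes xs01 US.
have [UV _ U0 U1] := US.
have m11 : -1 <= s * m <= 1 by case: s1 => ->; rewrite ?mul1r ?mulN1r; lra.
have nsm : `|s * m| = m by case: s1 => ->; rewrite ?mul1r ?mulN1r ?normrN gtr0_norm.
apply: (@scheme_error R xs sigma g G (fun x => psi x (s * m)) (Sh xs sigma (s * m) (Ph xs G)) s m h sm sM
  (L * h `^ eta + 2 * sM ^+ 2 * Gam * h / m) (4 * sM * Gam) (kap * E) (2 * sM * Gam / m)) => //.
- by move=> j jM; apply: sigma_bnd; exact: mid01.
- move=> j jM.
  have /andP[j0 _] := part_range xs01 (ltnW jM); have /andP[_ j1] := part_range xs01 jM.
  have jlt := part_lt xs01 jM; have jmid := part_mid xs01 jM; have hj := h_cell jM.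
  have gap c : c \in cs -> ~~ (X j < c < X j.+1).
    by move=> /cs_xs/part_mem[i iM ->]; exact: (part_gap xs01).
  have hmono (c : R) : c <= (X j.+1 - X j) *
       (L * (X j.+1 - X j) `^ eta + 2 * sM ^+ 2 * Gam * (X j.+1 - X j) / m) ->
     c <= (X j.+1 - X j) * (L * h `^ eta + 2 * sM ^+ 2 * Gam * h / m).
    have hj0 : 0 <= X j.+1 - X j by rewrite subr_ge0 ltW.
    move=> H; apply: (le_trans H); rewrite ler_wpM2l//; apply: lerD.
      rewrite ler_wpM2l//; apply: ge0_ler_powR; rewrite ?nnegrE// ?(ltW h0)//.
      by case/andP: eta01 => /ltW.
    rewrite ler_wpM2r ?invr_ge0 ?(ltW m0)// ler_wpM2l// mulr_ge0 ?mulr_ge0 ?exprn_ge0 ?(ltW sM0)//.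
  case: s1 => ->.
    rewrite !mul1r.
    have [||||c1 c2] := streams_cell sm0 sigma_bnd L0 g_bnd eta01 data_hoelder mk
      (streams_forward Hts mk) (inflow_left Hts mk) (a := X j) (b := X j.+1) (z := mid xs j) => //.
      by rewrite j0.
    by split=> //; exact: hmono.
  rewrite !mulN1r.
  have [||||] := streams_cell sm0 (sigma_bnd_refl sigma_bnd) L0 (g_bnd_refl g_bnd) eta01 data_hoelder_refl mk
      (streams_backward Hts mk) (inflow_right Hts mk) (a := 1 - X j.+1) (b := 1 - X j) (z := 1 - mid xs j).
  + by apply/andP; split; lra.
  + by lra.
  + move=> c; rewrite refl_mem => /gap; apply: contra => /andP[a b].
    by apply/andP; split; lra.
  + by case/andP: jmid => a b; apply/andP; split; lra.
  rewrite /= !subKr (_ : 1 - X j - (1 - X j.+1) = X j.+1 - X j); last by ring.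
  set c := `|_|; set c' := `|_|.
  have -> : c = c' by congr (Num.norm _); ring.
  by move=> c1 c2; split=> //; exact: hmono.
- move=> s1'; rewrite U0 s1' ?mul1r//; exact: (inflow_left Hts).
- move=> s1'; rewrite U1 s1' ?mulN1r ?oppr_lt0//; have := inflow_right Hts mk; by rewrite subr0.
- move=> a b ab b1.
  by have := psi_lipschitz Hts sm0 sigma_bnd g_bnd ab b1 m11 sm_n0; rewrite nsm.
- move=> j jM; rewrite /= (_ : _ - _ = sigmaS (mid xs j) * (phi (mid xs j) - Phi (mid xs j))); last by ring.
  have /andP[S0 S1] := sigmaS_bnd (mid01 xs01 jM).
  rewrite normrM (ger0_norm S0) mulrA (mulrC (sigma _)); apply: ler_pM => //.
  exact: HE.
- rewrite addr_ge0 ?mulr_ge0 ?powR_ge0 ?exprn_ge0 ?invr_ge0 ?(ltW sM0) ?(ltW h0) ?(ltW m0)//.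
- by rewrite !mulr_ge0 ?(ltW sM0).
- by rewrite mulr_ge0.
- by rewrite divr_ge0 ?mulr_ge0 ?(ltW sM0) ?(ltW m0).
Qed.

Definition consistency : R := L * h `^ eta / sm +
  2 * h * (1 + ln N.+1%:R) * (2 * sM ^+ 2 * Gam / sm + 4 * sM * Gam) +
  18 / N.+1%:R * (2 * Gam + 2 * layers_max).

(** Two errors add up: that of the rule applied to the exact angular flux, and that of the box
    scheme in each direction, whose source is wrong by at most [kap * E] relative to [sigma]. Only
    midpoints enter into [E], as [Ph] samples the source there. *)
Lemma flux_error_step (E : R) (x : R) :
  (forall j, (j < M)%N -> `|phi (mid xs j) - Phi (mid xs j)| <= E) -> 0 <= E -> 0 <= x <= 1 ->
  `|phi x - Phi x| <= consistency + kap * E * (1 + h * sM * (1 + ln N.+1%:R)).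
Proof.
move=> HE E0 x01; have xu : x \in unit_itv by rewrite inE /unit_itv /= in_itv.
have [_ PhiE] := HPhi; rewrite (PhiE x xu) /Kh.
pose T := \sum_(k < N.+1) w k * (psi x (mu k) + psi x (- mu k)).
set T' := \sum_(k < N.+1) _.
have TT : `|T - T'| <= 2 * \sum_(k < N.+1) w k * direction_bound (kap * E) (mu k).
  rewrite /T /T' -sumrB mulr_sumr; apply: (le_trans (ler_norm_sum _ _ _)); apply: ler_sum => k _.
  have w0 := gauss_weight_ge0 gauss k.
  rewrite -mulrBr normrM (ger0_norm w0) mulrCA ler_wpM2l//.
  have e1 := direction_error (s := 1) k HE E0 (or_introl erefl) x01.
  have e2 := direction_error (s := -1) k HE E0 (or_intror erefl) x01.
  rewrite mul1r in e1; rewrite mulN1r in e2.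
  rewrite opprD addrACA mulr_natl mulr2n.
  by apply: (le_trans (ler_normD _ _)); exact: lerD.
have -> : phi x - 2^-1 * T' = (phi x - 2^-1 * T) + 2^-1 * (T - T') by ring.
have half : 0 <= (2^-1 : R) by rewrite invr_ge0.
apply: (le_trans (ler_normD _ _)); rewrite distrC normrM (ger0_norm half).
have A := angular_error x01; rewrite -/T in A.
have {}TT := ler_wpM2l half TT; rewrite mulKf ?pnatr_eq0// in TT.
apply: (le_trans (lerD A TT)).
set y := kap * E.
(* The part of [direction_bound] that is constant in the direction, and the coefficient of 1 / m. *)
pose P0 := L * h `^ eta / sm + y; pose P1 := h * (2 * sM ^+ 2 * Gam / sm + 4 * sM * Gam + y * sM / 2).
have -> : \sum_(k < N.+1) w k * direction_bound y (mu k) =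
    P0 * \sum_(k < N.+1) w k + P1 * \sum_(k < N.+1) w k / mu k.
  rewrite !mulr_sumr -big_split; apply: eq_bigr => k _ /=.
  rewrite /direction_bound /P0 /P1; field.
  by have /andP[m0 _] := node01 k; rewrite !gt_eqF.
rewrite (gauss_sum1 gauss) (gauss_sum_inv gauss) mulr1.
have P10 : 0 <= P1.
  have y0 : 0 <= y by rewrite mulr_ge0.
  apply: mulr_ge0; first exact: ltW.
  by rewrite !addr_ge0// ?mulr_ge0 ?invr_ge0 ?exprn_ge0 ?(ltW sM0) ?(ltW sm0).
have Hn := @harmonic_le_ln R N.
have H2 : P1 * (2 * \sum_(i < N.+1) i.+1%:R^-1) <= P1 * (2 * (1 + ln N.+1%:R)).
  by rewrite ler_wpM2l// ler_wpM2l.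
apply: (le_trans (lerD (lexx _) (lerD (lexx _) H2))).
rewrite /consistency /P0 /P1 le_eqVlt; apply/orP; left; apply/eqP; field.
by rewrite nat1r pnatr_eq0 (gt_eqF sm0).
Qed.

(* The error at the midpoints feeds back into itself with a factor below 1. *)
Lemma flux_error (th : R) (x : R) :
  kap * (1 + h * sM * (1 + ln N.+1%:R)) <= 1 - th -> 0 < th -> 0 <= x <= 1 ->
  `|phi x - Phi x| <= consistency / th.
Proof.
move=> Hth th0 x01.
pose E := \big[Num.max/0]_(j < M) `|phi (mid xs j) - Phi (mid xs j)|.
have HE j : (j < M)%N -> `|phi (mid xs j) - Phi (mid xs j)| <= E.
  move=> jM; exact: (@le_bigmax _ _ _ 0 (fun j : 'I_M => `|phi (mid xs j) - Phi (mid xs j)|) (Ordinal jM)).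
have E0 : 0 <= E by exact: bigmax_ge_id.
have C (z : R) : 0 <= z <= 1 -> `|phi z - Phi z| <= consistency + (1 - th) * E.
  move=> z01; apply: (le_trans (flux_error_step HE E0 z01)).
  by rewrite lerD2l mulrAC ler_wpM2r.
have c0 : 0 <= consistency + (1 - th) * E by apply: le_trans (C x x01).
have EC : E <= consistency + (1 - th) * E.
  apply: bigmax_le => // j _; apply: C.
  by have /andP[/ltW-> /ltW->] := mid01 xs01 (ltn_ord j).
have E1 : E <= consistency / th by rewrite ler_pdivlMr//; lra.
have ln0 : 0 <= ln N.+1%:R :> R by rewrite ln_ge0// ler1n.
have th1 : 0 <= 1 - th.
  by apply: le_trans Hth; rewrite mulr_ge0// addr_ge0// mulr_ge0 ?addr_ge0// mulr_ge0// ltW.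
apply: (le_trans (C x x01)); apply: (@le_trans _ _ (consistency + (1 - th) * (consistency / th))).
  by rewrite lerD2l ler_wpM2l.
rewrite le_eqVlt; apply/orP; left; apply/eqP; field.
by rewrite gt_eqF.
Qed.

End discretized.
End flux_error.

(** * Data norms and the stability condition *)

Section norms.
Context {R : realType}.
Implicit Types (D : set R) (g : R -> R).

Lemma supnorm_ge D g (x : R) : D x -> (`|g x|%:E <= supnorm D g)%E.
Proof. by move=> Dx; apply: ereal_sup_ubound; exists x. Qed.

Lemma supnorm_le D g (b : \bar R) : (forall x, D x -> (`|g x|%:E <= b)%E) -> (supnorm D g <= b)%E.
Proof. by move=> H; apply: ge_ereal_sup => _ [x Dx <-]; exact: H. Qed.

Variables (eta : R) (cs : seq R).
Hypothesis cs01 : itv_partition 0 1 cs.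
Local Notation X j := ((0 :: cs)`_j).

Lemma cell_hoelder_norm g (j : nat) : (j < size cs)%N ->
  (forall x, cell cs j x -> (`|g x|%:E <= hoelder_norm eta (cell cs j) g)%E) /\
  (forall x y, cell cs j x -> cell cs j y -> x != y ->
    ((`|g x - g y| / `|x - y| `^ eta)%:E <= hoelder_norm eta (cell cs j) g)%E).
Proof.
move=> jM; have jlt := part_lt cs01 jM.
set D := cell cs j.
pose q x y := (`|g x - g y| / `|x - y| `^ eta)%:E.
pose Q := ereal_sup [set r | exists x y, [/\ D x, D y, x != y & r = q x y]].
have QP x y : D x -> D y -> x != y -> (q x y <= Q)%E.
  by move=> Dx Dy xy; apply: ereal_sup_ubound; exists x, y.
(* A supremum over an empty set would be -oo. The points at 1/2 and 1/4 of the cell show that both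
   suprema in the norm are nonnegative, so that each is bounded by their sum. *)
have inD (t : R) : 0 < t < 1 -> D (X j + t * (X j.+1 - X j)).
  move=> /andP[t0 t1]; rewrite /D /cell /= in_itv /=.
  have d0 : 0 < X j.+1 - X j by rewrite subr_gt0.
  have := mulr_gt0 t0 d0; have : t * (X j.+1 - X j) < 1 * (X j.+1 - X j) by rewrite ltr_pM2r.
  by move: (t * _) => z; rewrite mul1r => z1 z2; apply/andP; split; lra.
have h2 : 0 < (2^-1 : R) < 1 by apply/andP; split; lra.
have h3 : 0 < (4^-1 : R) < 1 by apply/andP; split; lra.
have Q0 : (0 <= Q)%E.
  apply: le_trans (QP _ _ (inD _ h2) (inD _ h3) _).
    by rewrite lee_fin divr_ge0// powR_ge0.
  rewrite (inj_eq (addrI _)); apply/negP => /eqP /mulIf H.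
  have : (2^-1 : R) = 4^-1 by apply: H; rewrite subr_eq0 gt_eqF.
  by lra.
have S0 : (0 <= supnorm D g)%E by apply: le_trans (supnorm_ge g (inD _ h2)); rewrite lee_fin.
split=> [x Dx|x y Dx Dy xy].
  by apply: (le_trans (supnorm_ge g Dx)); rewrite /hoelder_norm -/D -/Q leeDl.
by apply: (le_trans (QP x y Dx Dy xy)); rewrite /hoelder_norm -/D -/Q leeDr.
Qed.

Lemma pw_norm_ge0 g : (0 <= pw_norm eta cs g)%E.
Proof. exact: bigmax_ge_id. Qed.

Lemma pw_norm_cell g (j : nat) : (j < size cs)%N ->
  (hoelder_norm eta (cell cs j) g <= pw_norm eta cs g)%E.
Proof.
move=> jM; exact: (@le_bigmax _ _ _ 0%E (fun j : 'I_(size cs) => hoelder_norm eta (cell cs j) g) (Ordinal jM)).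
Qed.

Section finite_norm.
Variable g : R -> R.
Hypothesis gC : Cpw eta cs g.
Let S := fine (pw_norm eta cs g).

Lemma pw_normE : pw_norm eta cs g = S%:E.
Proof. by rewrite fineK// ge0_fin_numE ?pw_norm_ge0//; case: gC. Qed.

Lemma fine_pw_norm_ge0 : 0 <= S.
Proof. by rewrite fine_ge0// pw_norm_ge0. Qed.

Lemma cell_bound (j : nat) (x : R) : (j < size cs)%N -> X j < x < X j.+1 -> `|g x| <= S.
Proof.
move=> jM xj; rewrite -lee_fin -pw_normE; apply: le_trans (pw_norm_cell g jM).
by apply: (cell_hoelder_norm g jM).1; rewrite /cell /= in_itv.
Qed.

Lemma cell_hoelder (j : nat) (x y : R) : (j < size cs)%N -> X j < x < X j.+1 -> X j < y < X j.+1 ->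
  `|g x - g y| <= S * `|x - y| `^ eta.
Proof.
move=> jM xj yj; have [->|xy] := eqVneq x y.
  by rewrite !subrr normr0 mulr_ge0 ?powR_ge0 ?fine_pw_norm_ge0.
rewrite -ler_pdivrMr ?powR_gt0 ?normr_gt0 ?subr_eq0// -lee_fin -pw_normE.
apply: le_trans (pw_norm_cell g jM).
by apply: (cell_hoelder_norm g jM).2 => //; rewrite /cell /= in_itv.
Qed.

(** At a point of the partition the value is the one-sided limit prescribed by [Cpw], which inherits
    the bound from the adjacent cell. *)
Lemma Cpw_bound (x : R) : 0 <= x <= 1 -> `|g x| <= S.
Proof.
have [_ gr gl] := gC.
move=> /andP[x0]; rewrite le_eqVlt => /predU1P[->|x1]; last first.
  have [j jM /andP[jx xj]] : exists2 j, (j < size cs)%N & X j <= x < X j.+1.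
    by apply: part_find; rewrite ?x0.
  move: jx; rewrite le_eqVlt => /predU1P[<-|jx]; last by apply: (cell_bound jM); rewrite jx.
  have H := @cvg_norm _ _ _ _ (@at_right_proper_filter R (X j)) _ _ (gr j jM).
  apply: (@cvgr_to_le _ _ _ _ _ _ _ H).
  near=> z; apply: (cell_bound jM); apply/andP; split; near: z.
    exact: nbhs_right_gt.
  by apply: nbhs_right_lt; exact: part_lt.
have M0 := part_size cs01; have M1 : ((size cs).-1 < size cs)%N by rewrite prednK.
have e1 : X (size cs).-1.+1 = 1 by rewrite prednK// part_last.
have H := @cvg_norm _ _ _ _ (@at_left_proper_filter R 1) _ _ gl.
apply: (@cvgr_to_le _ _ _ _ _ _ _ H).
near=> z; apply: (cell_bound M1); rewrite e1; apply/andP; split; near: z.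
  by apply: nbhs_left_gt; rewrite -e1; exact: part_lt.
exact: nbhs_left_lt.
Unshelve. all: by end_near. Qed.

(** The absence of partition points between [x] and [y], ends included, puts both into one open
    cell. *)
Lemma Cpw_hoelder (x y : R) : 0 < x <= y -> y < 1 ->
  (forall c, c \in cs -> ~~ (x <= c <= y)) -> `|g x - g y| <= S * (y - x) `^ eta.
Proof.
move=> /andP[x0 xy] y1 gap.
have [j jM /andP[jx xj]] : exists2 j, (j < size cs)%N & X j <= x < X j.+1.
  by apply: part_find => //; rewrite (ltW x0) (le_lt_trans xy).
have jx' : X j < x.
  move: jx; rewrite le_eqVlt => /predU1P[jx|//]; case: j jM jx xj => [|j] jM jx xj.
    by move: x0; rewrite -jx ltxx.
  have /gap : X j.+1 \in cs by rewrite /= mem_nth// ltnW.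
  by rewrite jx lexx xy.
have yj : y < X j.+1.
  rewrite ltNge; apply/negP => yj; have /gap : X j.+1 \in cs by rewrite /= mem_nth.
  by rewrite (ltW xj) yj.
have -> : y - x = `|x - y| by rewrite distrC ger0_norm// subr_ge0.
by apply: (cell_hoelder jM); rewrite ?jx' ?xj ?yj ?(lt_le_trans jx' xy).
Qed.

Lemma le_fmax (x : R) : 0 <= x <= 1 -> g x <= fmax g.
Proof.
move=> x01; apply: ub_le_sup; last by exists x => //; rewrite /unit_itv /= in_itv.
exists S => _ [z zu <-]; apply: le_trans (ler_norm _) _; apply: Cpw_bound.
by move: zu; rewrite /unit_itv /= in_itv.
Qed.

Lemma fmax_le : fmax g <= S.
Proof.
apply: sup_le_ub; first by exists (g 0); exists 0 => //; rewrite /unit_itv /= in_itv /= lexx ler01.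
move=> _ [z zu <-]; apply: le_trans (ler_norm _) _; apply: Cpw_bound.
by move: zu; rewrite /unit_itv /= in_itv.
Qed.

End finite_norm.

(** The [inf] of a set without lower bound is 0 by default, so [0 < fmin g] also says that [g] is
    bounded below. *)
Lemma fmin_le g (x : R) : 0 < fmin g -> 0 <= x <= 1 -> fmin g <= g x.
Proof.
move=> g0 x01; apply: ge_inf; last by exists x => //; rewrite /unit_itv /= in_itv.
apply: contrapT => H; move: g0; rewrite /fmin inf_out ?ltxx// => -[_]; exact.
Qed.

Lemma le_fmin g (b : R) : (forall x : R, 0 <= x <= 1 -> b <= g x) -> b <= fmin g.
Proof.
move=> H; apply: lb_le_inf.
  by exists (g 0); exists 0 => //; rewrite /unit_itv /= in_itv /= lexx ler01.
by move=> _ [z zu <-]; apply: H; move: zu; rewrite /unit_itv /= in_itv.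
Qed.

Section admissible_data.
Variables (sigma sigmaS : R -> R).
Hypothesis adm : admissible eta cs sigma sigmaS.

Let sm := fmin sigma.
Let sM := fmax sigma.
Let aA := fmin (sigma \- sigmaS).

Definition scattering_ratio : R := fine (supnorm unit_itv (fun x => sigmaS x / sigma x)).

Lemma adm_sigma (x : R) : 0 <= x <= 1 -> 0 < sm <= sigma x /\ sigma x <= sM.
Proof.
by have [h1 h2 h3 h4 h5] := adm; move=> x01; rewrite h3 fmin_le// le_fmax.
Qed.

Lemma adm_sigmaS (x : R) : 0 <= x <= 1 -> 0 < fmin sigmaS <= sigmaS x /\ sigmaS x <= fmax sigmaS.
Proof.
by have [h1 h2 h3 h4 h5] := adm; move=> x01; rewrite h4 fmin_le// le_fmax.
Qed.

Lemma adm_sigmaA (x : R) : 0 <= x <= 1 -> 0 < aA <= sigma x - sigmaS x.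
Proof.
by have [h1 h2 h3 h4 h5] := adm; move=> x01; rewrite h5 (fmin_le h5).
Qed.

Let half01 : 0 <= (2^-1 : R) <= 1.
Proof. by apply/andP; split; lra. Qed.

Lemma adm_sM_gt0 : 0 < sM.
Proof. by have [/andP[a b] c] := adm_sigma half01; exact: lt_le_trans a (le_trans b c). Qed.

Lemma fmin_sigmaS_le : fmin sigmaS <= sm.
Proof.
apply: le_fmin => x x01; have [/andP[_ a] _] := adm_sigmaS x01.
by have /andP[b c] := adm_sigmaA x01; lra.
Qed.

(** The quantitative gap comes from writing [sigmaS / sigma] as 1 minus [(sigma - sigmaS) / sigma],
    where the latter is at least [aA / sM]. *)
Lemma scattering_ratioP : [/\ 0 <= scattering_ratio, aA / sM <= 1 - scattering_ratio, 0 < 1 - scattering_ratio &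
  forall x : R, 0 <= x <= 1 -> 0 <= sigmaS x <= scattering_ratio * sigma x].
Proof.
have sM0 := adm_sM_gt0.
have q_le (x : R) : 0 <= x <= 1 -> `|sigmaS x / sigma x| <= 1 - aA / sM.
  move=> x01; have [/andP[a b] c] := adm_sigma x01; have [/andP[d e] _] := adm_sigmaS x01.
  have /andP[k1 k2] := adm_sigmaA x01; have sx : 0 < sigma x := lt_le_trans a b.
  rewrite ger0_norm; last by rewrite divr_ge0// ltW// (lt_le_trans d).
  have -> : sigmaS x / sigma x = 1 - (sigma x - sigmaS x) / sigma x by field; rewrite gt_eqF.
  rewrite lerB//; apply: ler_pM; rewrite ?invr_ge0 ?(ltW k1) ?(ltW sM0)//.
  by rewrite lef_pV2 ?posrE.
have hu (x : R) : 0 <= x <= 1 -> unit_itv x by move=> x01; rewrite /unit_itv /= in_itv.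
have sup_le : (supnorm unit_itv (fun x => (sigmaS x / sigma x)%R) <= (1 - aA / sM)%:E)%E.
  apply: supnorm_le => x; rewrite /unit_itv /= in_itv /= => x01.
  by rewrite lee_fin q_le.
have sup_ge (x : R) (x01 : 0 <= x <= 1) := supnorm_ge (fun x => sigmaS x / sigma x) (hu x x01).
have sup0 : (0 <= supnorm unit_itv (fun x => (sigmaS x / sigma x)%R))%E.
  by apply: le_trans (sup_ge _ half01); rewrite lee_fin.
have supE : supnorm unit_itv (fun x => sigmaS x / sigma x) = scattering_ratio%:E.
  by rewrite fineK// ge0_fin_numE// (le_lt_trans sup_le)// ltry.
have r0 : 0 <= scattering_ratio by rewrite -lee_fin -supE.
have r1 : aA / sM <= 1 - scattering_ratio.
  by move: sup_le; rewrite supE lee_fin; lra.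
have aA0 : 0 < aA by have /andP[] := adm_sigmaA half01.
split=> //; first by apply: lt_le_trans r1; rewrite divr_gt0.
move=> x x01; have [/andP[a b] c] := adm_sigma x01; have [/andP[d e] _] := adm_sigmaS x01.
have sx : 0 < sigma x := lt_le_trans a b.
rewrite (ltW (lt_le_trans d e)) /= -ler_pdivrMr// -lee_fin -supE.
by apply: le_trans (sup_ge x x01); rewrite lee_fin ler_norm.
Qed.

(** Every factor of [R3] that is left out is at least 1; of the cube, one factor [Num.max 1 sM] is
    kept. *)
Lemma R3_ge (K : R) : 1 <= K ->
  2 * Num.max 1 sM / (1 - scattering_ratio) <= R3 eta cs K sigma sigmaS.
Proof.
move=> K1; have [r0 r1 r2 _] := scattering_ratioP; have sM0 := adm_sM_gt0.
have [/andP[sm0 smx] smM] := adm_sigma half01; have [/andP[S0 Sx] SM] := adm_sigmaS half01.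
rewrite /R3 /R1 -/sM -/sm -/scattering_ratio.
set P := Num.max 1 sM; have P1 : 1 <= P by rewrite le_max lexx.
have P0 : 0 < P := lt_le_trans ltr01 P1.
set m := Num.min sm 1; have m0 : 0 < m by rewrite lt_min sm0 ltr01.
have m1 : m <= 1 by rewrite ge_min lexx orbT.
have q1 : 1 <= fmax sigmaS / fmin sigmaS by rewrite ler_pdivlMr// mul1r (le_trans Sx).
have q2 : P <= (P / m) ^+ 3.
  have Pm : P <= P / m by rewrite ler_pdivlMr// ler_piMr// ltW.
  apply: (le_trans Pm); rewrite -[leLHS]expr1 ler_weXn2l//.
  exact: le_trans P1 Pm.
have q3 : 1 <= Num.max 1 (fine (pw_norm eta cs sigma)) by rewrite le_max lexx.
have q4 : 1 <= Num.sqrt P by rewrite -sqrtr1 ler_sqrt// ?(ltW P0).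
have q5 : 1 <= sM / sm by rewrite ler_pdivlMr// mul1r (le_trans smx).
have one_mul (a b : R) : 1 <= a -> 1 <= b -> 1 <= a * b.
  by move=> a1 b1; rewrite -(mulr1 1); apply: ler_pM.
have -> : K * (fmax sigmaS / fmin sigmaS) * (P / m) ^+ 3 * Num.max 1 (fine (pw_norm eta cs sigma)) *
   (2 * Num.sqrt P * (sM / sm) * (1 - scattering_ratio)^-1) =
   (K * (fmax sigmaS / fmin sigmaS) * Num.max 1 (fine (pw_norm eta cs sigma)) * (Num.sqrt P * (sM / sm))) *
   (2 * (P / m) ^+ 3 / (1 - scattering_ratio)) by ring.
have A1 : 1 <= K * (fmax sigmaS / fmin sigmaS) * Num.max 1 (fine (pw_norm eta cs sigma)) * (Num.sqrt P * (sM / sm)).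
  by apply: (one_mul); [apply: (one_mul); [apply: (one_mul)|]|apply: (one_mul)].
have B0 : 2 * P / (1 - scattering_ratio) <= 2 * (P / m) ^+ 3 / (1 - scattering_ratio).
  by rewrite ler_wpM2r ?invr_ge0 ?(ltW r2)// ler_wpM2l.
apply: (le_trans B0); rewrite ler_peMl//.
by apply: le_trans B0; rewrite divr_ge0 ?mulr_ge0 ?(ltW P0) ?(ltW r2).
Qed.

End admissible_data.
End norms.

(** * The order N(h), and what stability at one width says about smaller ones *)

Section quadrature_order.
Context {R : realType}.
Variables (eta c0 : R).
Hypotheses (eta01 : 0 < eta < 1) (c01 : 1 < c0).
Local Notation N h := (N_of eta c0 h).

Let c00 : 0 < c0. Proof. exact: lt_trans ltr01 c01. Qed.

Lemma N_of_itv (h : R) : 0 < h -> c0 * h `^ (- eta) <= (N h)%:R < c0 * h `^ (- eta) + 1.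
Proof.
move=> h0; have p0 : 0 < c0 * h `^ (- eta) by rewrite mulr_gt0// powR_gt0.
rewrite /N_of natr_absz ger0_norm; last by rewrite ltW// ceil_gt0.
by rewrite ceil_ge /= -ltrBlDr -[X in _ - X]/(1%:~R) -intrB ceilB1_lt.
Qed.

Lemma N_of_ge1 (h : R) : 0 < h <= 1 -> 1 <= (N h)%:R :> R.
Proof.
move=> /andP[h0 h1]; have /andP[+ _] := N_of_itv h0; apply: le_trans.
have : 1 <= h `^ (- eta).
  rewrite powRN -invr1 lef_pV2 ?posrE ?powR_gt0// -[leRHS](powRr0 h) ger_powR ?h0//.
  by case/andP: eta01 => /ltW.
by move=> k; rewrite -(mulr1 1) ler_pM// ltW.
Qed.

Lemma ln_N_of_le (h : R) : 0 < h -> ln (N h)%:R <= ln c0 - eta * ln h + h `^ eta / c0.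
Proof.
move=> h0; have /andP[a b] := N_of_itv h0.
have p0 : 0 < h `^ (- eta) by exact: powR_gt0.
have q0 : 0 < h `^ eta by exact: powR_gt0.
have E : c0 * h `^ (- eta) + 1 = c0 * (h `^ (- eta) * (1 + h `^ eta / c0)).
  by rewrite powRN; field; rewrite !gt_eqF.
have d0 : 0 < h `^ eta / c0 by rewrite divr_gt0.
have e0 : 0 < 1 + h `^ eta / c0 by rewrite addr_gt0.
have n0 : 0 < (N h)%:R :> R by apply: lt_le_trans a; rewrite mulr_gt0.
apply: (@le_trans _ _ (ln (c0 * h `^ (- eta) + 1))).
  by rewrite ler_ln ?posrE ?(ltW b)// addr_gt0// mulr_gt0.
rewrite E lnM ?posrE//; last by rewrite mulr_gt0.
rewrite lnM ?posrE// ln_powR mulNr addrA lerD2l.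
by apply: le_ln1Dx; apply: lt_trans d0; rewrite ltrN10.
Qed.

Lemma ln_N_of_ge (h : R) : 0 < h -> ln c0 - eta * ln h <= ln (N h)%:R.
Proof.
move=> h0; have /andP[a b] := N_of_itv h0.
have p0 : 0 < h `^ (- eta) by exact: powR_gt0.
have n0 : 0 < (N h)%:R :> R by apply: lt_le_trans a; rewrite mulr_gt0.
rewrite -mulNr -ln_powR -lnM ?posrE// ler_ln ?posrE//.
by rewrite mulr_gt0.
Qed.

Let le_powR (h : R) : 0 < h <= 1 -> h <= h `^ eta.
Proof.
move=> /andP[h0 h1]; rewrite -[leLHS](powRr1 (ltW h0)) ger_powR ?h0//.
by case/andP: eta01 => _ /ltW.
Qed.

(** This transfers the stability condition from [H] to a smaller width. ln N(h) exceeds ln N(H) by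
    about [eta * (ln H - ln h)], and [h * (ln H - ln h) <= H - h], so the product with [h] hardly
    grows as [h] decreases; the factor [1 + H / c0] accounts for the rounding in [N_of]. *)
Lemma width_ln_mono (h H : R) : 0 < h <= H -> H <= 1 ->
  h * (1 + ln (N h)%:R) <= (1 + H / c0) * (H `^ eta + H * ln (N H)%:R + (N H)%:R^-1).
Proof.
move=> /andP[h0 hH] H1; have H0 : 0 < H := lt_le_trans h0 hH.
have /andP[e0 e1] := eta01.
have a := ln_N_of_le h0; have b := ln_N_of_ge H0.
have lnm : 0 <= ln (N H)%:R :> R by rewrite ln_ge0// N_of_ge1// H0.
have c1 : h * (ln H - ln h) <= H - h.
  have := ln_le_subr1 (divr_gt0 H0 h0); rewrite ln_div ?posrE// => k.
  have := ler_wpM2l (ltW h0) k; by rewrite [X in _ <= X -> _]mulrBr mulr1 (mulrC h (H / h)) divfK// gt_eqF.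
have c2 : 0 <= ln H - ln h by rewrite subr_ge0 ler_ln.
have c3 : h * (eta * (ln H - ln h)) <= h * (ln H - ln h).
  by rewrite ler_wpM2l ?(ltW h0)// ler_piMl// ltW.
have p : h `^ eta <= H `^ eta by apply: ge0_ler_powR; rewrite ?nnegrE ?(ltW e0) ?(ltW h0) ?(ltW H0).
have c4 : h * (h `^ eta / c0) <= H * (H `^ eta / c0).
  apply: ler_pM; rewrite ?(ltW h0) ?divr_ge0 ?powR_ge0 ?(ltW c00)//.
  by rewrite ler_wpM2r// invr_ge0 ltW.
have c5 : h * ln (N H)%:R <= H * ln (N H)%:R by rewrite ler_wpM2r.
have c6 := le_powR (h := H); rewrite H0 H1 in c6; have {}c6 := c6 isT.
have c7 : h * ln (N h)%:R <= h * ln (N H)%:R + h * (eta * (ln H - ln h)) + h * (h `^ eta / c0).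
  by rewrite -!mulrDr ler_wpM2l ?(ltW h0)//; lra.
have c8 : 0 <= H / c0 * (H * ln (N H)%:R + (N H)%:R^-1).
  by rewrite mulr_ge0 ?divr_ge0 ?addr_ge0 ?mulr_ge0 ?invr_ge0 ?(ltW H0) ?(ltW c00).
have c9 : 0 <= (N H)%:R^-1 :> R by rewrite invr_ge0.
have -> : (1 + H / c0) * (H `^ eta + H * ln (N H)%:R + (N H)%:R^-1) =
   H `^ eta + H * (H `^ eta / c0) + H * ln (N H)%:R + (N H)%:R^-1 + H / c0 * (H * ln (N H)%:R + (N H)%:R^-1) by ring.
move: c7; rewrite [h * (1 + _)]mulrDr mulr1; move: c3 c1.
set u1 := h * (eta * _); set u2 := h * (ln H - _); set u3 := h * ln (N H)%:R in c5 *.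
set u4 := h * (_ / _) in c4 *; set u5 := H * ln _ in c5 c8 *; set u6 := H * (_ / _) in c4 *.
set u7 := H / c0 * _ in c8 *.
lra.
Qed.

Definition rate_const : R := 2 + ln c0 + (1 - eta)^-1.

Lemma rate_const_ge0 : 0 <= rate_const.
Proof.
have /andP[e0 e1] := eta01.
by rewrite /rate_const !addr_ge0// ?ln_ge0 ?(ltW c01)// invr_ge0 subr_ge0 ltW.
Qed.

Lemma width_ln_rate (h : R) : 0 < h <= 1 -> h * (1 + ln (N h)%:R) <= rate_const * h `^ eta.
Proof.
move=> h01; have /andP[h0 h1] := h01; have /andP[e0 e1] := eta01.
have e1' : 0 < 1 - eta by rewrite subr_gt0.
have a : h * ln (N h)%:R <= h * ln c0 + eta * (h * - ln h) + h * (h `^ eta / c0).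
  have := ler_wpM2l (ltW h0) (ln_N_of_le h0); congr (_ <= _); ring.
have p0 : 0 < h `^ eta by exact: powR_gt0.
have hh := le_powR h01.
have te : h * h `^ (eta - 1) = h `^ eta by rewrite mulr_powRB1// ltW.
have lnh : (1 - eta) * - ln h <= h `^ (eta - 1) - 1.
  have := @ln_le_subr1 R (h `^ (eta - 1)) (powR_gt0 _ h0).
  by rewrite ln_powR; lra.
have b : h * - ln h <= h `^ eta / (1 - eta).
  rewrite ler_pdivlMr// -te.
  have := ler_wpM2l (ltW h0) lnh; have := h0; lra.
have b0 : 0 <= h * - ln h by rewrite mulr_ge0 ?(ltW h0)// oppr_ge0 ln_le0.
have c : eta * (h * - ln h) <= h * - ln h by rewrite ler_piMl// ltW.
have lc : 0 <= ln c0 by rewrite ln_ge0// ltW.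
have d : h * ln c0 <= h `^ eta * ln c0 by rewrite ler_wpM2r.
have e : h * (h `^ eta / c0) <= h `^ eta.
  have k1 : h `^ eta / c0 <= h `^ eta by rewrite ler_pdivrMr// ler_peMr ?(ltW p0)// ltW.
  by apply: le_trans k1; rewrite ler_piMl// divr_ge0 ?(ltW p0)// ltW.
rewrite /rate_const; have -> : (2 + ln c0 + (1 - eta)^-1) * h `^ eta =
  h `^ eta + h `^ eta + h `^ eta * ln c0 + h `^ eta / (1 - eta) by ring.
move: a; rewrite mulrDr mulr1.
set u1 := h * ln (N h)%:R; set u2 := h * ln c0 in d *; set u3 := eta * _ in c *.
set u4 := h * (_ / _) in e *; set u5 := h * - _ in b b0 c *; set u6 := _ / _ in b *; set u7 := _ * ln c0 in d *.
lra.
Qed.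

Lemma inv_N_of_le (h : R) : 0 < h -> (N h)%:R^-1 <= h `^ eta.
Proof.
move=> h0; have /andP[a _] := N_of_itv h0.
have p0 : 0 < h `^ (- eta) by exact: powR_gt0.
rewrite -[leRHS]invrK -powRN lef_pV2 ?posrE//; last by apply: lt_le_trans a; rewrite mulr_gt0.
by apply: le_trans a; rewrite ler_peMl ?(ltW p0)// ltW.
Qed.

Variable cs : seq R.
Hypothesis cs01 : itv_partition 0 1 cs.
Variables (sigma sigmaS : R -> R) (K H : R).
Hypotheses (adm : admissible eta cs sigma sigmaS) (K1 : 1 <= K) (H0 : 0 < H).
Hypothesis stable : stability_condition eta cs K sigma sigmaS H (N H).
Local Notation kap := (scattering_ratio sigma sigmaS).

(** The second part is the stability condition with [R3] replaced by the lower bound [R3_ge]. It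
    makes H^eta at most 1/2; then H <= 1, so H <= H^eta <= 1/2. *)
Lemma stable_width_gap : H <= 2^-1 /\
  2 * Num.max 1 (fmax sigma) * (H `^ eta + H * ln (N H)%:R + (N H)%:R^-1) <= 1 - kap.
Proof.
have [r0 r1 r2 _] := scattering_ratioP cs01 adm.
have := le_trans (R3_ge cs01 adm K1) stable.
set P := Num.max 1 _; have P1 : 1 <= P by rewrite le_max lexx.
set G := H `^ eta + _ + _.
have p0 : 0 < H `^ eta by exact: powR_gt0.
have lnN : 0 <= ln (N H)%:R :> R.
  have [n0|n1] := ltnP (N H) 1.
    by move: n0; rewrite ltnS leqn0 => /eqP ->; rewrite ln0.
  by rewrite ln_ge0// ler1n.
have pG : H `^ eta <= G.
  by rewrite /G -addrA lerDl addr_ge0 ?mulr_ge0 ?(ltW H0) ?invr_ge0.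
have G0 : 0 < G := lt_le_trans p0 pG.
rewrite ler_pdivrMr// => E0.
have E : 2 * P * G <= 1 - kap by rewrite -ler_pdivlMr// [leRHS]mulrC.
split=> //.
have h2 : H `^ eta <= 2^-1.
  have k1 : G <= P * G by rewrite ler_peMl// ltW.
  have k2 : 2 * (P * G) <= 1 by rewrite mulrA; lra.
  by lra.
have H1 : H <= 1.
  rewrite leNgt; apply/negP => H1; have : 1 <= H `^ eta.
    have e0 : 0 <= eta by case/andP: eta01 => /ltW.
    have := ge0_ler_powR e0 (_ : 1 \in Num.nneg) (_ : H \in Num.nneg) (ltW H1).
    by rewrite powR1 !nnegrE ler01 (ltW H0); apply.
  by lra.
by apply: le_trans h2; apply: le_powR; rewrite H0.
Qed.

(** As [H / c0 <= 2^-1], the two preceding estimates give h sM (1 + ln N) <= 3/4 (1 - kap); since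
    kap <= 1, at most three quarters of the gap are used up. *)
Lemma stable_contraction (h : R) : 0 < h <= H ->
  kap * (1 + h * fmax sigma * (1 + ln (N h)%:R)) <= 1 - (1 - kap) / 4.
Proof.
move=> hH; have /andP[h0 _] := hH; have [Hh gap] := stable_width_gap.
have [r0 r1 r2 _] := scattering_ratioP cs01 adm.
have sM0 := adm_sM_gt0 cs01 adm.
have H1 : H <= 1 by apply: le_trans Hh _; lra.
have A := width_ln_mono hH H1.
move: gap A; set P := Num.max 1 _; set G := H `^ eta + _ + _; set l := 1 + ln _ => gap A.
have P1 : 1 <= P by rewrite le_max lexx.
have PM : fmax sigma <= P by rewrite le_max lexx orbT.
have l1 : 0 <= l.
  by rewrite addr_ge0// ln_ge0// N_of_ge1// h0; case/andP: hH => _ /le_trans; apply.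
have hc : H / c0 <= 2^-1.
  by apply: le_trans Hh; rewrite ler_pdivrMr// ler_peMr ?(ltW H0)// ltW.
have G0 : 0 <= G.
  rewrite /G !addr_ge0 ?powR_ge0 ?invr_ge0// mulr_ge0 ?(ltW H0)//.
  by rewrite ln_ge0// N_of_ge1// H0.
have PG0 : 0 <= P * G by rewrite mulr_ge0// (le_trans ler01 P1).
have B : h * fmax sigma * l <= (3 / 4) * (1 - kap).
  have -> : h * fmax sigma * l = fmax sigma * (h * l) by ring.
  have b1 : fmax sigma * (h * l) <= P * (h * l) by rewrite ler_wpM2r// mulr_ge0// ltW.
  have b2 : P * (h * l) <= P * ((1 + H / c0) * G) by rewrite ler_wpM2l// (le_trans ler01).
  have b3 : P * ((1 + H / c0) * G) <= (1 + 2^-1) * (P * G).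
    by rewrite mulrCA ler_wpM2r// lerD2l.
  have b4 : 2 * (P * G) <= 1 - kap by rewrite mulrA.
  by lra.
have := ler_wpM2l r0 B; rewrite mulrDr mulr1.
have : kap * (3 / 4 * (1 - kap)) <= 3 / 4 * (1 - kap).
  by rewrite ler_piMl// ?mulr_ge0 ?(ltW r2)//; lra.
lra.
Qed.

End quadrature_order.

(** For [c0 <= 1] the order at width 1 would be at most 1 and its logarithm at most 0. *)
Lemma N_of_c0 (R : realType) (eta c0 : R) : 0 < c0 -> 1 <= ln ((N_of eta c0 1)%:R : R) -> 1 < c0.
Proof.
rewrite /N_of powR1 mulr1 => c00 ln1; rewrite ltNge; apply/negP => c01.
have : (`|Num.ceil c0| <= 1)%N.
  rewrite -(ler_nat R) natr_absz ger0_norm; last by rewrite ltW// ceil_gt0.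
  by rewrite -[leRHS]/(1%:~R) ler_int ceil_le_int.
by move=> k; have : ln (`|Num.ceil c0|%N%:R : R) <= 0; [apply: ln_le0; rewrite lern1|lra].
Qed.

(** * The pathwise estimate and its dependence on the data *)

Section pathwise.
Context {R : realType}.
Variables (eta c0 : R) (cs : seq R).
Hypotheses (eta01 : 0 < eta < 1) (c01 : 1 < c0).
Hypothesis cs01 : itv_partition 0 1 cs.

(** A single majorant, at least 1, of all the data quantities involved, so that their products
    become powers of it and exponents can be raised at will. *)
Definition data_size (sigma sigmaS : R -> R) : R :=
  1 + fine (pw_norm eta cs sigma) + fine (pw_norm eta cs sigmaS) +
  (fmin sigmaS)^-1 + (fmin (sigma \- sigmaS))^-1.

Definition flux_const : R := 4 * (2 + (1 - eta)^-1).

Definition error_const : R :=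
  4 * ((3 + flux_const) + 12 * rate_const eta c0 +
       36 * (1 + (2 * (size cs).+1%:R + (3 + flux_const) / eta))).

Let eta0 : 0 < eta. Proof. by case/andP: eta01. Qed.

Lemma flux_const_ge0 : 0 <= flux_const.
Proof. by rewrite /flux_const mulr_ge0// addr_ge0// invr_ge0 subr_ge0; case/andP: eta01 => _ /ltW. Qed.

Lemma error_const_ge0 : 0 <= error_const.
Proof.
have fc := flux_const_ge0; have rc := rate_const_ge0 eta01 c01.
have q0 : 0 <= (3 + flux_const) / eta by rewrite divr_ge0 ?addr_ge0// ltW.
have k0 : 0 <= (size cs).+1%:R :> R by [].
by rewrite /error_const; lra.
Qed.

Variables (sigma sigmaS f phi : R -> R).
Hypothesis adm : admissible eta cs sigma sigmaS.
Hypothesis fC : Cpw eta cs f.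
Hypothesis Hphi : scalar_flux cs sigma sigmaS f phi.
Local Notation F := (fine (pw_norm eta cs f)).
Local Notation Z := (data_size sigma sigmaS).
Local Notation kap := (scattering_ratio sigma sigmaS).
Local Notation sm := (fmin sigma).
Local Notation sM := (fmax sigma).

Let sigmaC : Cpw eta cs sigma. Proof. by case: adm. Qed.
Let sigmaSC : Cpw eta cs sigmaS. Proof. by case: adm. Qed.
Let Sg0 := fine_pw_norm_ge0 eta cs sigma.
Let SS0 := fine_pw_norm_ge0 eta cs sigmaS.
Let F0 := fine_pw_norm_ge0 eta cs f.
Let half01 : 0 <= (2^-1 : R) <= 1.
Proof. by apply/andP; split; lra. Qed.
Let mS0 : 0 < fmin sigmaS. Proof. by case: adm. Qed.
Let mA0 : 0 < fmin (sigma \- sigmaS). Proof. by case: adm. Qed.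
Let sm0 : 0 < sm. Proof. by case: adm. Qed.
Let sM0 : 0 < sM. Proof. exact: (adm_sM_gt0 cs01 adm). Qed.
Let imS0 : 0 < (fmin sigmaS)^-1. Proof. by rewrite invr_gt0. Qed.
Let imA0 : 0 < (fmin (sigma \- sigmaS))^-1. Proof. by rewrite invr_gt0. Qed.

Lemma data_size_ge1 : 1 <= Z.
Proof. by rewrite /data_size; move: Sg0 SS0 imS0 imA0; lra. Qed.

Let sM_Z : 1 + sM <= Z.
Proof. by rewrite /data_size; have := fmax_le cs01 sigmaC; move: Sg0 SS0 imS0 imA0; lra. Qed.

Let ism_Z : 1 + sm^-1 <= Z.
Proof.
have : sm^-1 <= (fmin sigmaS)^-1 by rewrite lef_pV2 ?posrE//; exact: fmin_sigmaS_le adm.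
by rewrite /data_size; move: Sg0 SS0 imS0 imA0; lra.
Qed.

Let SS_Z : fine (pw_norm eta cs sigmaS) <= Z.
Proof. by rewrite /data_size; move: Sg0 SS0 imS0 imA0; lra. Qed.

Let Sg_Z : fine (pw_norm eta cs sigma) <= Z.
Proof. by rewrite /data_size; move: Sg0 SS0 imS0 imA0; lra. Qed.

Let gap_Z : (1 - kap)^-1 <= Z ^+ 2.
Proof.
have [r0 r1 r2 _] := scattering_ratioP cs01 adm.
have q0 : 0 < fmin (sigma \- sigmaS) / sM by rewrite divr_gt0.
apply: (@le_trans _ _ (fmin (sigma \- sigmaS) / sM)^-1); first by rewrite lef_pV2 ?posrE.
rewrite invf_div expr2; apply: ler_pM; rewrite ?(ltW sM0) ?(ltW imA0)//.
  by move: sM_Z; lra.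
by rewrite /data_size; move: Sg0 SS0 imS0 imA0; lra.
Qed.

(** The fixed point of [B = kap * B + F / sm]. *)
Definition flux_bound : R := F / sm / (1 - kap).
Local Notation Gam := flux_bound.

Let r2 : 0 < 1 - kap. Proof. by have [] := scattering_ratioP cs01 adm. Qed.

Let Gam0 : 0 <= Gam.
Proof. by rewrite /flux_bound !divr_ge0 ?(ltW sm0) ?(ltW r2). Qed.

Let sigma_bnd (x : R) : 0 < x < 1 -> sm <= sigma x <= sM.
Proof.
move=> /andP[/ltW x0 /ltW x1]; have x01 : 0 <= x <= 1 by rewrite x0.
by have [/andP[_ ->]] := adm_sigma cs01 adm x01.
Qed.

Let source_bnd (B : R) : (forall x : R, 0 <= x <= 1 -> `|phi x| <= B) ->
  forall x : R, 0 < x < 1 -> `|sigmaS x * phi x + f x| <= (kap * B + F / sm) * sigma x.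
Proof.
move=> HB x x01'; have /andP[/ltW x0 /ltW x1] := x01'; have x01 : 0 <= x <= 1 by rewrite x0.
have [r0 _ _ H] := scattering_ratioP cs01 adm; have /andP[a b] := H x x01.
have /andP[s1 _] := sigma_bnd x01'; have sx : 0 < sigma x := lt_le_trans sm0 s1.
apply: (le_trans (ler_normD _ _)); rewrite mulrDl normrM (ger0_norm a); apply: lerD.
  by rewrite mulrAC; apply: ler_pM => //; exact: HB.
apply: (le_trans (Cpw_bound cs01 fC x01)).
by rewrite mulrAC -mulrA ler_peMr// ler_pdivlMr// mul1r.
Qed.

(** Let [B] be the maximum of |phi|, attained by continuity. The source is then at most
    [kap * B + F / sm] relative to [sigma], the maximum principle carries this bound over to [psi]
    and to its average, and so [B <= kap * B + F / sm]. *)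
Lemma flux_le_bound (x : R) : 0 <= x <= 1 -> `|phi x| <= Gam.
Proof.
have [r0 _ _ _] := scattering_ratioP cs01 adm.
have [phiC [psi [Hts Hint]]] := Hphi.
have absC : {within `[0, 1], continuous (fun x => `|phi x|)}.
  by move=> z; apply: cvg_norm; exact: phiC.
have [c cin Hc] := @EVT_max R (fun x => `|phi x|) 0 1 ler01 absC.
have {}Hc (z : R) : 0 <= z <= 1 -> `|phi z| <= `|phi c| by move=> z01; apply: Hc; rewrite in_itv.
have c01' : 0 <= c <= 1 by move: cin; rewrite in_itv.
set B := `|phi c| in Hc *.
have step := flux_le Hint (fun m m1 m0 z z01 => psi_le Hts sm0 sigma_bnd (source_bnd Hc) z01 m1 m0) c01'.
move=> x01; apply: (le_trans (Hc x x01)); rewrite /flux_bound ler_pdivlMr//.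
by move: step; rewrite -/B; lra.
Qed.

Let g_bnd (x : R) : 0 < x < 1 -> `|sigmaS x * phi x + f x| <= Gam * sigma x.
Proof.
move=> x01; have := source_bnd flux_le_bound x01.
have -> // : kap * Gam + F / sm = Gam.
by rewrite /flux_bound; field; rewrite !gt_eqF.
Qed.

(** The four terms account for the increments of [sigmaS], of [phi] by [flux_hoelder], of [f], and
    of [sigma]. *)
Definition hoelder_const : R :=
  fine (pw_norm eta cs sigmaS) * Gam + fine (pw_norm eta cs sigmaS) * (flux_const * (1 + sM) * Gam) +
  F + Gam * fine (pw_norm eta cs sigma).
Local Notation L := hoelder_const.

Let lip0 : 0 <= flux_const * (1 + sM) * Gam.
Proof. exact: (mulr_ge0 (mulr_ge0 flux_const_ge0 (addr_ge0 ler01 (ltW sM0))) Gam0). Qed.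

Let L0 : 0 <= L.
Proof.
have g1 := mulr_ge0 SS0 Gam0; have g2 := mulr_ge0 SS0 lip0; have g3 := mulr_ge0 Gam0 Sg0.
exact: (addr_ge0 (addr_ge0 (addr_ge0 g1 g2) F0) g3).
Qed.

Let source_hoelder (x y : R) : 0 < x <= y -> y < 1 ->
  (forall c, c \in cs -> ~~ (x <= c <= y)) ->
  `|(sigmaS x * phi x + f x) - (sigmaS y * phi y + f y)| + Gam * `|sigma x - sigma y| <=
  L * (y - x) `^ eta.
Proof.
move=> xy y1 gap; have /andP[x0 xy'] := xy.
have [phiC [psi [Hts Hint]]] := Hphi.
have h1 := Cpw_hoelder cs01 sigmaSC xy y1 gap; have h2 := Cpw_hoelder cs01 sigmaC xy y1 gap.
have h3 := Cpw_hoelder cs01 fC xy y1 gap.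
have x01 : 0 <= x <= 1 by rewrite (ltW x0) (le_trans xy' (ltW y1)).
have y01 : 0 <= y <= 1 by rewrite (le_trans (ltW x0) xy') ltW.
have h4 := flux_hoelder Hts Hint sm0 sigma_bnd g_bnd eta01 Gam0 (ltW sM0) (x := x) (y := y).
rewrite (ltW x0) xy' (ltW y1) in h4; have {}h4 := h4 isT isT; rewrite -/flux_const in h4.
have h5 := Cpw_bound cs01 sigmaSC y01; have h6 := flux_le_bound x01.
set T := (y - x) `^ eta in h1 h2 h3 h4 *.
have T0 : 0 <= T by exact: powR_ge0.
have -> : (sigmaS x * phi x + f x) - (sigmaS y * phi y + f y) =
   (sigmaS x - sigmaS y) * phi x + sigmaS y * (phi x - phi y) + (f x - f y) by ring.
have e1 : `|(sigmaS x - sigmaS y) * phi x| <= fine (pw_norm eta cs sigmaS) * Gam * T.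
  by rewrite normrM mulrAC ler_pM.
have e2 : `|sigmaS y * (phi x - phi y)| <= fine (pw_norm eta cs sigmaS) * (flux_const * (1 + sM) * Gam) * T.
  by rewrite normrM -mulrA distrC ler_pM.
have e3 : Gam * `|sigma x - sigma y| <= Gam * fine (pw_norm eta cs sigma) * T.
  by rewrite -mulrA ler_wpM2l.
have e4 := le_trans (ler_normD _ _) (lerD (ler_normD ((sigmaS x - sigmaS y) * phi x) (sigmaS y * (phi x - phi y))) (lexx `|f x - f y|)).
apply: (le_trans (lerD e4 (lexx _))).
have -> : L * T = fine (pw_norm eta cs sigmaS) * Gam * T +
  fine (pw_norm eta cs sigmaS) * (flux_const * (1 + sM) * Gam) * T + F * T +
  Gam * fine (pw_norm eta cs sigma) * T by rewrite /hoelder_const; ring.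
by rewrite !lerD.
Qed.

Let Z1 := data_size_ge1.
Let Z0 : 0 <= Z. Proof. exact: le_trans ler01 Z1. Qed.
Let Zp (i j : nat) : (i <= j)%N -> Z ^+ i <= Z ^+ j.
Proof. by move=> ij; rewrite ler_weXn2l. Qed.

Let FZ_le (a b : R) (i j : nat) : (i <= j)%N -> 0 <= b -> a <= b * (F * Z ^+ i) -> a <= b * (F * Z ^+ j).
Proof.
move=> ij b0 H; apply: (le_trans H); rewrite ler_wpM2l// ler_wpM2l//; exact: Zp.
Qed.

Lemma flux_bound_le : Gam <= F * Z ^+ 3.
Proof.
rewrite /flux_bound -mulrA ler_wpM2l// (exprS Z 2); apply: ler_pM; rewrite ?invr_ge0 ?(ltW sm0) ?(ltW r2)//.
by move: ism_Z; lra.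
Qed.

Let sM_le : sM <= Z. Proof. by move: sM_Z; lra. Qed.
Let ism_le : sm^-1 <= Z. Proof. by move: ism_Z; lra. Qed.
Let ism0 : 0 <= sm^-1. Proof. by rewrite invr_ge0 ltW. Qed.

(** Bookkeeping: factors bounded by powers of [Z] are multiplied one at a time onto a term that
    carries the only factor [F]; [FZ_le] then raises the exponent to a common value. *)
Let mulZ (a c e : R) (i j : nat) : 0 <= a -> 0 <= c -> 0 <= e -> a <= Z ^+ i -> c <= e * (F * Z ^+ j) ->
  a * c <= e * (F * Z ^+ (i + j)).
Proof.
move=> a0 c00 e0 ha hc; apply: (le_trans (ler_pM a0 c00 ha hc)).
by rewrite exprD le_eqVlt; apply/orP; left; apply/eqP; ring.
Qed.

Let L_le : L <= (3 + flux_const) * (F * Z ^+ 5).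
Proof.
have fc := flux_const_ge0; have G := flux_bound_le.
have G1 : Gam <= 1 * (F * Z ^+ 3) by rewrite mul1r.
have e1 : fine (pw_norm eta cs sigmaS) * Gam <= 1 * (F * Z ^+ 5).
  by apply: (@FZ_le _ _ 4) => //; apply: (@mulZ _ _ _ 1 3) => //.
have e2 : fine (pw_norm eta cs sigmaS) * (flux_const * (1 + sM) * Gam) <= flux_const * (F * Z ^+ 5).
  have s0 : 0 <= 1 + sM by rewrite addr_ge0// ltW.
  apply: (@mulZ _ _ _ 1 4) => //.
  rewrite -mulrA ler_wpM2l// -[leRHS]mul1r.
  by apply: (@mulZ _ _ _ 1 3) => //.
have e3 : F <= 1 * (F * Z ^+ 5).
  by rewrite mul1r ler_peMr// -(expr0 Z) Zp.
have e4 : Gam * fine (pw_norm eta cs sigma) <= 1 * (F * Z ^+ 5).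
  by rewrite mulrC; apply: (@FZ_le _ _ 4) => //; apply: (@mulZ _ _ _ 1 3) => //.
rewrite /hoelder_const; have -> : (3 + flux_const) * (F * Z ^+ 5) =
  1 * (F * Z ^+ 5) + flux_const * (F * Z ^+ 5) + 1 * (F * Z ^+ 5) + 1 * (F * Z ^+ 5) by ring.
by rewrite !lerD.
Qed.

Let k := (size cs).+1%:R : R.

Let sM0w : 0 <= sM. Proof. exact: ltW. Qed.
Let i0 : 0 <= 1 + sm^-1. Proof. exact: addr_ge0. Qed.
Let sG : 0 <= sM * Gam. Proof. exact: mulr_ge0. Qed.
Let ssG : 0 <= sM * (sM * Gam). Proof. exact: mulr_ge0. Qed.
Let iL : 0 <= (1 + sm^-1) * L. Proof. exact: mulr_ge0. Qed.
Let iiL : 0 <= sm^-1 * ((1 + sm^-1) * L). Proof. exact: mulr_ge0. Qed.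
Let iiiL : 0 <= sm^-1 * (sm^-1 * ((1 + sm^-1) * L)). Proof. exact: mulr_ge0. Qed.

Let layers_le : layers_max cs sm sM Gam L eta <= (2 * k + (3 + flux_const) / eta) * (F * Z ^+ 9).
Proof.
have fc := flux_const_ge0; have k0 : 0 <= k by [].
have G1 : Gam <= 1 * (F * Z ^+ 3) by rewrite mul1r flux_bound_le.
rewrite /layers_max [leRHS]mulrDl; apply: lerD.
  have -> : 2 * sM * Gam / sm * (size cs).+1%:R = (2 * k) * (sm^-1 * (sM * Gam)) by rewrite /k; ring.
  have kk : 0 <= 2 * k by rewrite mulr_ge0.
  rewrite ler_wpM2l// -[leRHS]mul1r.
  apply: (@FZ_le _ _ 5) => //; apply: (@mulZ _ _ _ 1 4) => //.
  by apply: (@mulZ _ _ _ 1 3) => //.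
have -> : sM * L * ((1 + sm^-1) / sm) / (sm * eta) = (sM * (sm^-1 * (sm^-1 * ((1 + sm^-1) * L)))) / eta.
  by field; rewrite !gt_eqF.
rewrite [leRHS]mulrAC ler_wpM2r ?invr_ge0 ?(ltW eta0)//.
have c00 : 0 <= 3 + flux_const by rewrite addr_ge0.
apply: (@mulZ _ _ _ 1 8) => //.
apply: (@mulZ _ _ _ 1 7) => //.
apply: (@mulZ _ _ _ 1 6) => //.
by apply: (@mulZ _ _ _ 1 5) => //.
Qed.

Let layers_ge0 : 0 <= layers_max cs sm sM Gam L eta.
Proof.
have m01 : 0 < (1 : R) <= 1 by rewrite ltr01 lexx.
by have /andP[a b] := layers_bound cs sm0 sigma_bnd L0 g_bnd eta01 0 m01; exact: le_trans b.
Qed.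

Variables (K H : R) (xs : seq R) (Phi : R -> R) (rho : R).
Variables (mu w : 'I_(N_of eta c0 (mesh_width xs)) -> R).
Hypotheses (K1 : 1 <= K) (H0 : 0 < H).
Hypothesis stable : stability_condition eta cs K sigma sigmaS H (N_of eta c0 H).
Hypothesis xs_mesh : mesh rho cs xs.
Hypothesis widthH : mesh_width xs <= H.
Hypothesis gauss : gauss_legendre mu w.
Hypothesis HPhi : discrete_flux xs mu w sigma sigmaS f Phi.

Lemma pathwise_error (x : R) : 0 <= x <= 1 ->
  `|phi x - Phi x| <= error_const * (F * Z ^+ 11) * mesh_width xs `^ eta.
Proof.
have [xs01 cs_xs _] := xs_mesh; set h := mesh_width xs.
have h_cell j : (j < size xs)%N -> xs`_j - (0 :: xs)`_j <= h.
  move=> jM; exact: (@le_bigmax _ _ _ 0 (fun j : 'I_(size xs) => xs`_j - (0 :: xs)`_j) (Ordinal jM)).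
have h0 : 0 < h.
  have M0 := part_size xs01; apply: lt_le_trans (h_cell _ M0).
  by rewrite subr_gt0 (part_lt xs01).
have hH : 0 < h <= H by rewrite h0.
have contr := stable_contraction eta01 c01 cs01 adm K1 H0 stable hH.
have [Hh _] := stable_width_gap eta01 cs01 adm K1 H0 stable.
have h01 : 0 < h <= 1 by rewrite h0 (le_trans widthH)// (le_trans Hh)//; lra.
have rate := width_ln_rate eta01 c01 h01; have invN := inv_N_of_le eta c01 h0.
have n0 := N_of_ge1 eta01 c01 h01.
(* The quadrature lemmas are stated for [N.+1] nodes; [n0] rules out a rule without nodes. *)
move: mu w gauss HPhi; rewrite -/h; move: (N_of eta c0 h) contr rate invN n0 => [|N] contr rate invN n0 mu' w' gauss' HPhi'.
  by move: n0; rewrite ler10.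
have [phiC [psi [Hts Hint]]] := Hphi.
have [r0 _ _ SB] := scattering_ratioP cs01 adm.
have SB' (z : R) : 0 < z < 1 -> 0 <= sigmaS z <= kap * sigma z.
  by move=> /andP[/ltW z0 /ltW z1]; apply: SB; rewrite z0.
have th0 : 0 < (1 - kap) / 4 by rewrite divr_gt0.
move=> x01.
apply: (le_trans (flux_error Hts Hint sm0 sigma_bnd g_bnd L0 eta01 source_hoelder r0 SB' gauss' xs01 cs_xs h_cell HPhi' contr th0 x01)).
set C := consistency _ _ _ _ _ _ _ _.
have p0 : 0 < h `^ eta by exact: powR_gt0.
(* The three summands bound the three terms of [consistency], at the common power [Z ^+ 9]. The
   division by [(1 - kap) / 4] then costs [4 * Z ^+ 2], which turns [q] into [error_const] and 9
   into 11. *)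
pose q := (3 + flux_const) + 12 * rate_const eta c0 + 36 * (1 + (2 * k + (3 + flux_const) / eta)).
have fc := flux_const_ge0; have rc := rate_const_ge0 eta01 c01.
have k0 : 0 <= k by [].
have c30 : 0 <= 3 + flux_const by rewrite addr_ge0.
have G1 : Gam <= 1 * (F * Z ^+ 3) by rewrite mul1r flux_bound_le.
have CB : C <= q * (F * Z ^+ 9) * h `^ eta.
  rewrite /C /consistency.
  have t1 : L * h `^ eta / sm <= (3 + flux_const) * (F * Z ^+ 9) * h `^ eta.
    have -> : L * h `^ eta / sm = (sm^-1 * L) * h `^ eta by ring.
    rewrite ler_wpM2r ?(ltW p0)//; apply: (@FZ_le _ _ 6) => //.
    by apply: (@mulZ _ _ _ 1 5) => //.
  have t2 : 2 * h * (1 + ln N.+1%:R) * (2 * sM ^+ 2 * Gam / sm + 4 * sM * Gam) <=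
      12 * rate_const eta c0 * (F * Z ^+ 9) * h `^ eta.
    have u1 : 2 * sM ^+ 2 * Gam / sm + 4 * sM * Gam <= 6 * (F * Z ^+ 9).
      have -> : 6 * (F * Z ^+ 9) = 2 * (1 * (F * Z ^+ 9)) + 4 * (1 * (F * Z ^+ 9)) by ring.
      have -> : 2 * sM ^+ 2 * Gam / sm + 4 * sM * Gam = 2 * (sm^-1 * (sM * (sM * Gam))) + 4 * (sM * Gam) by ring.
      have v1 : sM * Gam <= 1 * (F * Z ^+ 4) by apply: (@mulZ _ _ _ 1 3) => //.
      apply: lerD; rewrite ler_wpM2l//; last exact: FZ_le v1.
      apply: (@FZ_le _ _ 6) => //.
      apply: (@mulZ _ _ _ 1 5) => //.
      by apply: (@mulZ _ _ _ 1 4) => //.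
    have u2 : 0 <= 2 * sM ^+ 2 * Gam / sm + 4 * sM * Gam.
      have -> : 2 * sM ^+ 2 * Gam / sm + 4 * sM * Gam = 2 * (sm^-1 * (sM * (sM * Gam))) + 4 * (sM * Gam) by ring.
      exact: (addr_ge0 (mulr_ge0 (ler0n R 2) (mulr_ge0 ism0 ssG)) (mulr_ge0 (ler0n R 4) sG)).
    have l0 : 0 <= 1 + ln N.+1%:R :> R by rewrite addr_ge0// ln_ge0.
    have -> : 2 * h * (1 + ln N.+1%:R) * (2 * sM ^+ 2 * Gam / sm + 4 * sM * Gam) =
      2 * ((h * (1 + ln N.+1%:R)) * (2 * sM ^+ 2 * Gam / sm + 4 * sM * Gam)) by ring.
    have -> : 12 * rate_const eta c0 * (F * Z ^+ 9) * h `^ eta = 2 * ((rate_const eta c0 * h `^ eta) * (6 * (F * Z ^+ 9))) by ring.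
    by rewrite ler_wpM2l// ler_pM// mulr_ge0// ltW.
  have t3 : 18 / N.+1%:R * (2 * Gam + 2 * layers_max cs sm sM Gam L eta) <=
      36 * (1 + (2 * k + (3 + flux_const) / eta)) * (F * Z ^+ 9) * h `^ eta.
    have -> : 18 / N.+1%:R * (2 * Gam + 2 * layers_max cs sm sM Gam L eta) =
      36 * (N.+1%:R^-1 * (Gam + layers_max cs sm sM Gam L eta)) by ring.
    have -> : 36 * (1 + (2 * k + (3 + flux_const) / eta)) * (F * Z ^+ 9) * h `^ eta =
      36 * (h `^ eta * (1 * (F * Z ^+ 9) + (2 * k + (3 + flux_const) / eta) * (F * Z ^+ 9))) by ring.
    have GL0 := addr_ge0 Gam0 layers_ge0.
    rewrite ler_wpM2l// ler_pM ?invr_ge0//.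
    by apply: lerD => //; exact: FZ_le G1.
  by apply: (le_trans (lerD (lerD t1 t2) t3)); rewrite -!mulrDl.
have i4 : ((1 - kap) / 4)^-1 = 4 * (1 - kap)^-1 by rewrite invf_div mulrC.
have q0 : 0 <= q.
  by have := error_const_ge0; rewrite /error_const -/k -/q pmulr_rge0.
have X0 : 0 <= q * (F * Z ^+ 9) * h `^ eta by rewrite !mulr_ge0 ?exprn_ge0 ?(ltW p0).
rewrite i4; apply: (@le_trans _ _ (q * (F * Z ^+ 9) * h `^ eta * (4 * Z ^+ 2))).
  apply: (@le_trans _ _ (q * (F * Z ^+ 9) * h `^ eta * (4 * (1 - kap)^-1))).
    by rewrite ler_wpM2r// mulr_ge0// invr_ge0 ltW.
  by rewrite ler_wpM2l// ler_wpM2l.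
rewrite le_eqVlt; apply/orP; left; apply/eqP; rewrite /error_const -/k -/q.
by rewrite (exprD Z 9 2); ring.
Qed.

End pathwise.

(** * Moments *)

Section lower_integral.
Context {d : measure_display} {T : measurableType d} {R : realType}.
Variable P : probability T R.
Implicit Types (f g : T -> \bar R) (X Y M : T -> R).
Local Open Scope ereal_scope.

Import HBNNSimple.

(* Without measurability the integral of a nonnegative function is a lower
   integral; it is still monotone almost everywhere. *)
Lemma ge0_le_integral_ae f g : (forall x, 0 <= f x) -> (forall x, 0 <= g x) ->
  {ae P, forall x, f x <= g x} -> \int[P]_x f x <= \int[P]_x g x.
Proof.
move=> f0 g0 [N [mN N0 subN]].
rewrite !ge0_integralE// !patch_setT.
apply: ge_ereal_sup => _ [h /= hf <-].
have mNc : measurable (setT `\` N) by exact: measurableD.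
rewrite -integralT_nnsfun (ge0_negligible_integral mN)//; last 2 first.
- by apply/measurable_EFinP.
- by move=> x _; rewrite lee_fin; exact: fun_ge0.
rewrite integral_nnsfun// (mrestrict h mNc).
apply: ereal_sup_ubound; exists (proj_nnsfun h mNc) => //= x.
rewrite mindicE; have [|_] := boolP (x \in _); last by rewrite mulr0.
rewrite inE mulr1 => -[_ Nx]; apply: (le_trans (hf x)).
by apply: contrapT => H; apply: Nx; apply: subN.
Qed.

(** Without measurability the integral of [X] is the difference of the lower integrals of its
    positive and negative parts. Both lie between 0 and [c], hence so does the absolute value of the
    difference. *)
Lemma abse_integral_le X M (c : R) : {ae P, forall w, `|X w|%R <= M w :> R}%R ->
  (forall w, 0 <= M w)%R -> \int[P]_w (M w)%:E = c%:E -> `|\int[P]_w (X w)%:E| <= c%:E.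
Proof.
move=> XM M0 Mc; rewrite integralE.
have a_le : \int[P]_w (fun w => (X w)%:E)^\+ w <= c%:E.
  rewrite -Mc; apply: ge0_le_integral_ae => //.
  apply: filterS XM => w XM; rewrite funeposE -EFin_max lee_fin ge_max M0 andbT.
  exact: le_trans (ler_norm _) XM.
have b_le : \int[P]_w (fun w => (X w)%:E)^\- w <= c%:E.
  rewrite -Mc; apply: ge0_le_integral_ae => //.
  apply: filterS XM => w XM; rewrite funenegE -EFinN -EFin_max lee_fin ge_max M0 andbT.
  by apply: le_trans XM; rewrite -normrN ler_norm.
have a0 : 0 <= \int[P]_w (fun w => (X w)%:E)^\+ w by exact: integral_ge0.
have b0 : 0 <= \int[P]_w (fun w => (X w)%:E)^\- w by exact: integral_ge0.
move: a_le b_le a0 b0; case: (\int[P]_w _ w) => [a| |] //; case: (\int[P]_w _ w) => [b| |] //.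
rewrite !lee_fin => ac bc a0 b0.
have : (`|a - b| <= c)%R by rewrite ler_norml; apply/andP; split; lra.
exact.
Qed.

Definition finite_moment (r : R) (X : T -> R) := [/\ measurable_fun setT X,
  (forall w, 0 <= X w)%R & \int[P]_w (X w `^ r)%:E < +oo].

Lemma powR_add_le (x y r : R) : (0 <= x -> 0 <= y -> 0 <= r ->
  (x + y) `^ r <= 2 `^ r * (x `^ r + y `^ r))%R.
Proof.
move=> x0 y0 r0; have le2 (z w : R) : (0 <= z -> z <= w -> (z + w) `^ r <= 2 `^ r * w `^ r)%R.
  move=> z0 zw; have w0 := le_trans z0 zw; rewrite -powRM//.
  by apply: ge0_ler_powR; rewrite ?nnegrE ?addr_ge0 ?mulr_ge0//; lra.
have [xy|yx] := leP x y.
  by apply: (le_trans (le2 _ _ x0 xy)); rewrite ler_wpM2l ?powR_ge0// lerDr powR_ge0.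
rewrite addrC; apply: (le_trans (le2 _ _ y0 (ltW yx))).
by rewrite ler_wpM2l ?powR_ge0// lerDl powR_ge0.
Qed.

Lemma measurable_moment X (r : R) : measurable_fun setT X ->
  measurable_fun setT (fun w => (X w `^ r)%:E).
Proof.
move=> mX; apply/measurable_EFinP.
by apply: (measurableT_comp (measurable_powR r)).
Qed.

Lemma finite_momentD (r : R) X Y : (0 <= r)%R -> finite_moment r X -> finite_moment r Y ->
  finite_moment r (fun w => X w + Y w)%R.
Proof.
move=> r0 [mX X0 Xr] [mY Y0 Yr]; split; first exact: measurable_funD.
  by move=> w; rewrite addr_ge0.
have mXr := measurable_moment r mX; have mYr := measurable_moment r mY.
apply: (@le_lt_trans _ _ ((2 `^ r)%:E * (\int[P]_w (X w `^ r)%:E + \int[P]_w (Y w `^ r)%:E))).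
  rewrite -ge0_integralD//; last 2 first.
  - by move=> w _; rewrite lee_fin powR_ge0.
  - by move=> w _; rewrite lee_fin powR_ge0.
  rewrite -ge0_integralZl//; last 2 first.
  - exact: emeasurable_funD.
  - by move=> w _; rewrite -EFinD lee_fin addr_ge0// powR_ge0.
  apply: ge0_le_integral_ae.
  - by move=> w; rewrite lee_fin powR_ge0.
  - by move=> w; rewrite -EFinD -EFinM lee_fin mulr_ge0 ?addr_ge0 ?powR_ge0.
  - by apply: nearW => w; rewrite -EFinD -EFinM lee_fin powR_add_le.
by rewrite lte_mul_pinfty ?lee_fin ?powR_ge0// lte_add_pinfty.
Qed.

Lemma finite_moment_bounded (r K : R) X : measurable_fun setT X -> (forall w, 0 <= X w)%R -> (0 <= r)%R ->
  {ae P, forall w, X w <= K :> R}%R -> finite_moment r X.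
Proof.
move=> mX X0 r0 XK; split=> //.
apply: (@le_lt_trans _ _ (\int[P]_w ((`|K| `^ r)%:E))).
  apply: ge0_le_integral_ae.
  - by move=> w; rewrite lee_fin powR_ge0.
  - by move=> w; rewrite lee_fin powR_ge0.
  - apply: filterS XK => w XK; rewrite lee_fin; apply: ge0_ler_powR; rewrite ?nnegrE//.
    exact: le_trans XK (ler_norm _).
by rewrite integral_cst// [X in _ * X](probability_setT P) mule1 ltry.
Qed.

Lemma finite_momentW (r t : R) X : (0 <= r <= t)%R -> finite_moment t X -> finite_moment r X.
Proof.
move=> /andP[r0 rt] [mX X0 Xt]; split=> //.
apply: (@le_lt_trans _ _ (\int[P]_w (cst 1 w + (X w `^ t)%:E))).
  apply: ge0_le_integral_ae.
  - by move=> w; rewrite lee_fin powR_ge0.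
  - by move=> w; rewrite /cst -EFinD lee_fin addr_ge0// powR_ge0.
  - apply: nearW => w; rewrite /cst -EFinD lee_fin.
    have [X1|X1] := leP (X w) 1%R.
      apply: (@le_trans _ _ 1%R); last by rewrite lerDl powR_ge0.
      have := ge0_ler_powR r0 (_ : X w \in Num.nneg) (_ : 1%R \in Num.nneg) X1.
      by rewrite powR1 !nnegrE X0 ler01; apply.
    apply: (@le_trans _ _ (X w `^ t)%R); last by rewrite lerDr.
    by rewrite ler_powR// ltW.
rewrite ge0_integralD//; last 2 first.
- by move=> w _; rewrite lee_fin powR_ge0.
- exact: measurable_moment.
by rewrite integral_cst// [X in _ * X + _](probability_setT P) mule1 lte_add_pinfty ?ltry.
Qed.

Lemma Lfun_moment (t : R) X : (0 < t)%R -> (forall w, 0 <= X w)%R -> X \in Lfun P t%:E -> finite_moment t X.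
Proof.
move=> t0 X0; rewrite inE => /andP[]; rewrite !inE => mX; rewrite /finite_norm => Nf.
split=> //.
have E : \int[P]_x (`|(EFin \o X) x| `^ t) = \int[P]_w (X w `^ t)%:E.
  by apply: eq_integral => w _; rewrite /= ger0_norm.
by rewrite -E -poweR_Lnorm ?gt_eqF// poweR_lty.
Qed.

End lower_integral.

(** * Moments of the norms of Bochner fields *)

Section strong_measurability.
Context {d : measure_display} {T : measurableType d} {R : realType}.
Variables (P : probability T R) (eta : R) (cs : seq R).
Hypothesis cs01 : itv_partition 0 1 cs.
Implicit Types (u v : R -> R).
Local Notation N := (pw_norm eta cs).

Lemma pw_norm_triangle u v : (N u <= N (u \- v)%R + N v)%E.
Proof.
apply: bigmax_le => [|j _]; first by rewrite adde_ge0 ?pw_norm_ge0.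
have [H1 H2] := cell_hoelder_norm eta cs01 (u \- v) (ltn_ord j).
have h1 := @pw_norm_cell R eta cs (u \- v) _ (ltn_ord j); have h2 := @pw_norm_cell R eta cs v _ (ltn_ord j).
apply: le_trans (leeD h1 h2).
set D := cell cs j.
rewrite /hoelder_norm addeACA; apply: leeD.
  apply: supnorm_le => x Dx; apply: le_trans (leeD (supnorm_ge _ Dx) (supnorm_ge _ Dx)).
  by rewrite -EFinD lee_fin /= -{1}(subrK (v x) (u x)) ler_normD.
apply: ge_ereal_sup => _ [x [y [Dx Dy xy ->]]].
have sup_ge (w : R -> R) : ((`|w x - w y| / `|x - y| `^ eta)%:E <=
  ereal_sup [set r | exists x y, [/\ D x, D y, x != y & r = (`|w x - w y| / `|x - y| `^ eta)%:E]])%E.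
  by apply: ereal_sup_ubound; exists x, y.
apply: le_trans (leeD (sup_ge (u \- v)) (sup_ge v)).
rewrite -EFinD lee_fin -mulrDl ler_wpM2r ?invr_ge0 ?powR_ge0//=.
by rewrite (_ : u x - u y = (u x - v x - (u y - v y)) + (v x - v y)) ?ler_normD//; ring.
Qed.

Lemma pw_normB u v : N (u \- v)%R = N (v \- u)%R.
Proof.
apply: eq_bigr => j _; rewrite /hoelder_norm; congr (_ + _)%E.
  rewrite /supnorm; congr ereal_sup; apply/seteqP.
  by split=> _ [x Dx <-]; exists x => //=; rewrite distrC.
congr ereal_sup; apply/seteqP; split=> _ [x [y [Dx Dy xy ->]]]; exists x, y; split=> //=.
  have -> : u x - v x - (u y - v y) = - (v x - u x - (v y - u y)) by ring.
  by rewrite normrN.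
have -> : v x - u x - (v y - u y) = - (u x - v x - (u y - v y)) by ring.
by rewrite normrN.
Qed.

Lemma simple_field_measurable X (s : T -> R -> R) (F : (R -> R) -> R) :
  simple_field X s -> measurable_fun setT (F \o s).
Proof.
move=> [fs _ ms] _ B mB; rewrite setTI.
rewrite (_ : _ @^-1` B = \bigcup_(g in range s `&` [set g | B (F g)]) (s @^-1` [set g])).
  by apply: fin_bigcup_measurable => //; exact: finite_setIl.
apply/seteqP; split=> [w /= Bw|w [g [_ /= Bg] /= ->] //].
by exists (s w) => //; split=> //; exists w.
Qed.

(** The norms of the simple approximations are measurable and, by the triangle inequality, converge
    almost everywhere to the norm of [F]. Their upper limit is measurable everywhere; [fine] and the
    absolute value make it a nonnegative number on the null set without convergence too. *)
Lemma strong_norm_measurable (F : T -> R -> R) : (forall w, Cpw eta cs (F w)) ->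
  strongly_measurable P (Cpw eta cs) N F ->
  exists m : T -> R, [/\ measurable_fun setT m, forall w, 0 <= m w &
    {ae P, forall w, fine (N (F w)) = m w}].
Proof.
move=> FC [s [simp conv]].
pose a n w := (fine (N (s n w)))%:E.
have ma n : measurable_fun setT (a n).
  apply/measurable_EFinP; exact: (simple_field_measurable (fun g => fine (N g)) (simp n)).
pose m w := `|fine (limn_esup (a ^~ w))|.
exists m; split.
- apply: (measurableT_comp (@normr_measurable R setT)) => //.
  by apply: (@measurableT_comp _ _ _ _ _ _ fine) => //; exact: measurable_fun_limn_esup.
- by move=> w; exact: normr_ge0.
apply: filterS conv => w conv; rewrite /m.
have sC n : Cpw eta cs (s n w) by have [_ H _] := simp n.
have NF := pw_normE (FC w).
have Ns n := pw_normE (sC n).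
have diff n : (`|fine (N (s n w)) - fine (N (F w))|%:E <= N (s n w \- F w)%R)%E.
  have h1 := pw_norm_triangle (s n w) (F w); have h2 := pw_norm_triangle (F w) (s n w).
  rewrite pw_normB in h2; have h0 := pw_norm_ge0 eta cs (s n w \- F w)%R.
  rewrite NF Ns in h1; rewrite NF Ns in h2.
  move: h1 h2 h0; case: (N (s n w \- F w)%R) => [e| |] //; last by move=> *; exact: leey.
  rewrite -!EFinD !lee_fin => h1 h2 h0.
  by rewrite ler_norml; apply/andP; split; lra.
have lim : a n w @[n --> \oo] --> (fine (N (F w)))%:E.
  apply/fine_cvgP; split; first by apply: nearW.
  apply/cvgrPdist_le => e e0 /=.
  have : \forall n \near \oo, (N (s n w \- F w)%R < e%:E)%E.
    have := conv; move/(_ [set x | (x < e%:E)%E]); apply.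
    by apply: open_ereal_lt'; rewrite lte_fin.
  by apply: filterS => n He; rewrite distrC -lee_fin; exact: le_trans (diff n) (ltW He).
rewrite is_cvg_limn_esupE; last by apply/cvg_ex; exists (fine (N (F w)))%:E.
by rewrite (cvg_lim _ lim)//= ger0_norm// fine_pw_norm_ge0.
Qed.

Lemma bochner_moment (r : R) (pstar : \bar R) (F : T -> R -> R) : 0 < r -> (r%:E <= pstar)%E ->
  bochner P (Cpw eta cs) N pstar F -> exists2 m, finite_moment P r m &
    {ae P, forall w, fine (N (F w)) = m w}.
Proof.
move=> r0 rp [FC sF NF].
have [m [mm m0 mE]] := strong_norm_measurable FC sF; exists m => //.
case: pstar rp sF NF => [t| |] //.
- rewrite lee_fin => rt _ NF; have t0 := lt_le_trans r0 rt.
  apply: (@finite_momentW _ _ _ _ _ t); first by rewrite (ltW r0).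
  split=> //; have := poweR_lty t NF; rewrite poweR_Lnorm ?gt_eqF//.
  apply: le_lt_trans; apply: ge0_le_integral_ae.
  + by move=> w; rewrite lee_fin powR_ge0.
  + by move=> w; exact: poweR_ge0.
  + apply: filterS mE => w <-; rewrite /= pw_normE//=.
    by rewrite ger0_norm// fine_pw_norm_ge0.
- move=> _ _; rewrite unlock /= [X in (0 < X)%E](probability_setT P) lte01 => NF.
  have [K HK] : exists K : R, (ess_sup_inf.ess_sup P (abse \o (N \o F)) <= K%:E)%E.
    move: NF; case: (ess_sup_inf.ess_sup _ _) => [K| |] // _; first by exists K.
    by exists 0; rewrite leNye.
  apply: (@finite_moment_bounded _ _ _ _ _ K) => //; first exact: ltW.
  move/ess_sup_inf.ess_supP : HK => HK; apply: filterS2 mE HK => w <-; rewrite /= pw_normE// abse_EFin lee_fin.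
  exact: le_trans (ler_norm _).
Qed.

End strong_measurability.

(** If Z^22 <= F^(p - 2), the product is at most F^p. Otherwise F <= Z^(22 / (p - 2)), which turns
    the product into the given power of [Z]. *)
Lemma interpolate_powers (R : realType) (F Z p : R) : 0 <= F -> 1 <= Z -> 2 < p ->
  (F * Z ^+ 11) ^+ 2 <= F `^ p + Z `^ (22 * p / (p - 2)).
Proof.
move=> F0 Z1 p2; have Z0 : 0 < Z by apply: lt_le_trans Z1.
have p20 : 0 < p - 2 by rewrite subr_gt0.
have -> : (F * Z ^+ 11) ^+ 2 = F ^+ 2 * Z ^+ 22 by rewrite exprMn -exprM.
have [->|Fn] := eqVneq F 0; first by rewrite expr0n mul0r addr_ge0 ?powR_ge0.
have F0' : 0 < F by rewrite lt0r Fn.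
have ZE (n : nat) : Z ^+ n = Z `^ n%:R by rewrite powR_mulrn// ltW.
have [le1|lt1] := leP (Z ^+ 22) (F `^ (p - 2)).
  apply: (@le_trans _ _ (F `^ p)); last by rewrite lerDl powR_ge0.
  have -> : F `^ p = F ^+ 2 * F `^ (p - 2).
    by rewrite -powR_mulrn// -powRD ?subrKC// (negbTE Fn) implybT.
  by rewrite ler_wpM2l// exprn_ge0.
apply: (@le_trans _ _ (Z `^ (22 * p / (p - 2)))); last by rewrite lerDr powR_ge0.
have FZ : F <= Z `^ (22 / (p - 2)).
  rewrite powRrM -(powRr1 F0) -{1}(mulfV (lt0r_neq0 p20)) powRrM.
  apply: ge0_ler_powR; rewrite ?nnegrE ?powR_ge0 ?invr_ge0 ?(ltW p20)//.
  by rewrite -ZE ltW.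
have -> : Z `^ (22 * p / (p - 2)) = (Z `^ (22 / (p - 2))) ^+ 2 * Z ^+ 22.
  rewrite -powR_mulrn ?powR_ge0// -powRrM ZE -powRD; last by rewrite (gt_eqF Z0) implybT.
  by congr (_ `^ _); field; rewrite gt_eqF.
by rewrite ler_wpM2r ?exprn_ge0 ?(ltW Z0)// ler_pXn2r ?nnegrE ?powR_ge0.
Qed.

Section size_moment.
Context {d : measure_display} {T : measurableType d} {R : realType}.
Variables (P : probability T R) (eta : R) (cs : seq R).
Hypothesis cs01 : itv_partition 0 1 cs.
Variables (sigma sigmaS f : T -> R -> R) (pstar : \bar R) (p : R).
Hypothesis adm : forall w, admissible eta cs (sigma w) (sigmaS w).
Hypothesis Ha : forall t : R, 1 <= t ->
  bochner P (Cpw eta cs) (pw_norm eta cs) t%:E sigma /\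
  bochner P (Cpw eta cs) (pw_norm eta cs) t%:E sigmaS.
Hypothesis Hb : forall t : R, 1 <= t ->
  (fun w => (fmin (sigmaS w))^-1) \in Lfun P t%:E /\
  (fun w => (fmin (sigma w \- sigmaS w))^-1) \in Lfun P t%:E.
Hypothesis Hc : bochner P (Cpw eta cs) (pw_norm eta cs) pstar f.
Hypotheses (Hp : 2 < p) (Hppstar : (p%:E < pstar)%E).

Definition error_size (w : T) : R :=
  fine (pw_norm eta cs (f w)) * data_size eta cs (sigma w) (sigmaS w) ^+ 11.

Lemma error_size_moment : exists G : T -> R, [/\ measurable_fun setT G,
  forall w, 0 <= G w, (\int[P]_w (G w)%:E < +oo)%E &
  {ae P, forall w, error_size w ^+ 2 <= G w}].
Proof.
pose r := 22 * p / (p - 2).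
have p0 : 0 < p by apply: lt_trans Hp.
have r1 : 1 <= r by rewrite /r ler_pdivlMr ?subr_gt0// mul1r; lra.
have r0 : 0 < r by apply: lt_le_trans r1.
have [[Ba Bb] [La Lb]] := (Ha r1, Hb r1).
have [ma Ma Ea] := bochner_moment cs01 r0 (lexx _) Ba.
have [mb Mb Eb] := bochner_moment cs01 r0 (lexx _) Bb.
have [mf Mf Ef] := bochner_moment cs01 p0 (ltW Hppstar) Hc.
have Mc : finite_moment P r (fun w => (fmin (sigmaS w))^-1).
  by apply: Lfun_moment => // w; rewrite invr_ge0 ltW//; case: (adm w).
have Md : finite_moment P r (fun w => (fmin (sigma w \- sigmaS w))^-1).
  by apply: Lfun_moment => // w; rewrite invr_ge0 ltW//; case: (adm w).
have M1 : finite_moment P r (fun=> 1).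
  by apply: (@finite_moment_bounded _ _ _ _ _ 1) => //; [exact: ltW|exact: nearW].
have [mZ Z0 Zr] := finite_momentD (ltW r0) (finite_momentD (ltW r0) (finite_momentD (ltW r0)
  (finite_momentD (ltW r0) M1 Ma) Mb) Mc) Md.
set Zm := fun w => _ in mZ Z0 Zr.
have [mF F0 Fp] := Mf.
exists (fun w => mf w `^ p + Zm w `^ r); split.
- by apply: measurable_funD; apply: (measurableT_comp (measurable_powR _)).
- by move=> w; rewrite addr_ge0 ?powR_ge0.
- under eq_integral do rewrite EFinD.
  rewrite ge0_integralD//; first exact: lte_add_pinfty.
  + by move=> w _; rewrite lee_fin powR_ge0.
  + exact: measurable_moment.
  + by move=> w _; rewrite lee_fin powR_ge0.
  + exact: measurable_moment.
apply: filterS3 Ea Eb Ef => w Ea Eb Ef.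
rewrite /error_size Ef.
have -> : data_size eta cs (sigma w) (sigmaS w) = Zm w by rewrite /data_size Ea Eb.
apply: interpolate_powers => //; rewrite /Zm -Ea -Eb.
exact: data_size_ge1 (adm w).
Qed.

End size_moment.

(** * A deterministic Lipschitz constant for the functional *)

Section lipschitz_constant.
Context {R : realType}.

Lemma C01_bounded (u : R -> R) : C01 u -> exists2 B, 0 <= B & forall x : R, 0 <= x <= 1 -> `|u x| <= B.
Proof.
move=> uC; have absC : {within `[0, 1], continuous (fun x => `|u x|)}.
  by move=> z; apply: cvg_norm; exact: uC.
have [c _ Hc] := @EVT_max R (fun x => `|u x|) 0 1 ler01 absC.
by exists `|u c| => // x x01; apply: Hc; rewrite in_itv.
Qed.

Lemma Linfnorm_lty (u : R -> R) : C01 u -> (Linfnorm u < +oo)%E.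
Proof.
move=> /C01_bounded[B B0 HB].
rewrite /Linfnorm unlock; case: ifPn => _; last by rewrite ltry.
apply: (@le_lt_trans _ _ B%:E); last by rewrite ltry.
apply/ess_sup_inf.ess_supP; exists (~` unit_itv); split.
- by apply: measurableC; exact: measurable_itv.
- by rewrite /= /mrestr setICl measure0.
- move=> x /= H x01; apply: H; rewrite lee_fin; apply: HB.
  by move: x01; rewrite /unit_itv /= in_itv.
Qed.

Lemma C01_Linf (u : R -> R) : C01 u -> Linf u.
Proof.
move=> uC; split; last exact: Linfnorm_lty.
by apply: subspace_continuous_measurable_fun => //; exact: measurable_itv.
Qed.

Context {d : measure_display} {T : measurableType d}.
Variable P : probability T R.

Lemma bochner_const (u : R -> R) (p : R) : 0 < p -> C01 u ->
  bochner P Linf Linfnorm p%:E (fun=> u).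
Proof.
move=> p0 uC; split.
- by move=> _; exact: C01_Linf.
- exists (fun=> fun=> u); split.
    move=> n; split.
    + apply: (@sub_finite_set _ _ [set u]); last exact: finite_set1.
      by move=> _ [w _ <-].
    + by move=> _; exact: C01_Linf.
    + by move=> g; rewrite preimage_cst; case: ifP => _.
  apply: nearW => w; have -> : Linfnorm (u \- u) = 0%E.
    rewrite /Linfnorm (_ : EFin \o (u \- u) = cst 0%E) ?Lnorm0//.
    by apply/funext => x; rewrite /= subrr.
  exact: cvg_cst.
- have := Linfnorm_lty uC.
  have : (0 <= Linfnorm u)%E by exact: Lnorm_ge0.
  case E : (Linfnorm u) => [c| |] // c0 _.
  rewrite (_ : Linfnorm \o (fun=> u) = cst c%:E); last by apply/funext => w /=.
  rewrite unlock /= poweR_lty// integral_cst//.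
  by rewrite [X in (_ * X)%E](probability_setT P) mule1 ltry.
Qed.

(* The functional is deterministic: on constant fields the random constant C'
   may be replaced by any bound that it satisfies with positive probability. *)
Lemma functional_lipschitz (calQ : (R -> R) -> R) (C' : T -> R) (p : R) : 0 < p ->
  (forall u v : T -> R -> R, bochner P Linf Linfnorm p%:E u -> bochner P Linf Linfnorm p%:E v ->
     (forall w, C01 (u w)) -> (forall w, C01 (v w)) ->
     {ae P, forall w, (`|calQ (u w) - calQ (v w)|%:E <=
                       (C' w)%:E * supnorm unit_itv (u w \- v w)%R)%E}) ->
  exists2 K, 0 <= K & forall u v b, C01 u -> C01 v -> (forall x : R, 0 <= x <= 1 -> `|u x - v x| <= b) ->
     `|calQ u - calQ v| <= K * b.
Proof.
move=> p0 HLip.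
(* [C'] takes finite values, so the sets where it is at most [n] exhaust the probability space and
   cannot all be negligible. *)
have [n Pn] : exists n : nat, ~ P.-negligible [set w | C' w <= n%:R].
  apply: contrapT => /forallNP H.
  have Hn n : P.-negligible [set w | C' w <= n%:R] by apply: contrapT; exact: H.
  have : P.-negligible setT.
    apply: negligibleS (negligible_bigcup Hn) => w _.
    by exists (Num.truncn `|C' w|).+1 => //=; rewrite (le_trans (ler_norm _))// ltW// truncnS_gt.
  by move=> /(measure_negligible measurableT); rewrite [LHS](probability_setT P) => /eqP; rewrite onee_eq0.
exists n%:R => // u v b uC vC uv.
have ae := HLip (fun=> u) (fun=> v) (bochner_const p0 uC) (bochner_const p0 vC) (fun=> uC) (fun=> vC).
have [w Cw Hw] : exists2 w, C' w <= n%:R &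
    (`|calQ u - calQ v|%:E <= (C' w)%:E * supnorm unit_itv (u \- v)%R)%E.
  apply: contrapT => H; apply: Pn; apply: negligibleS ae => w /= Cw Hw.
  by apply: H; exists w.
have sup0 : (0 <= supnorm unit_itv (u \- v)%R)%E.
  apply: le_trans (supnorm_ge _ (_ : unit_itv 0)); first by rewrite lee_fin.
  by rewrite /unit_itv /= in_itv /= lexx ler01.
have supb : (supnorm unit_itv (u \- v)%R <= b%:E)%E.
  apply: supnorm_le => x; rewrite /unit_itv /= in_itv /= => x01.
  by rewrite lee_fin uv.
rewrite -lee_fin; apply: (le_trans Hw); rewrite EFinM.
apply: (@le_trans _ _ (n%:R%:E * supnorm unit_itv (u \- v)%R)%E).
  by apply: lee_wpmul2r => //; rewrite lee_fin.
by apply: lee_wpmul2l => //; rewrite lee_fin.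
Qed.

End lipschitz_constant.

(** * Expectation and variance under a square-integrable majorant *)

Section moment_bounds.
Context {d : measure_display} {T : measurableType d} {R : realType}.
Variable P : probability T R.
Variables (A G : T -> R) (I : R).
Hypotheses (A0 : forall w, 0 <= A w) (mG : measurable_fun setT G) (G0 : forall w, 0 <= G w).
Hypothesis AG : {ae P, forall w, A w ^+ 2 <= G w}.
Hypothesis GI : (\int[P]_w (G w)%:E = I%:E)%E.

Let integral_affine (a b : R) : 0 <= a -> 0 <= b ->
  (\int[P]_w (a + b * G w)%:E = (a + b * I)%:E)%E.
Proof.
move=> a0 b0; under eq_integral do rewrite EFinD EFinM.
rewrite ge0_integralD//; last 2 first.
- by move=> w _; rewrite -EFinM lee_fin mulr_ge0.
- by apply/measurable_EFinP; apply: measurable_funM.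
rewrite integral_cst// [X in (_ * X + _)%E](probability_setT P) mule1.
rewrite ge0_integralZl//; first by rewrite GI.
- exact/measurable_EFinP.
- by move=> w _; rewrite lee_fin.
Qed.

Let I0 : 0 <= I.
Proof. by rewrite -lee_fin -GI integral_ge0// => w _; rewrite lee_fin. Qed.

Variables (X : T -> R) (k : R).
Hypotheses (k0 : 0 <= k) (XA : forall w, `|X w| <= k * (1 + A w)).

Lemma expectation_le : (`|'E_P[X]| <= (k * (2 + I))%:E)%E.
Proof.
rewrite expectation.unlock.
apply: (@abse_integral_le _ _ _ P X (fun w => 2 * k + k * G w)); last 2 first.
- by move=> w; rewrite addr_ge0 ?mulr_ge0.
- by rewrite integral_affine ?mulr_ge0//; congr (_%:E); ring.
apply: filterS AG => w Aw; apply: (le_trans (XA w)).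
have : 1 + A w <= 2 + G w by have := sqr_ge0 (A w - 1); have := G0 w; rewrite sqrrB1; lra.
by move=> /(ler_wpM2l k0); lra.
Qed.

(** The integrand is the square of [X - m] for the number [m = fine 'E_P[X]]. It is at most 2 X^2 +
    2 m^2, where the majorant [G] controls the first term and [expectation_le] the second. *)
Lemma variance_le : ('V_P[X] <= (k ^+ 2 * (4 * (1 + I) + 2 * (2 + I) ^+ 2))%:E)%E.
Proof.
rewrite /variance covariance.unlock.
set m := fine 'E_P[X].
have mk : `|m| <= k * (2 + I).
  have := expectation_le; rewrite /m; case: ('E_P[X])%E => [e| |] //=; rewrite ?leey//.
have mk2 : m ^+ 2 <= (k * (2 + I)) ^+ 2.
  by rewrite -(real_normK (num_real m)) ler_pXn2r ?nnegrE// mulr_ge0// addr_ge0.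
pose a := 4 * k ^+ 2 + 2 * (k * (2 + I)) ^+ 2.
have a0 : 0 <= a by rewrite addr_ge0// mulr_ge0 ?sqr_ge0.
have b0 : 0 <= 4 * k ^+ 2 by rewrite mulr_ge0 ?sqr_ge0.
rewrite expectation.unlock.
apply: (@le_trans _ _ (\int[P]_w (a + 4 * k ^+ 2 * G w)%:E)%E); last first.
  by rewrite integral_affine// lee_fin /a le_eqVlt; apply/orP; left; apply/eqP; ring.
apply: ge0_le_integral_ae.
- by move=> w; rewrite lee_fin -expr2 sqr_ge0.
- by move=> w; rewrite lee_fin addr_ge0// mulr_ge0.
apply: filterS AG => w Aw; rewrite lee_fin.
have -> : ((X \- cst m) * (X \- cst m)) w = (X w - m) ^+ 2 by [].
have X2 : X w ^+ 2 <= (k * (1 + A w)) ^+ 2.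
  by rewrite -(real_normK (num_real (X w))) ler_pXn2r ?nnegrE ?mulr_ge0 ?addr_ge0.
have A2 : (1 + A w) ^+ 2 <= 2 * (1 + G w).
  by have := sqr_ge0 (A w - 1); rewrite sqrrB1 sqrrD expr1n mul1r; lra.
have := ler_wpM2l (sqr_ge0 k) A2; rewrite -exprMn => kA.
have : (X w - m) ^+ 2 <= 2 * X w ^+ 2 + 2 * m ^+ 2.
  by have := sqr_ge0 (X w + m); rewrite sqrrB sqrrD; lra.
rewrite /a; move: X2 kA mk2; lra.
Qed.

End moment_bounds.

(** The width in use is the minimum of [h] and [hmax w]: below [hmax w] the contraction is
    available, and below [h] the rate is that of [h]. *)
Lemma approximation_error (R : realType) (T : Type) (eta c0 rho K : R) (cs : seq R)
    (mu wt : forall N : nat, 'I_N -> R) (sigma sigmaS f phi : T -> R -> R) (hmax : T -> R)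
    (h : R) (Phi : T -> R -> R) :
  0 < eta < 1 -> 1 < c0 -> itv_partition 0 1 cs -> 1 <= K ->
  (forall N, gauss_legendre (mu N) (wt N)) ->
  (forall w, admissible eta cs (sigma w) (sigmaS w)) ->
  (forall w, Cpw eta cs (f w)) ->
  (forall w, scalar_flux cs (sigma w) (sigmaS w) (f w) (phi w)) ->
  (forall w, largest_stable_width eta cs K c0 (sigma w) (sigmaS w) (hmax w)) ->
  0 < h -> sample_approximation eta cs rho c0 mu wt sigma sigmaS f hmax h Phi ->
  forall w, C01 (Phi w) /\ forall x : R, 0 <= x <= 1 ->
    `|phi w x - Phi w x| <= error_const eta c0 cs *
      (fine (pw_norm eta cs (f w)) * data_size eta cs (sigma w) (sigmaS w) ^+ 11) * h `^ eta.
Proof.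
move=> eta01 c01 cs01 K1 gauss adm fC Hphi Hhmax h0 approx w.
have [xs [xs_mesh xs_width HPhi]] := approx w.
have [[Hm0 stable] _] := Hhmax w.
move: HPhi; rewrite -xs_width => HPhi.
have [[PhiC _] _] := HPhi; split=> // x x01.
have widthH : mesh_width xs <= hmax w by rewrite xs_width ge_min lexx orbT.
apply: (le_trans (pathwise_error eta01 c01 cs01 (adm w) (fC w) (Hphi w) K1 Hm0 stable xs_mesh widthH
  (gauss _) HPhi x01)).
have /andP[e0 _] := eta01.
have Z0 := le_trans ler01 (data_size_ge1 (adm w)).
apply: ler_wpM2l.
  exact: (mulr_ge0 (error_const_ge0 cs eta01 c01) (mulr_ge0 (fine_pw_norm_ge0 eta cs (f w)) (exprn_ge0 11 Z0))).
apply: ge0_ler_powR; rewrite ?nnegrE ?(ltW e0) ?(ltW h0)//.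
- by rewrite xs_width ltW// lt_min h0 Hm0.
- by rewrite xs_width ge_min lexx.
Qed.

Theorem theorem5p14 (R : realType) (d : measure_display)
    (Omega : measurableType d) (P : probability Omega R)
    (* partition 0 = c_1 < ... < c_J = 1, mesh regularity, quadrature rules *)
    (cs : seq R) (Hcs : itv_partition 0 1 cs)
    (rho : R) (Hrho : 1 <= rho)
    (mu wt : forall N : nat, 'I_N -> R)
    (Hgauss : forall N, gauss_legendre (mu N) (wt N))
    (* random data *)
    (eta : R) (Heta : 0 < eta < 1)
    (sigma sigmaS f : Omega -> R -> R)
    (Hsigma_rf : random_field sigma) (HsigmaS_rf : random_field sigmaS)
    (Hf_rf : random_field f)
    (Hadm : forall w, admissible eta cs (sigma w) (sigmaS w))
    (Ha : forall t : R, 1 <= t ->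
       bochner P (Cpw eta cs) (pw_norm eta cs) t%:E sigma /\
       bochner P (Cpw eta cs) (pw_norm eta cs) t%:E sigmaS)
    (Hb : forall t : R, 1 <= t ->
       (fun w => (fmin (sigmaS w))^-1) \in Lfun P t%:E /\
       (fun w => (fmin (sigma w \- sigmaS w))^-1) \in Lfun P t%:E)
    (pstar : \bar R) (Hpstar : (2%:E < pstar)%E)
    (Hc : bochner P (Cpw eta cs) (pw_norm eta cs) pstar f)
    (* exact and approximate solutions *)
    (phi : Omega -> R -> R)
    (Hphi : forall w, scalar_flux cs (sigma w) (sigmaS w) (f w) (phi w))
    (K : R) (HK : stability_constant eta cs rho K)
    (c0 : R) (Hc0 : 0 < c0)
    (HN : forall h : R, 0 < h <= 1 -> 1 <= ln ((N_of eta c0 h)%:R : R))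
    (hmax : Omega -> R)
    (Hhmax : forall w,
       largest_stable_width eta cs K c0 (sigma w) (sigmaS w) (hmax w))
    (Phi : R -> Omega -> R -> R)
    (* quantity of interest *)
    (p : R) (Hp : 2 < p) (Hppstar : (p%:E < pstar)%E)
    (q : R) (Hq : q = 2 * p / (p - 2))
    (calQ : (R -> R) -> R) (C' : Omega -> R) (HC' : C' \in Lfun P q%:E)
    (HLip : forall u v : Omega -> R -> R,
       bochner P Linf Linfnorm p%:E u -> bochner P Linf Linfnorm p%:E v ->
       (forall w, C01 (u w)) -> (forall w, C01 (v w)) ->
       {ae P, forall w, (`|calQ (u w) - calQ (v w)|%:E <=
                         (C' w)%:E * supnorm unit_itv (u w \- v w)%R)%E})
    (h0 s : R) (Hh0 : 0 < h0 < 1) (Hs : 0 < s < 1) :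
  let Q := fun w => calQ (phi w) in
  let Qh := fun h w => calQ (Phi h w) in
  let hs := fun l : nat => s ^+ l * h0 in
  let is_approx := fun h =>
    sample_approximation eta cs rho c0 mu wt sigma sigmaS f hmax h (Phi h) in
  (exists C : R, forall h : R, 0 < h < 1 -> is_approx h ->
     (`|'E_P[Q \- Qh h]| <= (C * h `^ eta)%:E)%E) /\
  ((forall l, is_approx (hs l)) ->
   exists C : R, forall l,
     ('V_P[level_difference Qh hs l] <= (C * (hs l) `^ (2 * eta))%:E)%E).
Proof.
move=> Q Qh hs is_approx.
have h11 : 0 < (1 : R) <= 1 by rewrite ltr01 lexx.
have c01 := N_of_c0 Hc0 (HN 1 h11).
have K1 : 1 <= K by case: HK.
have fC : forall w, Cpw eta cs (f w) by case: Hc.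
have phiC w : C01 (phi w) by case: (Hphi w).
have p0 : 0 < p by apply: lt_trans Hp.
have [Kl Kl0 lip] := functional_lipschitz p0 HLip.
have [G [mG G0 Gfin AG]] := error_size_moment Hcs Hadm Ha Hb Hc Hp Hppstar.
pose A := error_size eta cs sigma sigmaS f.
have A0 w : 0 <= A w.
  exact: (mulr_ge0 (fine_pw_norm_ge0 eta cs (f w)) (exprn_ge0 11 (le_trans ler01 (data_size_ge1 (Hadm w))))).
have [I GI] : exists I, (\int[P]_w (G w)%:E = I%:E)%E.
  exists (fine (\int[P]_w (G w)%:E)%E); rewrite fineK// ge0_fin_numE//.
  by apply: integral_ge0 => w _; rewrite lee_fin.
have [EC EC0 ECE] : exists2 EC : R, 0 <= EC & error_const eta c0 cs = EC.
  by exists (error_const eta c0 cs) => //; exact: error_const_ge0.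
have err (h : R) : 0 < h -> is_approx h -> forall w, C01 (Phi h w) /\
    `|Q w - Qh h w| <= Kl * EC * h `^ eta * A w.
  move=> hp happ w.
  have [PhiC H] := approximation_error Heta c01 Hcs K1 Hgauss Hadm fC Hphi Hhmax hp happ w.
  split=> //; rewrite /Q /Qh.
  apply: (le_trans (lip _ _ _ (phiC w) PhiC H)).
  by rewrite le_eqVlt; apply/orP; left; apply/eqP; rewrite /A /error_size ECE; ring.
have h_le (x a : R) : 0 <= x -> 0 <= a -> x * a <= x * (1 + a) by move=> x0 a0; rewrite ler_wpM2l// lerDr.
split.
  exists (Kl * EC * (2 + I)) => h /andP[hp h1] happ.
  have k0 : 0 <= Kl * EC * h `^ eta by rewrite !mulr_ge0 ?powR_ge0.
  rewrite mulrAC.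
  apply: (expectation_le mG G0 AG GI k0) => w.
  by have [_ H] := err h hp happ w; apply: (le_trans H); exact: h_le.
move=> happ.
have /andP[s0 s1] := Hs; have /andP[h00 h01] := Hh0.
have hs0 l : 0 < hs l by rewrite /hs mulr_gt0// exprn_gt0.
(* The first summand serves two consecutive levels, where the coarser width costs a factor s^(-eta).
   The second serves level 0, whose difference is [Qh] itself and not small; the factor h0^(-eta)
   writes a constant as a multiple of the rate at [h0]. *)
pose D := Kl * EC * (1 + s `^ (- eta)) + (`|calQ (fun=> 0)| + Kl * (1 + EC)) * h0 `^ (- eta).
have se0 : 0 <= 1 + s `^ (- eta) by rewrite addr_ge0 ?powR_ge0.
have D1 : 0 <= Kl * EC * (1 + s `^ (- eta)) by rewrite !mulr_ge0.
have D2 : 0 <= (`|calQ (fun=> 0)| + Kl * (1 + EC)) * h0 `^ (- eta).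
  by rewrite mulr_ge0 ?powR_ge0// addr_ge0// mulr_ge0// addr_ge0.
have D0 : 0 <= D by exact: addr_ge0.
have level l w : `|level_difference Qh hs l w| <= D * hs l `^ eta * (1 + A w).
  have t0 : 0 <= hs l `^ eta * (1 + A w) by rewrite mulr_ge0 ?powR_ge0// addr_ge0.
  rewrite -mulrA /D mulrDl; case: l t0 => [|l] t0; rewrite /level_difference.
    rewrite subr0.
    apply: (@le_trans _ _ ((`|calQ (fun=> 0)| + Kl * (1 + EC)) * h0 `^ (- eta) * (hs 0%N `^ eta * (1 + A w)))).
      2: by rewrite lerDr mulr_ge0.
    have -> : (`|calQ (fun=> 0)| + Kl * (1 + EC)) * h0 `^ (- eta) * (hs 0%N `^ eta * (1 + A w)) =
       (`|calQ (fun=> 0)| + Kl * (1 + EC)) * (1 + A w).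
      by rewrite /hs expr0 mul1r powRN; field; rewrite gt_eqF// powR_gt0.
    have [PhiC e1] := err _ (hs0 0%N) (happ 0%N) w.
    have zC : C01 (fun=> 0 : R) by apply: within_cont_of_cont; exact: contC.
    (* At level 0 the functional is compared with its value at the zero field, so [A] must also
       dominate the flux itself; F Z^3 <= F Z^11 because Z >= 1. *)
    have phi_le (x : R) : 0 <= x <= 1 -> `|phi w x - 0| <= A w.
      move=> x01; rewrite subr0.
      apply: (le_trans (flux_le_bound Hcs (Hadm w) (fC w) (Hphi w) x01)).
      apply: (le_trans (flux_bound_le Hcs (f w) (Hadm w))).
      rewrite /A /error_size ler_wpM2l ?fine_pw_norm_ge0//.
      by apply: ler_weXn2l => //; exact: data_size_ge1 (Hadm w).
    have e2 := lip _ _ _ (phiC w) zC phi_le.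
    have e3 : Kl * EC * hs 0%N `^ eta * A w <= Kl * EC * A w.
      rewrite ler_wpM2r// ler_piMr ?mulr_ge0//.
      have e0 : 0 <= eta by case/andP: Heta => /ltW.
      rewrite /hs expr0 mul1r.
      have := ge0_ler_powR e0 (_ : h0 \in Num.nneg) (_ : 1 \in Num.nneg) (ltW h01).
      by rewrite powR1 !nnegrE ler01 (ltW h00); apply.
    have tri : `|Qh (hs 0%N) w| <= `|Q w - Qh (hs 0%N) w| + `|Q w - calQ (fun=> 0)| + `|calQ (fun=> 0)|.
      have {1}-> : Qh (hs 0%N) w = - (Q w - Qh (hs 0%N) w) + (Q w - calQ (fun=> 0)) + calQ (fun=> 0) by ring.
      apply: (le_trans (ler_normD _ _)); rewrite lerD2r.
      by apply: (le_trans (ler_normD _ _)); rewrite normrN.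
    apply: (le_trans tri).
    have e4 : 0 <= `|calQ (fun=> 0)| * A w by rewrite mulr_ge0.
    have e5 : 0 <= Kl * (1 + EC) by rewrite mulr_ge0// addr_ge0.
    have -> : (`|calQ (fun=> 0)| + Kl * (1 + EC)) * (1 + A w) =
      `|calQ (fun=> 0)| + `|calQ (fun=> 0)| * A w + Kl * (1 + EC) + (Kl * A w + Kl * EC * A w) by ring.
    move: (le_trans e1 e3) e2 e4 e5; rewrite -/(Q w).
    by move: (`|calQ _| * _) (Kl * EC * _) (Kl * (1 + _)) (Kl * A w) => *; lra.
  apply: (@le_trans _ _ (Kl * EC * (1 + s `^ (- eta)) * (hs l.+1 `^ eta * (1 + A w)))).
    2: by rewrite lerDl mulr_ge0.
  have [_ e1] := err _ (hs0 l.+1) (happ l.+1) w.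
  have [_ e2] := err _ (hs0 l) (happ l) w.
  have hsE : hs l `^ eta = s `^ (- eta) * hs l.+1 `^ eta.
    rewrite /hs exprS -mulrA [(s * _) `^ eta]powRM ?(ltW s0) ?mulr_ge0 ?exprn_ge0 ?(ltW s0) ?(ltW h00)//.
    by rewrite powRN mulrA mulVf ?mul1r// gt_eqF// powR_gt0.
  have -> : Qh (hs l.+1) w - Qh (hs l) w = - (Q w - Qh (hs l.+1) w) + (Q w - Qh (hs l) w) by ring.
  apply: (le_trans (ler_normD _ _)); rewrite normrN.
  apply: (le_trans (lerD e1 e2)).
  rewrite hsE.
  have -> : Kl * EC * hs l.+1 `^ eta * A w + Kl * EC * (s `^ (- eta) * hs l.+1 `^ eta) * A w =
    Kl * EC * (1 + s `^ (- eta)) * hs l.+1 `^ eta * A w by ring.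
  by rewrite [leRHS]mulrA h_le// mulr_ge0// powR_ge0.
exists (D ^+ 2 * (4 * (1 + I) + 2 * (2 + I) ^+ 2)) => l.
have k0 : 0 <= D * hs l `^ eta by rewrite mulr_ge0 ?powR_ge0.
apply: (le_trans (variance_le A0 mG G0 AG GI k0 (level l))).
rewrite lee_fin mulrC (mulrC 2 eta) powRrM powR_mulrn ?powR_ge0// exprMn le_eqVlt; apply/orP; left; apply/eqP; ring.
Qed.
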